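(* Let $G$ be a closed braid graph (with its outermost strand cut) with its outermost connected component (the one containing the cut edge) designated special. Let $\mathtt s$ be the layer framing defined in the context, and let $G^{\mathtt s}$ denote $G$ with this framing. Then $$\mathcal{B}(G^{\mathtt s})\cong\mathcal{A}(G),$$ where $\mathcal{A}$ is the alternative knot Floer graph homology of Gilmore's earlier work on the knot Floer cube of resolutions (described in the context).
   Context: **Ground ring.** $\mathcal{R}=\mathbb{F}[t^{-1},t]]$ is the ring of Laurent series in $t$ over a field $\mathbb{F}$. **Closed braid graphs.** Take an upward-oriented braid diagram on $b$ strands and replace each crossing by a thick edge (two incoming thin edges at its bottom vertex, two outgoing thin edges at its top vertex). Bivalent vertices are allowed on thin strands, and every connected component is required to contain a vertex of degree greater than one. Close all strands except the outermost one, which is left open (cut). The result is called a closed braid graph. **Framing $\mathtt s$.** A framing assigns an integer (number of half-twists relative to the blackboard framing) to each thin edge. Let $G$ be obtained, by replacing crossings with thick edges, from a braid diagram in which each crossing appears in a distinct horizontal layer. If there are $k$ thick edges between the incident thick edges of a given thin edge, assign the framing $k+1$ to that thin edge. The total framing on each strand is equal to the number of thick edges in $G$. This framing is called $\mathtt s$. **Edge ring and ideals.** Each thin edge $e$ with framing $\ell_e$ has variables $x_e$ (first segment) and $y_e$ (second segment), and $\mathcal{E}(G)=\mathcal{R}[x_e,y_e]/(t^{\ell_e}y_e-x_e)_e\cong\mathcal{R}[x_e]$. The linear ideal $L(G)\subset\mathcal{E}(G)$ is generated by $(x_a+x_b)-(y_c+y_d)$ for each thick edge with outgoing thin edges $a,b$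 and incoming thin edges $c,d$. The non-local ideal $N(G)\subset\mathcal{E}(G)$ is generated by $t^{\mathbf{w}(\Gamma)}x_{\Gamma,\mathrm{out}}-y_{\Gamma,\mathrm{in}}$ over all sets $\Gamma$ of thick edges and bivalent vertices, where $\mathbf{w}(\Gamma)$ is the sum of the framings of the thin edges with both endpoints in $\Gamma$, $x_{\Gamma,\mathrm{out}}$ is the product of the $x_e$ over thin edges leaving $\Gamma$ (to its complement or the top boundary), and $y_{\Gamma,\mathrm{in}}$ is the product of the $y_e$ over thin edges entering $\Gamma$ (from its complement or the bottom boundary). **Graph homology.** Let $V_G$ be the free $\mathcal{E}(G)$-module spanned by the non-special connected components of $G$. Then $$\mathcal{B}(G)=\mathrm{Tor}_*\big(\mathcal{E}(G)/L(G),\,\mathcal{E}(G)/N(G)\big)\otimes\Lambda^*V_G ,$$ with $\mathrm{Tor}$ taken over $\mathcal{E}(G)$. **The algebra $\mathcal{A}(G)$.** Let $\widehat G$ be the layered graph obtained from $G^{\mathtt s}$ by replacing each marking denoting a framing of $k$ by $k-1$ bivalent vertices. Then $\mathcal{A}(G)$ is the quotient of $\mathcal{R}[x_e: e\text{ a thin edge of }\widehat G]$ by the relations $t(x_a+x_b)=x_c+x_d$ for each thick edge (outgoing $a,b$, incoming $c,d$) and, for each set $\Gamma$ of thick edges and bivalent vertices of $\widehat G$, $t^{w(\Gamma)}\prod_{e\text{ out of }\Gamma}x_e=\prod_{e\text{ into }\Gamma}x_e$, where $w(\Gamma)$ is twice the number of thick edges plus the number of bivalent vertices in $\Gamma$.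 In the isomorphism, $\mathcal{A}(G)$ is placed in degree zero.
   Formalization: G is assumed to have at least one thick edge, and at most one bivalent vertex per strand at the height of each layer, away from its thick edge; otherwise the rule k+1 contradicts the stated total framing. The framing of the cut edge is split between its top and bottom parts. *)

(* Defs.v *)
From HB Require Import structures.
From mathcomp Require Import all_boot all_order all_algebra finmap.
From mathcomp Require Import zify.
From mathcomp Require Import boolp classical_sets fsbigop.
From mathcomp Require Import monalg mpoly.

Set Implicit Arguments.
Unset Strict Implicit.
Unset Printing Implicit Defensive.

Import Order.TTheory GRing.Theory Num.Theory.
Local Open Scope classical_set_scope.
Local Open Scope quotient_scope.
Local Open Scope ring_scope.

(* The field F((t)) of Laurent series, here only as a ring. *)
Section Laurent.
Variable F : fieldType.

Record laurent := Laurent {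
  lcoef :> int -> F;
  lcoef_bounded : exists N : nat, forall i : int, i < - N%:Z -> lcoef i = 0 }.

HB.instance Definition _ := gen_eqMixin laurent.
HB.instance Definition _ := gen_choiceMixin laurent.

Lemma laurent_eq (f g : laurent) : lcoef f =1 lcoef g -> f = g.
Proof.
case: f g => [f Pf] [g Pg] /= /funext E.
by subst g; congr Laurent; exact: Prop_irrelevance.
Qed.

Lemma lzero_bounded : exists N : nat, forall i : int, i < - N%:Z -> 0 = 0 :> F.
Proof. by exists 0%N. Qed.
Definition lzero := Laurent lzero_bounded.

Lemma lopp_bounded (f : laurent) :
  exists N : nat, forall i : int, i < - N%:Z -> - f i = 0.
Proof. by have [N fN] := lcoef_bounded f; exists N => i /fN ->; rewrite oppr0. Qed.
Definition lopp f := Laurent (lopp_bounded f).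

Lemma ladd_bounded (f g : laurent) :
  exists N : nat, forall i : int, i < - N%:Z -> f i + g i = 0.
Proof.
have [N fN] := lcoef_bounded f; have [M gM] := lcoef_bounded g.
exists (N + M)%N => i iNM.
by rewrite fN ?gM ?addr0 // (lt_le_trans iNM) // lerN2 lez_nat ?leq_addl ?leq_addr.
Qed.
Definition ladd f g := Laurent (ladd_bounded f g).

Lemma tpow_bounded (n : int) :
  exists N : nat, forall i : int, i < - N%:Z -> (i == n)%:R = 0 :> F.
Proof.
by exists `|n|%N => i iN; case: eqP => // E; exfalso; lia.
Qed.
(* t ^ n *)
Definition tpow n := Laurent (tpow_bounded n).

(* The support of i |-> f i * g (k - i) is finite. *)
Definition lconv (f g : int -> F) (k : int) : F :=
  \sum_(i \in [set: int]) f i * g (k - i).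

Let trunc (N D : nat) (f : int -> F) : {poly F} :=
  \poly_(i < D) f (i%:Z - N%:Z).

Let lconvE (f g : int -> F) (N M K D : nat) :
  (forall i : int, i < - N%:Z -> f i = 0) ->
  (forall i : int, i < - M%:Z -> g i = 0) -> (K < D)%N ->
  lconv f g (K%:Z - (N + M)%:Z) = (trunc N D f * trunc M D g)`_K.
Proof.
move=> fN gM KD; rewrite coefM /lconv.
pose h (i : nat) : int := i%:Z - N%:Z.
have hK : injective h by move=> i j; rewrite /h; lia.
rewrite (fsbigE [seq h i | i <- iota 0 K.+1]) //; first last.
- move=> i _ Hi; change int in (type of i); have [/fN ->|Ni] := ltP i (- N%:Z); first by rewrite mul0r.
  have [Ki|iK] := ltP (K%:Z - N%:Z) i; first by rewrite gM ?mulr0 //; lia.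
  case/negP: Hi; apply/mapP; exists (absz (i + N%:Z)); first by rewrite mem_iota; lia.
  by rewrite /h; lia.
- by rewrite map_inj_uniq // iota_uniq.
rewrite big_map -[iota 0 K.+1]/(index_iota 0 K.+1) big_mkord.
apply: eq_big => [i|i _]; first by rewrite in_setT.
rewrite !coef_poly (leq_trans (ltn_ord i) KD) (leq_ltn_trans (leq_subr i K) KD).
by congr (_ * g _); rewrite /h; have := ltn_ord i; lia.
Qed.

Let lconv_bounded0 (f g : int -> F) (N M : nat) (k : int) :
  (forall i : int, i < - N%:Z -> f i = 0) ->
  (forall i : int, i < - M%:Z -> g i = 0) ->
  k < - (N + M)%:Z -> lconv f g k = 0.
Proof.
move=> fN gM kNM; rewrite /lconv fsbig1 // => i _.
have [/fN ->|Ni] := ltP i (- N%:Z); first by rewrite mul0r.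
by rewrite gM ?mulr0 //; lia.
Qed.

Lemma lmul_bounded (f g : laurent) :
  exists N : nat, forall i : int, i < - N%:Z -> lconv f g i = 0.
Proof.
have [N fN] := lcoef_bounded f; have [M gM] := lcoef_bounded g.
by exists (N + M)%N => i; exact: lconv_bounded0.
Qed.
Definition lmul f g := Laurent (lmul_bounded f g).

Let laddA : associative ladd.
Proof. by move=> f g h; apply: laurent_eq => i /=; rewrite addrA. Qed.
Let laddC : commutative ladd.
Proof. by move=> f g; apply: laurent_eq => i /=; rewrite addrC. Qed.
Let ladd0 : left_id lzero ladd.
Proof. by move=> f; apply: laurent_eq => i /=; rewrite add0r. Qed.
Let laddN : left_inverse lzero lopp ladd.
Proof. by move=> f; apply: laurent_eq => i /=; rewrite addNr. Qed.

HB.instance Definition _ :=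
  GRing.isZmodule.Build laurent laddA laddC ladd0 laddN.

Let intE (k : int) (N : nat) : - N%:Z <= k -> exists K : nat, k = K%:Z - N%:Z.
Proof. by move=> Nk; exists (absz (k + N%:Z)); lia. Qed.

Let trunc_lconv (f g : int -> F) (N M D i : nat) :
  (forall i : int, i < - N%:Z -> f i = 0) ->
  (forall i : int, i < - M%:Z -> g i = 0) -> (i < D)%N ->
  (trunc (N + M) D (lconv f g))`_i = (trunc N D f * trunc M D g)`_i.
Proof. by move=> fN gM iD; rewrite coef_poly iD -lconvE. Qed.

Let lmulA : associative lmul.
Proof.
move=> f g h; apply: laurent_eq => k /=.
have [A fA] := lcoef_bounded f; have [B gB] := lcoef_bounded g.
have [C hC] := lcoef_bounded h.
have gh i := @lconv_bounded0 g h B C i gB hC.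
have fg i := @lconv_bounded0 f g A B i fA gB.
have [kl|/intE [K ->]] := ltP k (- (A + B + C)%:Z).
  by rewrite (lconv_bounded0 fA gh) ?(lconv_bounded0 fg hC) // addnA.
rewrite [RHS](lconvE fg hC (ltnSn K)) -[in LHS]addnA (lconvE fA gh (ltnSn K)).
rewrite coefM [in RHS]coefM.
transitivity (trunc A K.+1 f * (trunc B K.+1 g * trunc C K.+1 h))`_K.
  rewrite coefM; apply: eq_bigr => i _; congr (_ * _).
  by rewrite trunc_lconv // ltnS leq_subr.
rewrite mulrA coefM; apply: eq_bigr => i _; congr (_ * _).
by rewrite trunc_lconv.
Qed.

Let lmulC : commutative lmul.
Proof.
move=> f g; apply: laurent_eq => k /=.
have [A fA] := lcoef_bounded f; have [B gB] := lcoef_bounded g.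
have [kl|/intE [K ->]] := ltP k (- (A + B)%:Z).
  by rewrite (lconv_bounded0 fA gB) ?(lconv_bounded0 gB fA) // addnC.
by rewrite (lconvE fA gB (ltnSn K)) addnC (lconvE gB fA (ltnSn K)) mulrC.
Qed.

Let lmul1 : left_id (tpow 0) lmul.
Proof.
move=> f; apply: laurent_eq => k; rewrite /= /lconv (fsbigE [:: 0]) //.
  by rewrite big_cons big_nil in_setT addr0 eqxx mul1r; exact: addr0.
by move=> i _; rewrite inE => /negPf ->; rewrite mul0r.
Qed.

Let lmulDl : left_distributive lmul +%R.
Proof.
move=> f g h; apply: laurent_eq => k /=.
have [A0 fA0] := lcoef_bounded f; have [B0 gB0] := lcoef_bounded g.
have [C hC] := lcoef_bounded h; pose A := (A0 + B0)%N.
have fA (i : int) : i < - A%:Z -> f i = 0.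
  by move=> iA; apply: fA0; move: iA; rewrite /A; lia.
have gA (i : int) : i < - A%:Z -> g i = 0.
  by move=> iA; apply: gB0; move: iA; rewrite /A; lia.
have fgA (i : int) : i < - A%:Z -> (f + g) i = 0 by move=> iA /=; rewrite fA ?gA ?addr0.
have [kl|/intE [K ->]] := ltP k (- (A + C)%:Z).
  by rewrite !(lconv_bounded0 _ hC kl) // addr0.
rewrite !(lconvE _ hC (ltnSn K)) // -coefD -mulrDl.
suff -> : trunc A K.+1 (f + g) = trunc A K.+1 f + trunc A K.+1 g by [].
by apply/polyP => i; rewrite coefD !coef_poly; case: ifP; rewrite ?addr0.
Qed.

Let lone_neq0 : tpow 0 != 0.
Proof. by apply/eqP => /(congr1 (fun f : laurent => f 0)) /= /eqP; rewrite oner_eq0. Qed.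

HB.instance Definition _ := GRing.Zmodule_isComNzRing.Build laurent
  lmulA lmulC lmul1 lmulDl lone_neq0.

End Laurent.


Section Span.
Variables (E : comNzRingType) (M : lmodType E).

Definition is_submodule (U : set M) :=
  U 0 /\ forall (a : E) x y, U x -> U y -> U (a *: x + y).

Definition gen (S : set M) : {pred M} :=
  fun x => `[< forall U : set M, is_submodule U -> S `<=` U -> U x >].

Variable S : set M.

Lemma gen_submod_closed : submod_closed (gen S).
Proof.
split=> [|a x y /asboolP Sx /asboolP Sy]; apply/asboolP => U sU SU.
  by case: sU.
by case: (sU) => _; apply; [exact: Sx | exact: Sy].
Qed.
HB.instance Definition _ :=
  GRing.isSubmodClosed.Build E M (gen S) gen_submod_closed.

Lemma gen_incl x : S x -> x \in gen S.
Proof. by move=> Sx; apply/asboolP => U _; apply. Qed.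

Lemma gen_sub (U : set M) x : is_submodule U -> S `<=` U -> x \in gen S -> U x.
Proof. by move=> sU SU /asboolP; apply. Qed.

(* The submodule spanned by S, as a type. *)
Record submod := Submod { submod_val : M; submod_valP : submod_val \in gen S }.
HB.instance Definition _ := [isSub for submod_val].
HB.instance Definition _ := [Choice of submod by <:].
HB.instance Definition _ := [SubChoice_isSubLmodule of submod by <:].

Definition quot_rel : rel M := fun x y => x - y \in gen S.
Lemma quot_rel_equiv : equiv_class_of quot_rel.
Proof.
split=> [x|x y|y x z]; rewrite /quot_rel ?subrr ?rpred0 //.
  by rewrite -rpredN opprB.
by move=> xy yz; rewrite -(subrKA y) rpredD.
Qed.
Canonical quot_equiv := EquivRelPack quot_rel_equiv.
Canonical quot_encModRel := defaultEncModRel quot_rel.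

(* M modulo the submodule spanned by S. *)
Definition quot := {eq_quot quot_rel}.
HB.instance Definition _ := EqQuotient.on quot.
HB.instance Definition _ := Choice.on quot.

Definition toquot (x : M) : quot := \pi_quot x.

Lemma toquotP x y : reflect (toquot x = toquot y) (x - y \in gen S).
Proof. exact: eqquotP. Qed.

Lemma toquot_repr (q : quot) : toquot (repr q) = q.
Proof. exact: reprK. Qed.

Definition quot0 : quot := toquot 0.
Definition quotN (p : quot) : quot := toquot (- repr p).
Definition quotD (p q : quot) : quot := toquot (repr p + repr q).
Definition quotZ (a : E) (p : quot) : quot := toquot (a *: repr p).

Let repr_toquot x : repr (toquot x) - x \in gen S.
Proof. by apply/toquotP; rewrite toquot_repr. Qed.

Let toquotN x : quotN (toquot x) = toquot (- x).
Proof. by apply/toquotP; rewrite -opprD rpredN. Qed.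
Let toquotD x y : quotD (toquot x) (toquot y) = toquot (x + y).
Proof. by apply/toquotP; rewrite opprD addrACA rpredD. Qed.
Let toquotZ a x : quotZ a (toquot x) = toquot (a *: x).
Proof. by apply/toquotP; rewrite -scalerBr rpredZ. Qed.

Let quot_ind (P : quot -> Prop) : (forall x, P (toquot x)) -> forall q, P q.
Proof. by move=> Px q; rewrite -(toquot_repr q). Qed.

Let quotDA : associative quotD.
Proof.
by elim/quot_ind => x; elim/quot_ind => y; elim/quot_ind => z; rewrite !toquotD addrA.
Qed.
Let quotDC : commutative quotD.
Proof. by elim/quot_ind => x; elim/quot_ind => y; rewrite !toquotD addrC. Qed.
Let quot0D : left_id quot0 quotD.
Proof. by elim/quot_ind => x; rewrite toquotD add0r. Qed.
Let quotND : left_inverse quot0 quotN quotD.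
Proof. by elim/quot_ind => x; rewrite toquotN toquotD addNr. Qed.

HB.instance Definition _ := GRing.isZmodule.Build quot quotDA quotDC quot0D quotND.

Let quotZA a b p : quotZ a (quotZ b p) = quotZ (a * b) p.
Proof. by elim/quot_ind: p => x; rewrite !toquotZ scalerA. Qed.
Let quot1Z : left_id 1 quotZ.
Proof. by elim/quot_ind => x; rewrite toquotZ scale1r. Qed.
Let quotZDr : right_distributive quotZ +%R.
Proof.
move=> a; elim/quot_ind => x; elim/quot_ind => y.
by rewrite -[_ + _]/(quotD _ _) -[RHS]/(quotD _ _) !(toquotD, toquotZ) scalerDr.
Qed.
Let quotZDl p : {morph quotZ^~ p : a b / a + b}.
Proof.
move=> a b; elim/quot_ind: p => x.
by rewrite -[RHS]/(quotD _ _) !(toquotD, toquotZ) scalerDl.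
Qed.

HB.instance Definition _ :=
  GRing.Zmodule_isLmodule.Build E quot quotZA quot1Z quotZDr quotZDl.

Lemma toquot_is_linear : linear toquot.
Proof. by move=> a x y; rewrite -toquotD -toquotZ. Qed.
HB.instance Definition _ :=
  GRing.isLinear.Build E M quot *:%R toquot toquot_is_linear.

End Span.

Section QuotientRing.
Variables (R : comNzRingType) (S : set R^o).

(* R modulo the ideal generated by S; possibly the zero ring. *)
Definition quot_ring := quot S.
HB.instance Definition _ := GRing.Zmodule.on quot_ring.

Definition toquot_ring (x : R) : quot_ring := toquot S x.

Definition quot1 : quot_ring := toquot_ring 1.
Definition quotM (p q : quot_ring) : quot_ring := toquot_ring (repr p * repr q).

Let toquotM (x y : R) : quotM (toquot_ring x) (toquot_ring y) = toquot_ring (x * y).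
Proof.
apply/toquotP; set x' : R := repr _; set y' : R := repr _.
have xS : x' - x \in gen S by apply/toquotP; rewrite toquot_repr.
have yS : y' - y \in gen S by apply/toquotP; rewrite toquot_repr.
have -> : x' * y' - x * y = (y' : R) *: (x' - x : R^o) + (x : R) *: (y' - y : R^o).
  by rewrite /GRing.scale /= mulrBr [y' * x']mulrC [y' * x]mulrC mulrBr addrA subrK.
by rewrite rpredD ?rpredZ.
Qed.

Let quot_ring_ind (P : quot_ring -> Prop) :
  (forall x, P (toquot_ring x)) -> forall q, P q.
Proof. by move=> Px q; rewrite -(toquot_repr q); exact: Px. Qed.

Let quotMA : associative quotM.
Proof.
elim/quot_ring_ind => x; elim/quot_ring_ind => y; elim/quot_ring_ind => z.
by rewrite !toquotM mulrA.
Qed.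
Let quotMC : commutative quotM.
Proof. by elim/quot_ring_ind => x; elim/quot_ring_ind => y; rewrite !toquotM mulrC. Qed.
Let quot1M : left_id quot1 quotM.
Proof. by elim/quot_ring_ind => x; rewrite toquotM mul1r. Qed.
Let toquot_ringD x y : toquot_ring (x + y) = toquot_ring x + toquot_ring y.
Proof. exact: (raddfD (toquot S)). Qed.
Let quotMDl : left_distributive quotM +%R.
Proof.
elim/quot_ring_ind => x; elim/quot_ring_ind => y; elim/quot_ring_ind => z.
by rewrite -toquot_ringD !toquotM mulrDl toquot_ringD.
Qed.

HB.instance Definition _ :=
  GRing.Zmodule_isComPzRing.Build quot_ring quotMA quotMC quot1M quotMDl.

Lemma toquot_ring_is_zmod_morphism : zmod_morphism toquot_ring.
Proof. exact: (raddfB (toquot S)). Qed.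
Lemma toquot_ring_is_monoid_morphism : monoid_morphism toquot_ring.
Proof. by split=> // x y; rewrite -[RHS]/(quotM _ _) toquotM. Qed.
HB.instance Definition _ :=
  GRing.isZmodMorphism.Build R quot_ring toquot_ring toquot_ring_is_zmod_morphism.
HB.instance Definition _ :=
  GRing.isMonoidMorphism.Build R quot_ring toquot_ring toquot_ring_is_monoid_morphism.

End QuotientRing.

Section Multilinear.
Variable E : comNzRingType.

Definition free_lift (S : choiceType) (M : lmodType E) (g : S -> M)
    (z : {malg E[S]}) : M := \sum_(s <- monalg.msupp z) monalg.mcoeff s z *: g s.

Definition tensor_rel (M N : lmodType E) : set {malg E[(M * N)%type]} :=
  [set z | (exists a m m' n,
              z = << (a *: m + m', n) >> - a *: << (m, n) >> - << (m', n) >>)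
        \/ (exists a m n n',
              z = << (m, a *: n + n') >> - a *: << (m, n) >> - << (m, n') >>)].

Definition tensor (M N : lmodType E) : lmodType E := quot (@tensor_rel M N).

Definition pure (M N : lmodType E) (m : M) (n : N) : tensor M N :=
  toquot _ << (m, n) >>.

(* f \otimes id_N; it is meaningful for linear f. *)
Definition tensor_mapl (M M' N : lmodType E) (f : M -> M') (z : tensor M N) :
    tensor M' N :=
  free_lift (fun p : M * N => pure (f p.1) p.2) (repr z).

Definition upd (j : nat) (V : lmodType E) (w : {ffun 'I_j -> V}) (i : 'I_j) (v : V) :=
  [ffun k => if k == i then v else w k].

Definition exterior_rel (j : nat) (V : lmodType E) : set {malg E[{ffun 'I_j -> V}]} :=
  [set z | (exists w i a v v',
              z = << upd w i (a *: v + v') >> - a *: << upd w i v >> - << upd w i v' >>)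
        \/ (exists (w : {ffun 'I_j -> V}) i k,
              [/\ i != k, w i = w k & z = << w >>])].

Definition exterior (j : nat) (V : lmodType E) : lmodType E :=
  quot (@exterior_rel j V).

(* The canonical free resolution of M: the 0-th syzygy is M, and the (n+1)-st is
   the kernel of the surjection onto the n-th one from the free module spanned
   by its elements.  The sets given to submod below are already submodules, so
   it does not enlarge them. *)
Fixpoint syzygy (M : lmodType E) (n : nat) : lmodType E :=
  if n is n'.+1 then
    submod [set z : {malg E[syzygy M n']} | free_lift id z = 0]
  else M.

Definition resolution (M : lmodType E) (n : nat) : lmodType E := {malg E[syzygy M n]}.

Definition resolution_diff (M : lmodType E) (n : nat) :
    resolution M n.+1 -> resolution M n :=
  free_lift (fun z : syzygy M n.+1 => submod_val z).

Definition tor_diff (M N : lmodType E) (n : nat) :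
    tensor (resolution M n.+1) N -> tensor (resolution M n) N :=
  tensor_mapl (@resolution_diff M n).

Definition tor_cycles (M N : lmodType E) (n : nat) :
    set (tensor (resolution M n) N) :=
  match n with
  | 0 => setT
  | n'.+1 => [set z | @tor_diff M N n' z = 0]
  end.

Definition tor_boundaries (M N : lmodType E) (n : nat) :
    set (submod (@tor_cycles M N n)) :=
  [set z | exists y, submod_val z = @tor_diff M N n y].

Definition tor (n : nat) (M N : lmodType E) : lmodType E :=
  quot (@tor_boundaries M N n).

End Multilinear.

(* A thin edge with no tail starts at the bottom boundary, one with no head ends
   at the top boundary.  A thick edge counts as a single vertex, whose out-edges
   leave its top and whose in-edges arrive at its bottom; a vertex that is not
   thick is bivalent. *)
Record graph := Graph {
  vertex : finType;
  edge : finType;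
  thick : pred vertex;
  tail : edge -> option vertex;
  head : edge -> option vertex }.

Section Graph.
Variable G : graph.
Implicit Types (Gam : {set vertex G}) (e : edge G) (v : vertex G).

Definition tail_in Gam e := if tail e is Some v then v \in Gam else false.
Definition head_in Gam e := if head e is Some v then v \in Gam else false.
Definition inner Gam : {pred edge G} := [pred e | tail_in Gam e && head_in Gam e].
Definition leaving Gam : {pred edge G} := [pred e | tail_in Gam e && ~~ head_in Gam e].
Definition entering Gam : {pred edge G} := [pred e | head_in Gam e && ~~ tail_in Gam e].

Definition adjacent : rel (vertex G) := fun u v =>
  [exists e, ((tail e == Some u) && (head e == Some v))
          || ((tail e == Some v) && (head e == Some u))].

Definition component v : {set vertex G} := [set u | connect adjacent v u]%SET.

(* The special component is the one that contains the cut edge. *)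
Definition special (C : {set vertex G}) :=
  [exists e, (tail_in C e && (head e == None)) || (head_in C e && (tail e == None))].

Definition nonspecial_components : {set {set vertex G}} :=
  [set C in [set component v | v : vertex G] | ~~ special C]%SET.

End Graph.

Section GraphHomology.
Variables (F : fieldType) (G : graph) (l : edge G -> int).

Local Notation P := {mpoly (laurent F)[#|{: edge G + edge G}|]}.

(* xvar e and yvar e (below) are the variables of the first and the last segment
   of e, as inl e and inr e here. *)
Definition edge_ring_rel : set P^o :=
  [set p | exists e : edge G,
      p = (tpow F (l e))%:MP * 'X_(enum_rank (inr e)) - 'X_(enum_rank (inl e))].

Definition edge_ring := quot_ring edge_ring_rel.
HB.instance Definition _ := GRing.ComPzRing.on edge_ring.

Lemma edge_ring_oner_neq0 : 1 != 0 :> edge_ring.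
Proof.
apply/eqP => /(@toquotP _ _ edge_ring_rel 1 0); rewrite subr0.
move=> /(@gen_sub _ _ _ [set p : P^o | (p : P).@[fun=> 0] = 0]).
rewrite /= meval1 => H; have := oner_neq0 (laurent F).
rewrite H ?eqxx //; first split => [|a x y /= x0 y0]; first exact: meval0.
  by rewrite mevalD mevalM x0 y0 mulr0 addr0.
by move=> _ [e ->] /=; rewrite mevalB mevalM !mevalXU mulr0 subrr.
Qed.
HB.instance Definition _ := GRing.PzSemiRing_isNonZero.Build edge_ring edge_ring_oner_neq0.

Definition edge_scalar (c : laurent F) : edge_ring := toquot_ring edge_ring_rel c%:MP.
Definition xvar (e : edge G) : edge_ring :=
  toquot_ring edge_ring_rel 'X_(enum_rank (inl e)).
Definition yvar (e : edge G) : edge_ring :=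
  toquot_ring edge_ring_rel 'X_(enum_rank (inr e)).

Definition linear_gens : set edge_ring^o :=
  [set p | exists2 v : vertex G, thick v &
      p = \sum_(e | tail e == Some v) xvar e - \sum_(e | head e == Some v) yvar e].

Definition framing_weight (Gam : {set vertex G}) : int := \sum_(e in inner Gam) l e.

Definition nonlocal_gens : set edge_ring^o :=
  [set p | exists Gam : {set vertex G},
      p = edge_scalar (tpow F (framing_weight Gam)) * \prod_(e in leaving Gam) xvar e
          - \prod_(e in entering Gam) yvar e].

Definition component_module : lmodType edge_ring :=
  {malg edge_ring[{C : {set vertex G} | C \in nonspecial_components G}]}.

(* The summand of Tor-degree i and exterior degree j; its homological degree is
   i + j. *)
Definition graph_homology (i j : nat) : lmodType edge_ring :=
  tensor (tor i (quot linear_gens) (quot nonlocal_gens)) (exterior j component_module).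

End GraphHomology.

Section GraphAlgebra.
Variables (F : fieldType) (G : graph).

Local Notation P := {mpoly (laurent F)[#|edge G|]}.
Local Notation "''x_' e" := ('X_(enum_rank e) : P) (at level 8, e at level 2).

Definition algebra_weight (Gam : {set vertex G}) : nat :=
  \sum_(v in Gam) (if thick v then 2 else 1).

Definition graph_algebra_rel : set P^o :=
  [set p | (exists2 v : vertex G, thick v &
              p = (tpow F 1)%:MP * (\sum_(e | tail e == Some v) 'x_e)
                  - \sum_(e | head e == Some v) 'x_e)
        \/ (exists Gam : {set vertex G},
              p = (tpow F (algebra_weight Gam))%:MP * (\prod_(e in leaving Gam) 'x_e)
                  - \prod_(e in entering Gam) 'x_e)].

Definition graph_algebra := quot_ring graph_algebra_rel.
HB.instance Definition _ := GRing.ComPzRing.on graph_algebra.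

Definition algebra_scalar (c : laurent F) : graph_algebra :=
  toquot_ring graph_algebra_rel c%:MP.
Definition algebra_var (e : edge G) : graph_algebra :=
  toquot_ring graph_algebra_rel 'x_e.

End GraphAlgebra.

(* Replaces each thin edge e by a chain of (l e).-1 bivalent vertices; the edges
   of the chain are numbered upwards from ord0. *)
Section Subdivision.
Variables (G : graph) (l : edge G -> nat).

Definition bead := {e : edge G & 'I_(l e).-1}.
Definition link := {e : edge G & 'I_(l e).-1.+1}.

Definition link_tail (a : link) : option (vertex G + bead) :=
  if unlift ord0 (tagged a) is Some i then
    Some (inr (Tagged (fun e => 'I_(l e).-1) i))
  else omap inl (tail (tag a)).

Definition link_head (a : link) : option (vertex G + bead) :=
  if unlift ord_max (tagged a) is Some i then
    Some (inr (Tagged (fun e => 'I_(l e).-1) i))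
  else omap inl (head (tag a)).

Definition subdivision : graph :=
  @Graph (vertex G + bead)%type link
    (fun v => if v is inl u then thick u else false) link_tail link_head.

Definition first_link (e : edge G) : edge subdivision :=
  @Tagged _ e (fun e => 'I_(l e).-1.+1) ord0.

End Subdivision.

Definition feet (w : nat) (i : 'I_w) : {set 'I_w.+1} :=
  [set s : 'I_w.+1 | (s == i :> nat) || (s == i.+1 :> nat)]%SET.

(* A closed braid graph on width.+1 strands drawn in layers numbered upwards,
   each of which contains a single thick edge, between the strands crossing k
   and (crossing k).+1; a bivalent vertex on a strand lies at the height of some
   layer, away from its thick edge.  Strand 0 is the outermost one, left open. *)
Record braid_graph := BraidGraph {
  width : nat;
  layers : nat;
  crossing : 'I_layers -> 'I_width;
  bivalent : 'I_layers -> {set 'I_width.+1};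
  bivalent_thin : forall k s, s \in bivalent k -> s \notin feet (crossing k);
  (* equivalently, every component has a vertex of degree greater than one *)
  strand_vertex : forall s, exists k, (s \in feet (crossing k)) || (s \in bivalent k) }.

Section ClosedBraid.
Variable B : braid_graph.
Local Notation strand := 'I_(width B).+1.
Local Notation layer := 'I_(layers B).

Definition occupied (k : layer) (s : strand) :=
  (s \in feet (crossing k)) || (s \in bivalent k).

Definition braid_vertex := (layer + {p : layer * strand | p.2 \in bivalent p.1})%type.

Definition vertex_at (s : strand) (k : layer) : option braid_vertex :=
  if s \in feet (crossing k) then Some (inl k : braid_vertex)
  else omap inr (insub (k, s) : option {p : layer * strand | p.2 \in bivalent p.1}).

Definition first_layer (s : strand) : option layer :=
  ohead [seq k <- enum layer | occupied k s].

Definition next_layer (k : layer) (s : strand) : option layer :=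
  ohead [seq j : layer <- enum layer | (k < j)%N && occupied j s].

(* Some (k, s) is the thin edge that leaves layer k along strand s; None is the
   one that enters strand 0 from the bottom boundary. *)
Definition braid_edge := option {p : layer * strand | occupied p.1 p.2}.

Definition braid_tail (e : braid_edge) : option braid_vertex :=
  if e is Some p then vertex_at (val p).2 (val p).1 else None.

Definition braid_head (e : braid_edge) : option braid_vertex :=
  if e is Some p then
    let: (k, s) := val p in
    if next_layer k s is Some j then vertex_at s j
    else if s == ord0 then None else obind (vertex_at s) (first_layer s)
  else obind (vertex_at ord0) (first_layer ord0).

Definition closed_braid : graph :=
  @Graph braid_vertex braid_edge (fun v => if v is inl _ then true else false)
    braid_tail braid_head.

(* One half-twist is placed on every strand just below each thick edge layer.
   Hence a thin edge between two vertices with k layers strictly between them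
   has framing k + 1, and so has the bottom edge with k layers below its head,
   while the top edge with k layers above its tail has framing k; this makes
   the total framing of every strand equal to the number of layers. *)
Definition layer_framing (e : edge closed_braid) : nat :=
  match e with
  | None => if first_layer ord0 is Some j then j.+1 else 0
  | Some p =>
      let: (k, s) := val p in
      if next_layer k s is Some j then (j - k)%N
      else if s == ord0 then (layers B - k.+1)%N
      else if first_layer s is Some j then (layers B - k.+1 + j.+1)%N else 0
  end.

Definition layered_graph : graph := subdivision layer_framing.

End ClosedBraid.

(* Main.v *)
(* If some component C of G is not special, the non-local relation of C reads
   t ^ w - 1 with w > 0, so that E(G) / N(G) is the zero ring and both sides
   vanish.  Otherwise the exterior factor is trivial, and it suffices that the
   generators of L(G) form a regular sequence both on E(G) and on E(G) / N(G):
   then Tor is concentrated in degree 0, where it is E(G) / (L(G) + N(G)), and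
   eliminating the bivalent vertices of the layered graph identifies this ring
   with A(G).

   Regularity is proved by letting t tend to 0.  After rescaling the variables,
   the relations of N(G) become Y_in(Gam) = t ^ k * Y_out(Gam) with k > 0, over
   F[[t]], and those of L(G) become sums of incoming edges, up to sign, modulo t.
   At t = 0 the ideal N(G) is generated by the squarefree monomials Y_in(Gam);
   these are the sets of edges that meet every path from the bottom boundary to
   some vertex, and deletion and contraction of an edge whose tail has been
   reached prove regularity by induction.  The special fibre controls the whole
   family because F[[t]][Y] / N(G) is t-torsion-free, each monomial having a
   normal form computed from shortest distances to the bottom boundary, and
   because the relations are homogeneous, so that t-adic approximations of
   bounded degree converge to polynomials. *)
From Pilot Require Import Defs.
From HB Require Import structures.
From mathcomp Require Import all_boot all_order all_algebra finmap.
From mathcomp Require Import zify ring.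
From mathcomp Require Import boolp classical_sets fsbigop.
From mathcomp Require Import monalg mpoly.
(* So that head and tail are those of a graph edge, and not those of a sequence. *)
Import Pilot.Defs.

Set Implicit Arguments.
Unset Strict Implicit.
Unset Printing Implicit Defensive.

Import Order.TTheory GRing.Theory Num.Theory.
Local Open Scope classical_set_scope.
Local Open Scope ring_scope.
(* The notation of monalg would otherwise take precedence over that of mpoly. *)
Local Notation "{ 'mpoly' R [ n ] }" := (mpoly n R) : type_scope.

(** * Regular sequences modulo an ideal *)

Section RegularSequences.
Variable P : comPzRingType.
Implicit Types (J : set P) (s : nat -> P).

(** Over Laurent series [t] is a unit, so [t = 0] makes sense only on a model over power series, and
    rescaling variables by powers of [t] chooses the model. Dividing [y_e] by [t] at the top edge
    compensates for the one edge whose framing may be 0: every outgoing variable then carries a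
    positive power of [t], and the outgoing half of each linear relation dies at [t = 0]. What
    survives is a sum over the two in-edges of a thick edge. That there are two lets the induction
    run: contracting one of them kills its variable, and the other keeps the sum nonzero.

    Deletion and contraction correspond to [J : y] and [J + (y)], whose quotients are the outer
    terms of an exact sequence around [P / J]. The same computation with [y = t] allows cancelling
    [t] during the lifting. *)

Definition is_ideal J := J 0 /\ forall a x y, J x -> J y -> J (a * x + y).

(* Membership in the ideal J + (s 0, ..., s (k - 1)). *)
Fixpoint ideal_plus J s k : set P :=
  if k is k'.+1 then [set x | exists b, ideal_plus J s k' (x - s k' * b)] else J.

(** Weak regularity: the quotient may become zero. The unit ideal does occur, as a base case of the
    induction on graphs. *)
Definition regular_mod J s n :=
  forall k a, (k < n)%N -> ideal_plus J s k (s k * a) -> ideal_plus J s k a.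

Section Ideal.
Variable J : set P.
Hypothesis idJ : is_ideal J.

Lemma idealD x y : J x -> J y -> J (x + y).
Proof. by case: idJ => _ HJ Jx Jy; rewrite -[x]mul1r; apply: HJ. Qed.
Lemma idealMl a x : J x -> J (a * x).
Proof. by case: idJ => J0 HJ Jx; rewrite -[_ * _]addr0; apply: HJ. Qed.
Lemma idealN x : J x -> J (- x).
Proof. by move=> Jx; rewrite -mulN1r; apply: idealMl. Qed.
Lemma idealB x y : J x -> J y -> J (x - y).
Proof. by move=> Jx Jy; apply: idealD => //; apply: idealN. Qed.
Lemma ideal_sum (I : Type) (r : seq I) (Q : pred I) (f : I -> P) :
  (forall i, Q i -> J (f i)) -> J (\sum_(i <- r | Q i) f i).
Proof.
by move=> Hf; elim/big_rec: _ => [|i x Qi Jx]; [case: idJ | apply: idealD; auto].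
Qed.
End Ideal.

Lemma ideal_plus_ideal J s k : is_ideal J -> is_ideal (ideal_plus J s k).
Proof.
move=> idJ; elim: k => //= k [U0 HU]; split; first by exists 0; rewrite mulr0 subr0.
move=> a x y [b xb] [c yc]; exists (a * b + c).
have -> : a * x + y - s k * (a * b + c) = a * (x - s k * b) + (y - s k * c) by ring.
exact: HU.
Qed.

Lemma ideal_plusW J s k m x : (k <= m)%N -> ideal_plus J s k x -> ideal_plus J s m x.
Proof.
move=> /subnK <-; elim: (m - k)%N => //= i IH xJ; exists 0; rewrite mulr0 subr0; exact: IH.
Qed.

Lemma ideal_plus_gen J s k i : is_ideal J -> (i < k)%N -> ideal_plus J s k (s i).
Proof.
by case=> J0 _ ik; apply: (ideal_plusW ik); exists 1; rewrite mulr1 subrr; apply: (@ideal_plusW _ _ 0%N).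
Qed.

Lemma ideal_plusS (J J' : set P) s k : J `<=` J' -> ideal_plus J s k `<=` ideal_plus J' s k.
Proof. by move=> JJ'; elim: k => //= k IH x [b xb]; exists b; apply: IH. Qed.

Lemma ideal_plusP J s k x :
  ideal_plus J s k x <-> exists b : nat -> P, J (x - \sum_(i < k) s i * b i).
Proof.
elim: k x => [|k IH] x /=.
  by split=> [Jx|[b]]; [exists (fun=> 0)|]; rewrite big_ord0 subr0.
split=> [[c] /IH [b Jb]|[b Jb]].
  exists (fun i => if i == k then c else b i); rewrite big_ord_recr /= eqxx.
  under eq_bigr => i _ do rewrite ltn_eqF //.
  by rewrite [X in _ - X]addrC opprD addrA.
exists (b k); apply/IH; exists b; move: Jb; rewrite big_ord_recr /= opprD.
by rewrite [- _ - _]addrC addrA.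
Qed.

Section Extension.
Variables (J J1 J2 : set P) (y : P) (s : nat -> P) (n : nat).
Hypotheses (idJ : is_ideal J) (idJ1 : is_ideal J1).
Hypothesis J1P : forall p, J (y * p) <-> J1 p.
Hypothesis J2P : forall p, J2 p <-> exists q, J (p - y * q).

(** In [y p = s_k b], read modulo the smaller ideal, the right side vanishes modulo [y]; regularity
    on [P / J2] then gives [b = y c], and [p - s_k c] falls to the induction. In other words,
    multiplication by [y] stays injective from [P / J1] to [P / J] after dividing by the
    sequence. *)
Lemma ideal_plus_colon k p : regular_mod J2 s n -> (k <= n)%N ->
  ideal_plus J s k (y * p) -> ideal_plus J1 s k p.
Proof.
move=> reg2; elim: k p => [p _ /J1P //|k IH p kn /= [b Hb]].
have idJk := ideal_plus_ideal s k idJ.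
have idJ2 : is_ideal J2.
  split=> [|a x z /J2P[q Hq] /J2P[r Hr]]; apply/J2P.
    by exists 0; rewrite mulr0 subr0; case: idJ.
  exists (a * q + r).
  have -> : a * x + z - y * (a * q + r) = a * (x - y * q) + (z - y * r) by ring.
  by case: idJ => _; apply.
have sub2 : ideal_plus J s k `<=` ideal_plus J2 s k.
  by apply: ideal_plusS => x Jx; apply/J2P; exists 0; rewrite mulr0 subr0.
have [c Hc] : exists c, ideal_plus J s k (b - y * c).
  have : ideal_plus J2 s k b.
    apply: reg2 => //; have yJ2 : ideal_plus J2 s k (y * p).
      by apply: (@ideal_plusW _ _ 0%N) => //; apply/J2P; exists p; rewrite subrr; case: idJ.
    by have := idealB (ideal_plus_ideal s k idJ2) yJ2 (sub2 _ Hb); rewrite subKr.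
  move=> /ideal_plusP[d /J2P[q Jq]]; exists q; apply/ideal_plusP; exists d.
  by rewrite addrAC.
exists c; apply: IH; first exact: ltnW.
have -> : y * (p - s k * c) = (y * p - s k * b) + s k * (b - y * c) by ring.
by apply: (idealD idJk) => //; apply: (idealMl idJk).
Qed.

(** Regularity passes from the ends to the middle of [0 -> P / J1 -> P / J -> P / J2 -> 0], the
    first map being multiplication by [y]: if [s k] kills [a], then [a = y c] by regularity on
    [P / J2], [s k] kills [c] by the colon computation, and [c] vanishes by regularity on
    [P / J1]. *)
Lemma regular_ext : regular_mod J1 s n -> regular_mod J2 s n -> regular_mod J s n.
Proof.
move=> reg1 reg2 k a kn ska.
have idJk := ideal_plus_ideal s k idJ.
have [c Hc] : exists c, ideal_plus J s k (a - y * c).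
  have sub2 : ideal_plus J s k `<=` ideal_plus J2 s k.
    by apply: ideal_plusS => x Jx; apply/J2P; exists 0; rewrite mulr0 subr0.
  have /ideal_plusP[d /J2P[q Jq]] := reg2 _ _ kn (sub2 _ ska); exists q; apply/ideal_plusP.
  by exists d; rewrite addrAC.
have Jyc : ideal_plus J1 s k c.
  apply: reg1 => //; apply: (ideal_plus_colon reg2 (ltnW kn)).
  have -> : y * (s k * c) = s k * a - s k * (a - y * c) by ring.
  by apply: (idealB idJk) => //; apply: (idealMl idJk).
rewrite -[a](subrK (y * c)); apply: (idealD idJk) => //.
move: Jyc => /ideal_plusP[d /J1P Jd]; apply/ideal_plusP; exists (fun i => y * d i).
move: Jd; rewrite mulrBr mulr_sumr; congr (J (_ - _)).
by apply: eq_bigr => i _; ring.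
Qed.

End Extension.
End RegularSequences.

(** * Monomial ideals of directed graphs *)

Section MonomialIdeal.
Variables (F : idomainType) (n : nat).
Local Notation P := {mpoly F[n]}.

(** Described by exponents and not by generators, so that colons and sums with a variable become
    identities between predicates. *)
Definition monomial_ideal (Bad : pred 'X_{1..n}) : set P :=
  [set p | forall m, m \in msupp p -> Bad m].

Variable Bad : pred 'X_{1..n}.
Hypothesis Bad_up : forall m m', Bad m -> Bad (m' + m)%MM.

Lemma monomial_ideal_ideal : is_ideal (monomial_ideal Bad).
Proof.
split=> [m|a x y Jx Jy m]; first by rewrite msupp0.
move=> /msuppD_le; rewrite mem_cat => /orP[|/Jy //].
by move=> /msuppM_le /allpairsP[[m1 m2] /= [_ /Jx Bm ->]]; apply: Bad_up.
Qed.

(** Together with [monomial_ideal_add] this provides the two outer ideals of [regular_ext] when [y]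
    is a variable. *)
Lemma monomial_ideal_colon (c : 'I_n) (Bad1 : pred 'X_{1..n}) (p : P) :
  (forall m, Bad (U_(c) + m)%MM = Bad1 m) ->
  monomial_ideal Bad ('X_c * p) <-> monomial_ideal Bad1 p.
Proof.
move=> HB; rewrite mulrC /monomial_ideal /=.
have mem m : m \in msupp (p * 'X_c) = (m \in [seq (U_(c) + m')%MM | m' <- msupp p]).
  exact: perm_mem (msuppMX p U_(c)) m.
split=> H m; first by move=> mp; rewrite -HB; apply: H; rewrite mem map_f.
by rewrite mem => /mapP[m' /H Bm ->]; rewrite HB.
Qed.

Lemma monomial_ideal_add (c : 'I_n) (Bad2 : pred 'X_{1..n}) (p : P) :
  (forall m, Bad2 m = (0 < m c)%N || Bad m) ->
  monomial_ideal Bad2 p <-> exists q, monomial_ideal Bad (p - 'X_c * q).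
Proof.
move=> HB; split=> [Hp|[q Hq] m mp]; last first.
  rewrite HB; case: posnP => //= mc0; apply: Hq; rewrite mcoeff_msupp mcoeffB.
  suff -> : ('X_c * q)@_m = 0 by rewrite subr0 -mcoeff_msupp.
  apply: memN_msupp_eq0; rewrite mulrC (perm_mem (msuppMX q U_(c)) m).
  by apply/mapP => -[m' _ E]; move: mc0; rewrite E mnmDE mnm1E eqxx.
exists (\sum_(m <- msupp p | (0 < m c)%N) p@_m *: 'X_[m - U_(c)]).
have -> : p - 'X_c * \sum_(m <- msupp p | (0 < m c)%N) p@_m *: 'X_[m - U_(c)]
    = \sum_(m <- msupp p | ~~ (0 < m c)%N) p@_m *: 'X_[m].
  rewrite {1}(mpolyE p) (bigID (fun m : 'X_{1..n} => (0 < m c)%N)) /= mulr_sumr addrAC.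
  rewrite (_ : \sum_(i <- msupp p | _) 'X_c * _ =
     \sum_(m <- msupp p | (0 < m c)%N) p@_m *: 'X_[m]) ?subrr ?add0r //.
  apply: eq_bigr => m mc; rewrite -scalerAr -mpolyXD addmC submK //.
  by rewrite lep1mP -lt0n.
move=> m /msupp_sum_le /flattenP[s /mapP[m']].
rewrite mem_filter => /andP[mc m'p] -> /msuppZ_le; rewrite msuppX inE => /eqP->.
by have := Hp _ m'p; rewrite HB (negPf mc).
Qed.

End MonomialIdeal.

(** Congruence modulo an ideal is compatible with products, one factor at a time; a check on
    variables thus extends to all polynomials. *)
Lemma comp_mpoly_cong (R : comNzRingType) n (J : set {mpoly R[n]})
    (lq : n.-tuple {mpoly R[n]}) p :
  is_ideal J -> (forall i, J ('X_i - tnth lq i)) -> J (p - (p \mPo lq)).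
Proof.
move=> idJ Jlq.
have -> : p - (p \mPo lq) = \sum_(m <- msupp p) p@_m *: ('X_[m] - ('X_[m] \mPo lq)).
  rewrite comp_mpolyEX {1}(mpolyE p) -sumrB; apply: eq_bigr => m _; exact/esym/scalerBr.
apply: ideal_sum => // m _; rewrite -mul_mpolyC; apply: idealMl => //.
rewrite comp_mpolyX mpolyXE_id; apply: (big_ind2 (fun x y => J (x - y))).
- by rewrite subrr; case: idJ.
- move=> x1 x2 y1 y2 J1 J2; have -> : x1 * y1 - x2 * y2 = y1 * (x1 - x2) + x2 * (y1 - y2) by ring.
  by apply: idealD => //; apply: idealMl.
- move=> i _; elim: (m i) => [|k IH]; first by rewrite !expr0 subrr; case: idJ.
  rewrite !exprS; set x := 'X_i; set y := tnth _ _.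
  have -> : x * x ^+ k - y * y ^+ k = x ^+ k * (x - y) + y * (x ^+ k - y ^+ k) by ring.
  by apply: idealD => //; apply: idealMl => //; apply: Jlq.
Qed.

Section Arborescence.
Variables (F : idomainType) (V : finType) (n : nat) (hd tl : 'I_n -> option V).
Local Notation P := {mpoly F[n]}.
Implicit Types (W Gam : {set V}) (D Z : {set 'I_n}) (m : 'X_{1..n}).

Definition oin Gam (o : option V) := if o is Some v then v \in Gam else false.
Definition enters Gam : pred 'I_n := fun e => oin Gam (hd e) && ~~ oin Gam (tl e).

(* A monomial is bad when it is divisible by a variable of Z, or when deleting
   D and its support from the graph leaves a set of vertices that cannot be
   reached from W and the bottom boundary. *)
Definition bad W D Z : pred 'X_{1..n} := fun m =>
  [exists e in Z, (0 < m e)%N] ||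
  [exists Gam : {set V}, [&& Gam != finset.set0, [disjoint Gam & W] &
     [forall e, enters Gam e ==> ((e \in D) || (0 < m e)%N)]]].

Lemma bad_up W D Z m m' : bad W D Z m -> bad W D Z (m' + m)%MM.
Proof.
have le e : (0 < m e)%N -> (0 < (m' + m)%MM e)%N by rewrite mnmDE addn_gt0 orbC => ->.
case/orP=> [/exists_inP[e eZ /le me]|/existsP[Gam /and3P[G0 GW /forallP GD]]]; apply/orP.
  by left; apply/exists_inP; exists e.
right; apply/existsP; exists Gam; rewrite G0 GW; apply/forallP => e; apply/implyP => eG.
by have /implyP/(_ eG)/orP[->//|/le ->] := GD e; rewrite orbT.
Qed.

(** Multiplying by [X_c] puts [c] in the support for good, which is the effect of deleting it. This
    is the colon half of the recursion. *)
Lemma bad_delete W D Z c m : c \notin Z ->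
  bad W D Z (U_(c) + m)%MM = bad W (c |: D) Z m.
Proof.
move=> cZ; congr orb.
  apply: eq_existsb => e; case: (boolP (e \in Z)) => //= eZ.
  by rewrite mnmDE mnm1E; case: eqP => // E; rewrite E eZ in cZ.
apply: eq_existsb => Gam; congr [&& _, _ & _]; apply: eq_forallb => e.
by rewrite mnmDE mnm1E !inE addn_gt0 eq_sym; case: (e == c); rewrite ?orbT.
Qed.

(** A set [Gam] containing [v] is entered by [c], which comes from [W] or from the boundary and is
    not in [D]; such a [Gam] witnesses only monomials divisible by [X_c]. The remaining sets avoid
    [v], that is, they are disjoint from [v |: W]. *)
Lemma bad_contract W D Z c v m : hd c = Some v -> v \notin W ->
    (forall u, tl c = Some u -> u \in W) -> c \notin D ->
  bad (v |: W) D (c |: Z) m = (0 < m c)%N || bad W D Z m.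
Proof.
move=> hc vW tc cD; apply/idP/idP.
  case/orP=> [/exists_inP[e]|].
    rewrite !inE => /orP[/eqP-> ->//|eZ me].
    by rewrite orbC /bad (_ : [exists _ in Z, _]) //; apply/exists_inP; exists e.
  case/existsP=> Gam /and3P[G0 GW GD]; rewrite orbC /bad; apply/orP; left; apply/orP; right.
  apply/existsP; exists Gam; rewrite G0 GD andbT.
  by apply: disjointWr GW; apply: finset.subsetUr.
case/orP=> [mc|/orP[/exists_inP[e eZ me]|/existsP[Gam /and3P[G0 GW GD]]]].
- by apply/orP; left; apply/exists_inP; exists c; rewrite // !inE eqxx.
- by apply/orP; left; apply/exists_inP; exists e; rewrite // !inE eZ orbT.
have [vG|vG] := boolP (v \in Gam); apply/orP; [left|right]; last first.
  apply/existsP; exists Gam; rewrite G0 GD andbT disjoint_sym disjoint_subset.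
  apply/fintype.subsetP => u; rewrite !inE => /orP[/eqP-> //|uW].
  by apply: contraL uW => uG; rewrite (disjointFr GW uG).
apply/exists_inP; exists c; first by rewrite !inE eqxx.
have /forallP/(_ c) := GD; rewrite (negPf cD) /= => /implyP; apply.
rewrite /enters hc /= vG; case tcE: (tl c) => [u|//] /=.
by apply/negP => uG; have := disjointFr GW uG; rewrite tc.
Qed.

Variables (r : nat) (th : nat -> V).
Hypothesis th_inj : forall i j, (i < r)%N -> (j < r)%N -> th i = th j -> i = j.
Hypothesis th_in2 : forall i c, (i < r)%N -> hd c = Some (th i) ->
  exists2 d, d != c & hd d = Some (th i).

Definition in_sum (i : nat) : P := \sum_(e | hd e == Some (th i)) 'X_e.

(** With every vertex reached, the ideal is generated by the variables of [Z], and the sums involve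
    disjoint sets of variables because an edge has one head. Eliminating a variable [ch i] from each
    of the first [k] sums embeds the quotient in a polynomial ring, a domain where the next sum is
    nonzero. *)
Lemma in_sum_regular_free Z :
  (forall i, (i < r)%N -> exists2 e, e \notin Z & hd e = Some (th i)) ->
  regular_mod (monomial_ideal (F := F) (bad finset.setT finset.set0 Z)) in_sum r.
Proof.
move=> ZT k a kr; set J := monomial_ideal _; set J' := ideal_plus J _ _ => ska.
have idJ : is_ideal J by apply: monomial_ideal_ideal; apply: bad_up.
have idJ' : is_ideal J' by apply: ideal_plus_ideal.
have [ch chP] : exists ch : nat -> 'I_n,
    forall i, (i < r)%N -> ch i \notin Z /\ hd (ch i) = Some (th i).
  have [e0 _ _] := ZT k kr.
  suff /boolp.choice[ch chP] : forall i, exists e, (i < r)%N -> e \notin Z /\ hd e = Some (th i).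
    by exists ch.
  move=> i.
  by have [/ZT[e eZ he]|] := boolP (i < r)%N; [exists e | exists e0].
(* The subtracted sum contains [ch i] itself, so [X_(ch i)] is replaced by minus the other terms of
   its sum. *)
pose lqf (e : 'I_n) : P := if e \in Z then 0 else
  if [exists i : 'I_k, e == ch i]
  then 'X_e - \sum_(d | (hd d == hd e) && (d \notin Z)) 'X_d else 'X_e.
pose lq := [tuple lqf e | e < n].
have lqE e : tnth lq e = lqf e by rewrite tnth_mktuple.
have thX e : 'X_e \mPo lq = lqf e by rewrite comp_mpolyXU -tnth_nth lqE.
have modlq p : J' (p - (p \mPo lq)).
  apply: comp_mpoly_cong => // e; rewrite lqE /lqf.
  case: ifP => [eZ|_].
    rewrite subr0; apply: (@ideal_plusW _ _ _ 0%N) => // m; rewrite msuppX inE => /eqP->.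
    by apply/orP; left; apply/exists_inP; exists e; rewrite // mnm1E eqxx.
  case: existsP => [[i /eqP E]|_]; last by rewrite subrr; case: idJ'.
  rewrite subKr; have ir : (i < r)%N := ltn_trans (ltn_ord i) kr.
  have [_ he] := chP i ir; rewrite E he.
  have -> : \sum_(d | (hd d == Some (th i)) && (d \notin Z)) 'X_d =
      in_sum i - \sum_(d | (hd d == Some (th i)) && (d \in Z)) 'X_d.
    by rewrite /in_sum [X in X - _](bigID (mem Z)) /= addrAC subrr add0r.
  apply: (idealB idJ'); first exact: ideal_plus_gen.
  apply: (@ideal_plusW _ _ _ 0%N) => //; apply: (ideal_sum idJ) => d /andP[_ dZ] m.
  rewrite msuppX inE => /eqP->.
  by apply/orP; left; apply/exists_inP; exists d; rewrite // mnm1E eqxx.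
have th_in i : (i < r)%N ->
    in_sum i \mPo lq = \sum_(e | (hd e == Some (th i)) && (e \notin Z)) lqf e.
  move=> ir; rewrite /in_sum raddf_sum /= (bigID (mem Z)) /= big1 ?add0r.
    by apply: eq_bigr.
  by move=> e /andP[_ eZ]; rewrite thX /lqf eZ.
have th0 p : J' p -> p \mPo lq = 0.
  move=> /ideal_plusP[b Jb]; rewrite -[p](subrK (\sum_(i < k) in_sum i * b i)).
  rewrite raddfD /= [X in X + _](_ : _ = 0) ?add0r; last first.
    rewrite comp_mpolyEX big_seq big1 // => m /Jb /orP[/exists_inP[e eZ me]|].
      rewrite comp_mpolyX (bigD1 e) //= lqE /lqf eZ expr0n.
      by rewrite eqn0Ngt me mul0r scaler0.
    case/existsP => Gam /and3P[/finset.set0Pn[v vG]].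
    by rewrite disjoint_sym disjoint_subset => /fintype.subsetP/(_ v); rewrite !inE vG => /(_ isT).
  rewrite raddf_sum /= big1 // => i _; rewrite rmorphM /= th_in; last first.
    exact: ltn_trans (ltn_ord i) kr.
  have ir : (i < r)%N := ltn_trans (ltn_ord i) kr.
  have [cZ hc] := chP i ir.
  rewrite (bigD1 (ch i)) /=; last by rewrite hc eqxx cZ.
  rewrite {1}/lqf (negPf cZ) (_ : [exists _, _]) ?hc; last by apply/existsP; exists i.
  rewrite [\sum_(d | _ && _) 'X_d](bigD1 (ch i)) /= ?hc ?eqxx ?cZ //.
  rewrite opprD addNKr.
  rewrite addrC (eq_bigr (fun e => 'X_e)) ?subrr ?mul0r // => e /andP[/andP[/eqP he eZ] ne].
  rewrite /lqf (negPf eZ); case: existsP => // -[j /eqP E].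
  have [jr] : (j < r)%N by exact: ltn_trans (ltn_ord j) kr.
  have [_ hj] := chP j jr; move: he; rewrite E hj => -[/th_inj E2].
  by case/eqP: ne; rewrite E E2.
have thk : in_sum k \mPo lq != 0.
  rewrite th_in // (eq_bigr (fun e => 'X_e)); last first.
    move=> e /andP[/eqP he eZ]; rewrite /lqf (negPf eZ); case: existsP => // -[j /eqP E].
    have jr : (j < r)%N by exact: ltn_trans (ltn_ord j) kr.
    have [_ hj] := chP j jr; move: he; rewrite E hj => -[/th_inj E2].
    by have := ltn_ord j; rewrite E2 // ltnn.
  apply/eqP => /(congr1 (mcoeff U_(ch k))) /eqP; rewrite mcoeff0 raddf_sum /=.
  have [cZ hc] := chP k kr; rewrite (bigD1 (ch k)) /= ?hc ?eqxx ?cZ // mcoeffXU eqxx.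
  rewrite big1 ?addr0 ?oner_eq0 // => e /andP[_ ne].
  by rewrite mcoeffXU (negPf ne).
have /eqP := th0 _ ska; rewrite rmorphM /= mulf_eq0 (negPf thk) /= => /eqP E.
by have := modlq a; rewrite E subr0.
Qed.

(** Induction on the vertices not yet reached and the edges not yet deleted. Because edges of [Z]
    have their heads in [W], contracting [c] still leaves its head another in-edge outside [Z]. *)
Lemma in_sum_regular W D Z :
  (forall e, e \in Z -> oin W (hd e)) ->
  (forall i, (i < r)%N -> exists2 e, e \notin Z & hd e = Some (th i)) ->
  regular_mod (monomial_ideal (F := F) (bad W D Z)) in_sum r.
Proof.
have [k] := ubnP (#|~: W| + #|~: D|); elim: k W D Z => // k IH W D Z.
rewrite ltnS => le_k ZW ZT.
have idJ W' D' Z' : is_ideal (monomial_ideal (F := F) (bad W' D' Z')).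
  by apply: monomial_ideal_ideal => m m'; apply: bad_up.
have [/existsP[c /and3P[cD]]|] := boolP [exists c,
   [&& c \notin D, if hd c is Some v then v \notin W else false
     & if tl c is Some u then u \in W else true]].
  case hc: (hd c) => [v|//] vW tc.
  have cZ : c \notin Z by apply/negP => /ZW; rewrite hc /= (negPf vW).
  have tW u : tl c = Some u -> u \in W by move=> E; rewrite E in tc.
  apply: (regular_ext (J1 := monomial_ideal (bad W (c |: D) Z))
                      (J2 := monomial_ideal (bad (v |: W) D (c |: Z))) (y := 'X_c)) => //.
  - by move=> p; apply: monomial_ideal_colon => m; apply: bad_delete.
  - by move=> p; apply: monomial_ideal_add => m; apply: bad_contract.
  - apply: IH => //; apply: leq_trans le_k; rewrite ltn_add2l; apply: proper_card.
    by rewrite finset.setCU properE finset.subsetIr; apply/subsetPn; exists c; rewrite !inE ?eqxx ?cD.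
  - apply: IH => [|e|i ir].
    + apply: leq_trans le_k; rewrite ltn_add2r; apply: proper_card.
      by rewrite finset.setCU properE finset.subsetIr; apply/subsetPn; exists v; rewrite !inE ?eqxx ?vW.
    + rewrite !inE => /orP[/eqP->|/ZW]; first by rewrite hc /= !inE eqxx.
      by case: (hd e) => //= u uW; rewrite !inE uW orbT.
    + have [e eZ he] := ZT i ir; have [E|ne] := eqVneq e c; last first.
        by exists e; rewrite // !inE negb_or ne.
      rewrite {}E in eZ he; have [d dc hdd] := th_in2 ir he; exists d => //.
      rewrite !inE negb_or dc; apply/negP => /ZW; rewrite hdd -he hc /=.
      by rewrite (negPf vW).
rewrite negb_exists => /forallP noc.
have [WT|WT] := eqVneq W finset.setT.
  suff -> : bad W D Z = bad finset.setT finset.set0 Z by apply: in_sum_regular_free.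
  apply/funext => m; rewrite WT; congr orb; apply: eq_existsb => Gam.
  have [->|/finset.set0Pn[v vG]] := eqVneq Gam finset.set0; first by [].
  suff dT : [disjoint Gam & [set: V]%SET]%B = false by rewrite dT.
  by apply/negP => /disjointFr/(_ vG); rewrite finset.in_setT.
(* No undeleted edge leads into the complement of [W], so this complement makes every monomial bad
   and the ideal is everything. *)
move=> i a ir _; apply: (@ideal_plusW _ _ _ 0%N) => // m _; apply/orP; right.
apply/existsP; exists (~: W); apply/and3P; split.
- by apply: contra_neq WT => E; rewrite -[W]finset.setCK E finset.setC0.
- by rewrite disjoint_sym disjoint_subset; apply/fintype.subsetP => u; rewrite !inE negbK.
apply/forallP => e; apply/implyP => /andP[]; have := noc e.
case: (hd e) => [v|//] /=; rewrite inE => H vW; move: H; rewrite vW /=.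
by case: (tl e) => [u|] /=; rewrite ?inE ?andbT ?negbK => + uW; rewrite ?uW ?andbT ?negbK => ->.
Qed.
End Arborescence.

(** * Power series and Laurent series *)

Section Laurent.
Variable F : fieldType.
Local Notation L := (laurent F).
Implicit Types (f g : L) (i n : int).

Lemma lmulE f g i : (f * g) i = \sum_(k \in [set: int]) f k * g (i - k).
Proof. by []. Qed.

Lemma laddE f g i : (f + g) i = f i + g i.
Proof. by []. Qed.

Lemma loppE f i : (- f) i = - f i.
Proof. by []. Qed.

Lemma tpow_mulE n f i : (tpow F n * f) i = f (i - n).
Proof.
rewrite lmulE (fsbigE [:: n]) //.
  by rewrite big_cons big_nil in_setT /= eqxx mul1r addr0.
by move=> k _; rewrite inE /= => /negPf ->; rewrite mul0r.
Qed.

Lemma tpowD n m : tpow F (n + m) = tpow F n * tpow F m.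
Proof. by apply: laurent_eq => i; rewrite tpow_mulE /= subr_eq [m + n]addrC. Qed.

Lemma tpow0 : tpow F 0 = 1.
Proof. by []. Qed.

Lemma tpow_sum (I : Type) (r : seq I) (Q : pred I) (f : I -> int) :
  tpow F (\sum_(i <- r | Q i) f i) = \prod_(i <- r | Q i) tpow F (f i).
Proof. exact: (big_morph _ tpowD tpow0). Qed.

(** The inverse is the geometric series in [t ^ n]. It makes the relation of a closed component a
    unit. *)
Lemma one_sub_tpow_inv (n : nat) : (0 < n)%N -> exists f, (1 - tpow F n) * f = 1.
Proof.
move=> n0; pose c i : F := ((0 <= i) && (n %| `|i|)%N)%:R.
have cb : exists N : nat, forall i, i < - N%:Z -> c i = 0.
  by exists 0%N => i; rewrite oppr0 /c ltNge => /negPf ->.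
exists (Laurent cb); apply: laurent_eq => i.
rewrite mulrBl mul1r laddE loppE tpow_mulE /= /c.
have [i0|i0] := ltP i 0; last have [in0|in0] := ltP i n%:Z.
- by rewrite (lt_geF (_ : i - n%:Z < 0)) ?subrr ?(lt_eqF i0) //; lia.
- rewrite (lt_geF (_ : i - n%:Z < 0)) ?subr0 /=; last by lia.
  have E : (n %| `|i|)%N = (i == 0).
    apply/idP/eqP => [|->]; last by rewrite absz0 dvdn0.
    by have [/eqP|i_gt0] := posnP `|i|%N; [rewrite absz_eq0 => /eqP | move=> /(dvdn_leq i_gt0); lia].
  by rewrite E.
- rewrite (_ : 0 <= i - n%:Z) ?subr_ge0 //=.
  have -> : `|i|%N = (n + `|(i - n%:Z)%R|)%N by lia.
  rewrite dvdn_addr // subrr; case: eqP => // E; lia.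
Qed.

Lemma lconst_bounded (c : F) : exists N : nat, forall i, i < - N%:Z -> c * (i == 0)%:R = 0.
Proof. by exists 0%N => i; rewrite oppr0 => /lt_eqF ->; rewrite mulr0. Qed.
Definition lconst (c : F) : L := Laurent (lconst_bounded c).

Definition integral : {pred L} := fun f => `[< forall i, i < 0 -> f i = 0 >].

Lemma integralP f : reflect (forall i, i < 0 -> f i = 0) (f \in integral).
Proof. exact: asboolP. Qed.

Lemma integral_mul0 f g : f \in integral -> g \in integral -> (f * g) 0 = f 0 * g 0.
Proof.
move=> /integralP If /integralP Ig; rewrite lmulE (fsbigE [:: (0 : int)]) //.
  by rewrite big_cons big_nil in_setT addr0; exact: addr0.
move=> k _; rewrite inE; case: (ltgtP k 0) => // k0 _; first by rewrite If ?mul0r.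
by rewrite Ig ?mulr0 // add0r oppr_lt0.
Qed.

Lemma integral_subring : subring_closed integral.
Proof.
split=> [|f g /integralP If /integralP Ig|f g /integralP If /integralP Ig]; apply/integralP => i i0.
- by rewrite /= lt_eqF.
- by rewrite laddE loppE If // Ig // subr0.
- rewrite lmulE fsbig1 // => k _; have [k0|k0] := ltP k 0; first by rewrite If ?mul0r.
  by rewrite Ig ?mulr0 // subr_lt0 (lt_le_trans i0).
Qed.
HB.instance Definition _ := GRing.isSubringClosed.Build L integral integral_subring.

(** F[[t]] as a subring of the Laurent series: ring axioms are inherited and the inclusion is
    [val]. *)
Record pseries := PSeries { pseries_val :> L; pseries_valP : pseries_val \in integral }.
HB.instance Definition _ := [isSub for pseries_val].
HB.instance Definition _ := [Choice of pseries by <:].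
HB.instance Definition _ := [SubChoice_isSubComNzRing of pseries by <:].

Lemma psvalD (f g : pseries) : pseries_val (f + g) = pseries_val f + pseries_val g.
Proof. exact: (rmorphD val). Qed.
Lemma psvalM (f g : pseries) : pseries_val (f * g) = pseries_val f * pseries_val g.
Proof. exact: (rmorphM val). Qed.

Lemma tpow_integral (k : nat) : tpow F k \in integral.
Proof. by apply/integralP => i i0 /=; case: eqP => // E; exfalso; lia. Qed.
Definition pstpow k : pseries := PSeries (tpow_integral k).

Lemma pstpowD j k : pstpow (j + k) = pstpow j * pstpow k.
Proof. by apply: val_inj; rewrite rmorphM /= PoszD tpowD. Qed.

Lemma pstpow0 : pstpow 0 = 1.
Proof. exact: val_inj. Qed.

Lemma lconst_integral c : lconst c \in integral.
Proof. by apply/integralP => i i0 /=; rewrite lt_eqF ?mulr0. Qed.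
Definition psconst c : pseries := PSeries (lconst_integral c).

Definition psconst_term (f : pseries) : F := f 0.

Lemma psconst_term_zmod : zmod_morphism psconst_term.
Proof. by move=> f g; rewrite /psconst_term [pseries_val _](rmorphB val). Qed.
Lemma psconst_term_monoid : monoid_morphism psconst_term.
Proof. by split=> [|f g]; rewrite /psconst_term //; apply: integral_mul0; apply: pseries_valP. Qed.
HB.instance Definition _ := GRing.isZmodMorphism.Build pseries F psconst_term psconst_term_zmod.
HB.instance Definition _ := GRing.isMonoidMorphism.Build pseries F psconst_term psconst_term_monoid.

Lemma psconstK c : psconst_term (psconst c) = c.
Proof. by rewrite /psconst_term /= mulr1. Qed.

Lemma psconst0 : psconst 0 = 0.
Proof. by apply: val_inj; apply: laurent_eq => i /=; rewrite mul0r. Qed.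

Lemma psconst_term_tpow k : psconst_term (pstpow k) = (k == 0%N)%:R.
Proof. by rewrite /psconst_term /= [(0 : int) == _]eq_sym. Qed.

Definition pscoef (f : pseries) (k : nat) : F := f k.

Lemma pseriesP (f g : pseries) : pscoef f =1 pscoef g -> f = g.
Proof.
move=> E; apply: val_inj; apply: laurent_eq => -[k|k]; first exact: E.
have /integralP -> // := pseries_valP f; by have /integralP -> := pseries_valP g.
Qed.

Definition int_ext (c : nat -> F) (i : int) : F := if i is Posz k then c k else 0.
Lemma int_ext_bounded c : exists N : nat, forall i, i < - N%:Z -> int_ext c i = 0.
Proof. by exists 0%N => -[k|k] //=; rewrite oppr0. Qed.
Lemma int_ext_integral c : Laurent (int_ext_bounded c) \in integral.
Proof. by apply/integralP => -[k|k]. Qed.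
Definition ps_of c : pseries := PSeries (int_ext_integral c).

Lemma ps_ofE c k : pscoef (ps_of c) k = c k.
Proof. by []. Qed.

Lemma ps_shift (f : pseries) :
  f = psconst (psconst_term f) + pstpow 1 * ps_of (fun k => pscoef f k.+1).
Proof.
apply: pseriesP => k; rewrite /pscoef psvalD psvalM laddE tpow_mulE /= /psconst_term.
by case: k => [|k] /=; rewrite ?mulr1 ?addr0 // mulr0 add0r subn1.
Qed.

Lemma pstpow1_lreg (f : pseries) : pstpow 1 * f = 0 -> f = 0.
Proof.
move=> E; apply: pseriesP => k; have := congr1 (pscoef^~ k.+1) E.
by rewrite /pscoef psvalM tpow_mulE (_ : k.+1%:Z - 1%:Z = k%:Z) //; lia.
Qed.

Lemma integral_scale f : exists N : nat, tpow F N * f \in integral.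
Proof.
have [N fN] := lcoef_bounded f; exists N; apply/integralP => i i0.
by rewrite tpow_mulE fN // ltrBlDr addNr.
Qed.
End Laurent.

(** * Lifting regular sequences from t = 0 *)

(** Unlike membership in [gen], membership here comes with finitely many explicit coefficients,
    which can be lifted, truncated or cleared of denominators. *)
Definition span_ideal (P : comPzRingType) (I : finType) (g : I -> P) : set P :=
  [set x | exists c : I -> P, x = \sum_i c i * g i].

Lemma span_ideal_ideal (P : comPzRingType) (I : finType) (g : I -> P) :
  is_ideal (span_ideal g).
Proof.
split=> [|a x y [c ->] [d ->]].
  by exists (fun=> 0); rewrite big1 // => i _; rewrite mul0r.
exists (fun i => a * c i + d i); rewrite mulr_sumr -big_split /=.
by apply: eq_bigr => i _; ring.
Qed.

Lemma span_ideal_gen (P : comPzRingType) (I : finType) (g : I -> P) i : span_ideal g (g i).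
Proof.
exists (fun j => (j == i)%:R); rewrite (bigD1 i) //= eqxx mul1r big1 ?addr0 // => j /negPf->.
by rewrite mul0r.
Qed.

Section Truncation.
Variables (R : comNzRingType) (n : nat).
Implicit Types (p h : {mpoly R[n]}).

Definition mtrunc k p : {mpoly R[n]} := \sum_(m : 'X_{1..n < k}) p@_m *: 'X_[m].

Lemma mcoeff_mtrunc k p m : (mtrunc k p)@_m = if (mdeg m < k)%N then p@_m else 0.
Proof.
case: ifP => [|/negbT mk]; first exact: (mcoeff_mpoly (fun m => p@_m)).
rewrite raddf_sum big1 // => -[m' m'k] _ /=; rewrite mcoeffZ mcoeffX.
by case: eqP mk => [<-|_ _]; rewrite ?m'k ?mulr0.
Qed.

Lemma mtrunc_id k p : (msize p <= k)%N -> mtrunc k p = p.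
Proof.
move=> pk; apply/mpolyP => m; rewrite mcoeff_mtrunc; case: ifP => // /negbT.
rewrite -leqNgt => km; apply/esym/memN_msupp_eq0/msize_mdeg_ge; exact: leq_trans km.
Qed.

Lemma msize_mtrunc k p : (msize (mtrunc k p) <= k)%N.
Proof.
rewrite msizeE; apply/bigmax_leqP_seq => m; rewrite mcoeff_msupp mcoeff_mtrunc.
by case: ifP; rewrite ?eqxx.
Qed.

Lemma mtruncD k : {morph mtrunc k : p q / p + q}.
Proof.
by move=> p q; apply/mpolyP => m; rewrite mcoeffD !mcoeff_mtrunc mcoeffD; case: ifP; rewrite ?addr0.
Qed.

Lemma mtrunc0 k : mtrunc k 0 = 0.
Proof. by apply/mpolyP => m; rewrite mcoeff_mtrunc mcoeff0; case: ifP. Qed.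

Lemma mtruncX k m p : mtrunc k ('X_[m] * p) = 'X_[m] * mtrunc (k - mdeg m) p.
Proof.
apply/mpolyP => m'; rewrite mcoeff_mtrunc.
have [/mnm_lepP mm'|mm'] := boolP (m <= m')%MM.
  have -> : m' = (m + (m' - m))%MM by apply/mnmP => i; rewrite mnmDE mnmBE subnKC.
  by rewrite !(mulrC 'X_[m]) !mcoeffMX mcoeff_mtrunc mdegD ltn_subRL.
have Z (q : {mpoly R[n]}) : ('X_[m] * q)@_m' = 0.
  rewrite mulrC; apply: memN_msupp_eq0; rewrite (perm_mem (msuppMX q m) m').
  by apply: contra mm' => /mapP[m'' _ ->]; apply: lem_addr.
by rewrite !Z if_same.
Qed.

(** A homogeneous factor shifts all degrees by [d], so truncating a combination of homogeneous
    generators truncates its coefficients. *)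
Lemma mtruncM k d h p : (forall m, m \in msupp h -> mdeg m = d) ->
  mtrunc k (h * p) = h * mtrunc (k - d) p.
Proof.
move=> hd; rewrite [in LHS](mpolyE h) [X in _ = X * _](mpolyE h) !mulr_suml.
rewrite (big_morph (mtrunc k) (mtruncD k) (mtrunc0 k)) big_seq [RHS]big_seq.
apply: eq_bigr => m /hd md; rewrite -!scalerAl -md -mtruncX.
by apply/mpolyP => m'; rewrite mcoeffZ !mcoeff_mtrunc mcoeffZ; case: ifP; rewrite ?mulr0.
Qed.

Lemma mtrunc_sum k (I : Type) (r : seq I) (Q : pred I) (f : I -> {mpoly R[n]}) :
  mtrunc k (\sum_(i <- r | Q i) f i) = \sum_(i <- r | Q i) mtrunc k (f i).
Proof. exact: (big_morph _ (mtruncD k) (mtrunc0 k)). Qed.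

End Truncation.

Section Lifting.
Variables (F : fieldType) (n : nat).
Local Notation O := (pseries F).
Local Notation PO := {mpoly O[n]}.
Local Notation PF := {mpoly F[n]}.
Local Notation t := ((pstpow F 1)%:MP : PO).

Definition mred : PO -> PF := map_mpoly (@psconst_term F).
HB.instance Definition _ := GRing.RMorphism.on mred.

Definition mlift (b : PF) : PO := \sum_(m <- msupp b) psconst b@_m *: 'X_[m].

Lemma mcoeff_mred p m : (mred p)@_m = psconst_term p@_m.
Proof. exact: mcoeff_map_mpoly. Qed.

Lemma mcoeff_mlift b m : (mlift b)@_m = psconst b@_m.
Proof.
rewrite /mlift raddf_sum /=; have [mb|mb] := boolP (m \in msupp b).
  rewrite (bigD1_seq m) //= mcoeffZ mcoeffX eqxx mulr1 big1 ?addr0 // => m' ne.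
  by rewrite mcoeffZ mcoeffX (negPf ne) mulr0.
rewrite (memN_msupp_eq0 mb) psconst0 big_seq big1 // => m' m'b.
by rewrite mcoeffZ mcoeffX; case: eqP mb => [<-|_ _]; rewrite ?m'b ?mulr0.
Qed.

Lemma mliftK : cancel mlift mred.
Proof. by move=> b; apply/mpolyP => m; rewrite mcoeff_mred mcoeff_mlift psconstK. Qed.

Lemma mred_eq0 (p : PO) : mred p = 0 -> exists q, p = t * q.
Proof.
move=> p0; pose E m := ps_of (fun k => pscoef p@_m k.+1).
exists (\sum_(m : 'X_{1..n < msize p}) E m *: 'X_[m]).
apply/mpolyP => m; rewrite mcoeffCM.
have -> : (\sum_(m : 'X_{1..n < msize p}) E m *: 'X_[m])@_m = E m.
  have [mp|mp] := ltnP (mdeg m) (msize p); first exact: mcoeff_mpoly.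
  rewrite /E (memN_msupp_eq0 (msize_mdeg_ge mp)) raddf_sum big1 => [|m' _] /=.
    by apply: pseriesP => k; rewrite ps_ofE.
  rewrite mcoeffZ mcoeffX; case: eqP => [E'|_]; rewrite ?mulr0 //.
  by have := bmdeg m'; rewrite E' ltnNge mp.
rewrite [LHS]ps_shift -/(E m) -mcoeff_mred p0 mcoeff0.
by rewrite psconst0 add0r.
Qed.

Lemma mulXt_inj (p : PO) : t * p = 0 -> p = 0.
Proof.
move=> tp0; apply/mpolyP => m; rewrite mcoeff0; apply: pstpow1_lreg.
by rewrite -mcoeffCM tp0 mcoeff0.
Qed.

Lemma mtrunc_mlift k b : mtrunc k (mlift b) = mlift (mtrunc k b).
Proof.
apply/mpolyP => m; rewrite mcoeff_mtrunc !mcoeff_mlift mcoeff_mtrunc.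
by case: ifP; rewrite ?psconst0.
Qed.

Section Completeness.
Variables (I : finType) (h : I -> PO) (d : I -> nat) (Q : set PO).
Hypothesis h_homog : forall i m, m \in msupp (h i) -> mdeg m = d i.
Hypothesis approx : forall a, Q a ->
  exists b : I -> PF, exists a', a = \sum_i h i * mlift (b i) + t * a'.
Hypothesis Q_rest : forall a a' (B : I -> PO),
  Q a -> a = \sum_i h i * B i + t * a' -> Q a'.

(* Successive t-adic approximation; truncating at the degree of a makes the
   sums of the corrections polynomials again. *)
Lemma complete_span a : Q a -> exists B : I -> PO, a = \sum_i h i * B i.
Proof.
move=> Qa; pose D := msize a; pose Q' x := Q x /\ (msize x <= D)%N.
(* [step x] holds the corrections and the next remainder; its value outside [Q'] is arbitrary. The
   degree bound carried by [Q'] confines all corrections to the same finite set of monomials. *)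
have /boolp.choice[step stepP] : forall x, exists ba : (I -> PF) * PO, Q' x ->
   [/\ x = \sum_i h i * mlift (ba.1 i) + t * ba.2, Q' ba.2
     & forall i, (msize (ba.1 i) <= D)%N].
  move=> x; have [[Qx xD]|nQ] := pselect (Q' x); last by exists (fun=> 0, 0).
  have [b [a' E]] := approx Qx.
  have {}E : x = \sum_i h i * mlift (mtrunc (D - d i) (b i)) + t * mtrunc D a'.
    rewrite -{1}(mtrunc_id xD) E mtruncD mtrunc_sum; congr (_ + _).
      by apply: eq_bigr => i _; rewrite (mtruncM _ _ (@h_homog i)) mtrunc_mlift.
    rewrite (@mtruncM _ _ _ 0%N) ?subn0 // => m; rewrite msuppC.
    by case: ifP => //; rewrite inE => _ /eqP->; rewrite mdeg0.
  exists (fun i => mtrunc (D - d i) (b i), mtrunc D a') => _ /=; split => //.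
    by split; [exact: Q_rest E | exact: msize_mtrunc].
  by move=> i; apply: leq_trans (msize_mtrunc _ _) (leq_subr _ _).
pose st x := (step x).2.
(* The [j]-th correction supplies the coefficient of [t ^ j]. *)
pose C x i m := ps_of (fun j => ((step (iter j st x)).1 i)@_m).
pose B x i : PO := \sum_(m : 'X_{1..n < D}) C x i m *: 'X_[m].
have BE x i : Q' x -> B x i = mlift ((step x).1 i) + t * B (st x) i.
  move=> Qx; have [_ _ sD] := stepP _ Qx.
  have QS := stepP _; have Qit j : Q' (iter j st x) by elim: j => //= j /stepP[].
  apply/mpolyP => m; rewrite mcoeffD mcoeffCM mcoeff_mlift.
  have coefB y : (forall j, Q' (iter j st y)) -> (B y i)@_m = C y i m.
    move=> Qy; have [mD|mD] := ltnP (mdeg m) D; first exact: mcoeff_mpoly.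
    rewrite raddf_sum big1 => [|m' _] /=.
      apply: pseriesP => j; rewrite ps_ofE; apply/esym/memN_msupp_eq0/msize_mdeg_ge.
      by apply: leq_trans mD; have [_ _] := stepP _ (Qy j); apply.
    rewrite mcoeffZ mcoeffX; case: eqP => [E'|_]; rewrite ?mulr0 //.
    by have := bmdeg m'; rewrite E' ltnNge mD.
  rewrite !coefB => [|j|//]; last by rewrite -iterSr; apply: Qit.
  rewrite [LHS]ps_shift; congr (psconst _ + _ * _).
  by apply: pseriesP => j; rewrite !ps_ofE iterSr.
pose diff x := x - \sum_i h i * B x i.
have diffE x : Q' x -> diff x = t * diff (st x).
  move=> Qx; have [E _ _] := stepP _ Qx; rewrite /diff.
  have -> : \sum_i h i * B x i =
      \sum_i h i * mlift ((step x).1 i) + t * \sum_i h i * B (st x) i.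
    rewrite mulr_sumr -big_split /=; apply: eq_bigr => i _; rewrite BE //; ring.
  rewrite {1}E -/(st x); ring.
have diffX x J : Q' x -> diff x = (pstpow F J)%:MP * diff (iter J st x).
  elim: J x => [|J IH] x Qx; first by rewrite pstpow0 mul1r.
  have [_ Qst _] := stepP _ Qx.
  by rewrite (diffE x Qx) (IH (st x) Qst) iterSr mulrA; congr (_ * _); rewrite -mpolyCM -pstpowD add1n.
exists (B a); apply/eqP; rewrite -subr_eq0 -/(diff a); apply/eqP/mpolyP => m.
(* After [k + 1] steps the difference is a multiple of [t ^ (k + 1)], so its coefficient of [t ^ k]
   is a coefficient of negative index of a power series. *)
apply: pseriesP => k; rewrite (diffX a k.+1) // mcoeffCM mcoeff0 /pscoef psvalM tpow_mulE.
by have /integralP -> := pseries_valP ((diff (iter k.+1 st a))@_m); [|lia].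
Qed.
End Completeness.

Section Lift.
Variables (I : finType) (g : I -> PO) (dg : I -> nat) (s : nat -> PO) (r : nat).
Hypothesis g_homog : forall i m, m \in msupp (g i) -> mdeg m = dg i.
Hypothesis s_homog : forall i m, m \in msupp (s i) -> mdeg m = 1%N.
Hypothesis t_reg : forall p, span_ideal g (t * p) -> span_ideal g p.
Hypothesis red_reg : regular_mod (span_ideal (mred \o g)) (mred \o s) r.

Let N := span_ideal g.
Let J2 : set PO := [set p | span_ideal (mred \o g) (mred p)].

Let ideal_plus_red k p : ideal_plus J2 s k p <->
  ideal_plus (span_ideal (mred \o g)) (mred \o s) k (mred p).
Proof.
elim: k p => // k IH p /=; split=> -[b].
  by move=> /IH H; exists (mred b); rewrite -rmorphM -rmorphB.
by move=> H; exists (mlift b); apply/IH; rewrite rmorphB rmorphM /= mliftK.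
Qed.

Let J2_regular : regular_mod J2 s r.
Proof.
move=> k a kr /ideal_plus_red; rewrite rmorphM => H.
exact/ideal_plus_red/red_reg.
Qed.

Let J2P p : J2 p <-> exists q, N (p - t * q).
Proof.
split=> [[c E]|[q [c E]]].
  have /mred_eq0[q Eq] : mred (p - \sum_i mlift (c i) * g i) = 0.
    rewrite rmorphB /= E rmorph_sum -sumrB big1 // => i _ /=.
    by rewrite rmorphM /= mliftK subrr.
  exists q, (mlift \o c); by rewrite -Eq subKr.
exists (mred \o c); rewrite -[p](subrK (t * q)) E rmorphD rmorph_sum rmorphM /=.
have -> : mred t = 0.
  by apply/mpolyP => m; rewrite mcoeff_mred mcoeffC mcoeff0 rmorphM /= psconst_term_tpow mul0r.
by rewrite mul0r addr0; apply: eq_bigr => i _; rewrite rmorphM.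
Qed.

(** [complete_span] is applied to the set of all [a] killed by [s k], with the generators of [N] and
    the earlier [s i] in the role of [h]. Regularity at [t = 0] yields each approximation. The
    remainder is killed as well because [t] cancels: this is [ideal_plus_colon] with [y = t], where
    torsion-freeness says that [N : t] is [N]. *)
Lemma regular_lift : regular_mod N s r.
Proof.
move=> k a kr ska; have idN := span_ideal_ideal g.
have idk := ideal_plus_ideal s k idN.
pose h (i : I + 'I_k) := match i with inl i => g i | inr i => s i end.
have h_in i : ideal_plus N s k (h i).
  case: i => [i|i] /=; last exact: ideal_plus_gen.
  by apply: (@ideal_plusW _ _ _ 0%N) => //; apply: span_ideal_gen.
pose Q : set PO := [set a | ideal_plus N s k (s k * a)].
have [i m|||B ->] := @complete_span (I + 'I_k)%type h
  (fun i => match i with inl i => dg i | inr _ => 1%N end) Q _ _ _ a ska.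
- by case: i => [i|i]; [apply: g_homog | apply: s_homog].
- move=> {ska}a Qa; have /ideal_plus_red/ideal_plusP[b [c E]] : ideal_plus J2 s k a.
    apply: J2_regular => //; apply: ideal_plusS Qa => x Nx; apply/J2P.
    by exists 0; rewrite mulr0 subr0.
  pose bb (i : I + 'I_k) := match i with inl i => c i | inr i => b i end.
  have /mred_eq0[a' Ea] : mred (a - \sum_i h i * mlift (bb i)) = 0.
    rewrite rmorphB rmorph_sum big_sumType /=.
    rewrite (eq_bigr (fun i => c i * mred (g i))) => [|i _]; last by rewrite rmorphM /= mliftK mulrC.
    rewrite [X in _ - (_ + X)](eq_bigr (fun i : 'I_k => mred (s i) * b i)) => [|i _]; last first.
      by rewrite rmorphM /= mliftK.
    rewrite -[X in _ - (X + _)]E /=; ring.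
  by exists bb, a'; rewrite -Ea addrC subrK.
- move=> {ska}a a' B Qa E.
  apply: (ideal_plus_colon idN (J1 := N) (J2 := J2) (y := t) _ J2P J2_regular (ltnW kr)).
    move=> p; split; [exact: t_reg | exact: idealMl].
  have -> : t * (s k * a') = s k * a - s k * \sum_i h i * B i by rewrite E; ring.
  apply: (idealB idk) => //; apply: (idealMl idk); apply: (ideal_sum idk) => i _.
  by rewrite mulrC; apply: (idealMl idk).
by apply: (ideal_sum idk) => i _; rewrite mulrC; apply: (idealMl idk).
Qed.

Local Notation L := (laurent F).
Local Notation PL := {mpoly L[n]}.
Definition mincl : PO -> PL := map_mpoly (\val : O -> L).
HB.instance Definition _ := GRing.RMorphism.on mincl.

Lemma mcoeff_mincl p m : (mincl p)@_m = \val p@_m.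
Proof. exact: mcoeff_map_mpoly. Qed.

Lemma mincl_inj : injective mincl.
Proof.
move=> p q /mpolyP E; apply/mpolyP => m; apply: val_inj.
exact: etrans (esym (mcoeff_mincl p m)) (etrans (E m) (mcoeff_mincl q m)).
Qed.

Lemma mincl_tpow k : mincl (pstpow F k)%:MP = (tpow F k)%:MP.
Proof. by rewrite /mincl map_mpolyC. Qed.

Lemma mincl_scale (x : PL) : exists M, exists y, mincl y = (tpow F (Posz M))%:MP * x.
Proof.
elim/mpolyind: x => [|c m p _ _ [M [y E]]].
  by exists 0%N, 0; rewrite rmorph0 mulr0.
have [M' cM'] := integral_scale c; exists (M + M')%N.
exists ((pstpow F M)%:MP * (PSeries cM')%:MP * 'X_[m] + (pstpow F M')%:MP * y).
rewrite (rmorphD mincl) (rmorphM mincl) (rmorphM mincl) (rmorphM mincl) /= E !mincl_tpow [mincl (PSeries _)%:MP]map_mpolyC [mincl _]map_mpolyX /=.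
by rewrite PoszD tpowD !mpolyCM mulrDr -mul_mpolyC; ring.
Qed.

Let NL := span_ideal (mincl \o g).

(** Denominators are powers of [t] and finitely many coefficients occur, so a single power clears
    them all. *)
Let descend k x : ideal_plus NL (mincl \o s) k x ->
  exists M y, ideal_plus N s k y /\ mincl y = (tpow F (Posz M))%:MP * x.
Proof.
elim: k x => [x [c ->]|k IH x /= [b /IH[M [y [Hy E]]]]].
  have [M HM] : exists M, forall i, exists y, mincl y = (tpow F (Posz M))%:MP * c i.
    suff [M HM] : exists M, forall i, i \in enum I -> exists y, mincl y = (tpow F (Posz M))%:MP * c i.
      by exists M => i; apply: HM; rewrite mem_enum.
    elim: (enum I) => [|i l [M HM]]; first by exists 0%N.
    have [M' [y E]] := mincl_scale (c i); exists (M + M')%N => j.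
    rewrite inE => /orP[/eqP->|/HM[z Ez]].
      exists ((pstpow F M)%:MP * y); rewrite rmorphM /= E mincl_tpow PoszD tpowD mpolyCM; ring.
    exists ((pstpow F M')%:MP * z); rewrite rmorphM /= Ez mincl_tpow PoszD tpowD mpolyCM; ring.
  have /boolp.choice[y Ey] := HM; exists M, (\sum_i y i * g i); split; first by exists y.
  rewrite rmorph_sum mulr_sumr; apply: eq_bigr => i _; rewrite rmorphM /= Ey; ring.
have [M' [z Ez]] := mincl_scale b.
exists (M + M')%N, ((pstpow F M')%:MP * y + (pstpow F M)%:MP * (s k * z)); split.
  exists ((pstpow F M)%:MP * z).
  have -> : (pstpow F M')%:MP * y + (pstpow F M)%:MP * (s k * z) - s k * ((pstpow F M)%:MP * z)
    = (pstpow F M')%:MP * y by ring.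
  by apply: idealMl => //; apply: ideal_plus_ideal; apply: span_ideal_ideal.
rewrite rmorphD !rmorphM /= E Ez !mincl_tpow PoszD tpowD mpolyCM /=; ring.
Qed.

Let ascend k y : ideal_plus N s k y -> ideal_plus NL (mincl \o s) k (mincl y).
Proof.
elim: k y => [y [c ->]|k IH y /= [b /IH H]].
  by exists (mincl \o c); rewrite rmorph_sum; apply: eq_bigr => i _; rewrite rmorphM.
by exists (mincl b); rewrite -rmorphM -rmorphB.
Qed.

Lemma regular_lift_laurent : regular_mod NL (mincl \o s) r.
Proof.
move=> k a kr /descend[M [y [Hy E]]]; have [M' [z Ez]] := mincl_scale a.
have idk := ideal_plus_ideal s k (span_ideal_ideal g).
have /ascend : ideal_plus N s k ((pstpow F M)%:MP * z).
  apply: regular_lift => //.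
  have -> : s k * ((pstpow F M)%:MP * z) = (pstpow F M')%:MP * y.
    by apply: mincl_inj; rewrite !rmorphM /= E Ez !mincl_tpow; ring.
  exact: idealMl.
rewrite rmorphM /= Ez mincl_tpow => H.
have idL := ideal_plus_ideal (mincl \o s) k (span_ideal_ideal (mincl \o g)).
have := idealMl idL (tpow F (- (Posz M + Posz M')))%:MP H.
by rewrite !mulrA -!mpolyCM -!tpowD addrAC -addrA [_ + Posz M']addrC addNr tpow0 mul1r.
Qed.

End Lift.
End Lifting.

(** * Torsion-freeness of cut ideals *)

Section Potential.
Variables (R : comNzRingType) (c : R) (V : finType) (n : nat).
Variables (hd tl : 'I_n -> option V) (w : V -> nat).
Local Notation P := {mpoly R[n]}.
Implicit Types (Gam : {set V}) (m u : 'X_{1..n}) (pi : V -> nat).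

Definition leaves Gam : pred 'I_n := fun e => oin Gam (tl e) && ~~ oin Gam (hd e).
Definition in_mnm Gam : 'X_{1..n} := [multinom (enters hd tl Gam e : nat) | e < n].
Definition out_mnm Gam : 'X_{1..n} := [multinom (leaves Gam e : nat) | e < n].
(** Here [c] stands for [t]. As the exponent is additive over vertices, the weight of a potential is
    the sum of the weights of its level sets. *)
Definition cut_binomial Gam : P :=
  'X_[in_mnm Gam] - (c ^+ (\sum_(v in Gam) w v))%:MP * 'X_[out_mnm Gam].
Definition cut_ideal : set P := span_ideal cut_binomial.

Hypothesis cut_balanced : forall Gam, mdeg (in_mnm Gam) = mdeg (out_mnm Gam).
Hypothesis cut_entered : forall Gam, Gam != finset.set0 -> exists e, enters hd tl Gam e.

Definition opot pi (o : option V) := if o is Some v then pi v else 0%N.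

Definition feasible u pi := forall e, (opot pi (hd e) <= opot pi (tl e) + u e)%N.

Lemma sum_between a b M : (\sum_(h < M) ((a <= h < b) : nat) <= b - a)%N.
Proof.
suff : (\sum_(h < M) ((a <= h < b) : nat) <= minn M b - a)%N by lia.
elim: M => [|M IH]; rewrite ?big_ord0 // big_ord_recr /=.
move: IH; set S := (\sum_(h < M) _)%N; case: (leqP a M) => aM; case: (ltnP M b) => Mb /=; lia.
Qed.

(** For [h < pi v] the level set [lvl h] is nonempty, hence entered by some edge, and an edge [e]
    enters at most [u e] of these sets. The bound makes [dist] a maximum over a finite type. *)
Lemma feasible_bound u pi v : feasible u pi -> (pi v <= mdeg u)%N.
Proof.
move=> fpi; pose lvl h : {set V} := [set x | (h < pi x)%N]%SET.
have entE h e : enters hd tl (lvl h) e = (opot pi (tl e) <= h < opot pi (hd e))%N.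
  rewrite /enters /opot /oin; case: (hd e) => [x|]; last by rewrite ltn0 andbF.
  by rewrite inE andbC; case: (tl e) => [y|]; rewrite ?inE ?leq0n -?leqNgt.
apply: (@leq_trans (\sum_(h < pi v) \sum_e (enters hd tl (lvl h) e : nat))%N).
  rewrite -[X in (X <= _)%N]card_ord -sum1_card; apply: leq_sum => h _.
  have [|e he] := cut_entered (Gam := lvl h).
    by apply/finset.set0Pn; exists v; rewrite inE.
  by rewrite (bigD1 e) //= he.
rewrite exchange_big mdegE /=; apply: leq_sum => e _.
under eq_bigr => h _ do rewrite entE.
by apply: leq_trans (sum_between _ _ _) _; have := fpi e; lia.
Qed.

(* The length of a shortest path to v from the bottom boundary, the edge e
   having length u e: by duality, the largest feasible potential. *)
Definition dist u (v : V) : nat :=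
  (\max_(p : {ffun V -> 'I_(mdeg u).+1} |
     [forall e, opot (fun x => p x) (hd e) <= opot (fun x => p x) (tl e) + u e]) p v)%N.

Lemma dist_max u pi v : feasible u pi -> (pi v <= dist u v)%N.
Proof.
move=> fpi; pose p : {ffun V -> 'I_(mdeg u).+1} := [ffun x => inord (pi x)].
have pE x : p x = pi x :> nat by rewrite ffunE inordK // ltnS feasible_bound.
have oE o : opot (fun x => p x) o = opot pi o by case: o => //= x; rewrite pE.
rewrite -pE; rewrite /dist (bigD1 p) /= ?leq_maxl //.
by apply/forallP => e; rewrite !oE.
Qed.

Lemma dist_feasible u : feasible u (dist u).
Proof.
move=> e; case he : (hd e) => [v|] //=; apply/bigmax_leqP => p fp.
have /forallP/(_ e) := fp; rewrite he /= => /leq_trans; apply; rewrite leq_add2r.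
case: (tl e) => //= x.
by rewrite /dist (bigD1 p) /= ?leq_maxl.
Qed.

Lemma cut_shift Gam m e :
  ((m + in_mnm Gam)%MM e + oin Gam (tl e) = (m + out_mnm Gam)%MM e + oin Gam (hd e))%N.
Proof.
rewrite !mnmDE !mnmE /enters /leaves -!addnA; congr addn.
by case: (oin Gam (hd e)); case: (oin Gam (tl e)).
Qed.

Lemma opotD Gam pi o :
  opot (fun v => pi v + (v \in Gam))%N o = (opot pi o + oin Gam o)%N.
Proof. by case: o. Qed.

(** Replacing the out-monomial by the in-monomial changes edge lengths by the coboundary of the
    indicator of [Gam]; adding this indicator therefore carries feasible potentials for [u2] to
    feasible potentials for [u1]. *)
Lemma dist_cut Gam m v :
  dist (m + in_mnm Gam)%MM v = (dist (m + out_mnm Gam)%MM v + (v \in Gam))%N.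
Proof.
set u1 := (m + in_mnm Gam)%MM; set u2 := (m + out_mnm Gam)%MM.
have shift e : (u1 e + oin Gam (tl e) = u2 e + oin Gam (hd e))%N := cut_shift Gam m e.
have le1 x : (dist u2 x + (x \in Gam) <= dist u1 x)%N.
  apply: (dist_max (pi := fun x => (dist u2 x + (x \in Gam))%N)) => e.
  by rewrite !opotD; have := dist_feasible u2 e; have := shift e; lia.
(* Truncated subtraction is harmless: by [le1] the distance for [u1] is at least 1 on [Gam]. *)
have le2 : (dist u1 v - (v \in Gam) <= dist u2 v)%N.
  apply: (dist_max (pi := fun x => (dist u1 x - (x \in Gam))%N)) => e.
  have oB o : opot (fun x => (dist u1 x - (x \in Gam))%N) o = (opot (dist u1) o - oin Gam o)%N.
    by case: o.
  have oL o : (oin Gam o <= opot (dist u1) o)%N by case: o => //= x; have := le1 x; lia.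
  rewrite !oB; have := dist_feasible u1 e; have := shift e.
  by have := oL (tl e); have := oL (hd e); lia.
by have := le1 v; lia.
Qed.

(** The reduced costs of shortest path theory; for a feasible [pi] the subtraction does not
    truncate. *)
Definition reduce u pi : 'X_{1..n} :=
  [multinom (u e + opot pi (tl e) - opot pi (hd e))%N | e < n].
Definition pweight pi : nat := (\sum_v w v * pi v)%N.

Lemma reduce_cut Gam m :
  reduce (m + in_mnm Gam)%MM (dist (m + in_mnm Gam)%MM) =
  reduce (m + out_mnm Gam)%MM (dist (m + out_mnm Gam)%MM).
Proof.
apply/mnmP => e; rewrite ![reduce _ _ e]mnmE.
have dE o : opot (dist (m + in_mnm Gam)%MM) o
    = (opot (dist (m + out_mnm Gam)%MM) o + oin Gam o)%N.
  by case: o => //= v; rewrite dist_cut.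
by rewrite !dE; have := cut_shift Gam m e; lia.
Qed.

Lemma pweightD pi Gam :
  pweight (fun v => pi v + (v \in Gam))%N = (pweight pi + \sum_(v in Gam) w v)%N.
Proof.
rewrite /pweight [X in (_ + X)%N]big_mkcond -big_split; apply: eq_bigr => v _ /=.
by rewrite mulnDr; case: (v \in Gam); rewrite ?muln1 ?muln0.
Qed.

Lemma pweight_cut Gam m :
  pweight (dist (m + in_mnm Gam)%MM) =
  (pweight (dist (m + out_mnm Gam)%MM) + \sum_(v in Gam) w v)%N.
Proof.
rewrite -pweightD; apply: eq_bigr => v _; by rewrite dist_cut.
Qed.

(** Let [Gam] be the support of [pi]. By feasibility every edge entering [Gam] has positive length,
    so the in-monomial divides [X_[u]], and one cut relation lowers [pi] by 1 on [Gam]. *)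
Lemma reduce_mod u pi : feasible u pi ->
  cut_ideal ('X_[u] - (c ^+ pweight pi)%:MP * 'X_[reduce u pi]).
Proof.
have idN : is_ideal cut_ideal := span_ideal_ideal _.
have [k] := ubnP (\sum_v pi v)%N; elim: k u pi => // k IH u pi; rewrite ltnS => le_k fpi.
pose Gam : {set V} := [set v | (0 < pi v)%N]%SET.
have [G0|G0] := eqVneq Gam finset.set0.
  have pi0 v : pi v = 0%N.
    by have := finset.in_set0 v; rewrite -G0 inE; case: (pi v).
  have -> : pweight pi = 0%N by apply: big1 => v _; rewrite pi0 muln0.
  have -> : reduce u pi = u.
    apply/mnmP => e; rewrite mnmE.
    have o0 o : opot pi o = 0%N by case: o => //= v; rewrite pi0.
    by rewrite !o0 addn0 subn0.
  by rewrite expr0 mpolyC1 mul1r subrr; case: idN.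
pose m := (u - in_mnm Gam)%MM; pose pi' v := (pi v).-1.
have uE : u = (m + in_mnm Gam)%MM.
  rewrite submK //; apply/mnm_lepP => e; rewrite mnmE; case: (boolP (enters _ _ _ e)) => //.
  rewrite /enters /oin; have := fpi e; rewrite /opot; case: (hd e) => // v.
  rewrite inE; case: (tl e) => [x|] /=; rewrite ?inE; lia.
have piE : pi = (fun v => pi' v + (v \in Gam))%N.
  by apply/funext => v; rewrite /pi' inE; case: (pi v) => //= j; rewrite addn1.
have fpi' : feasible (m + out_mnm Gam)%MM pi'.
  move=> e; have := fpi e; rewrite {1 2}piE !opotD uE; have := cut_shift Gam m e.
  by rewrite -uE; lia.
have lt_k : (\sum_v pi' v < k)%N.
  apply: leq_trans le_k; rewrite piE big_split /= -addn1 leq_add2l.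
  have /finset.set0Pn[v vG] := G0; by rewrite (bigD1 v) //= vG.
have redE : reduce u pi = reduce (m + out_mnm Gam)%MM pi'.
  apply/mnmP => e; rewrite ![reduce _ _ e]mnmE piE !opotD uE.
  by have := cut_shift Gam m e; lia.
have := IH _ _ lt_k fpi'; rewrite -redE => HN.
have wE : pweight pi = (pweight pi' + \sum_(v in Gam) w v)%N by rewrite piE pweightD.
have -> : 'X_[u] - (c ^+ pweight pi)%:MP * 'X_[reduce u pi] =
    'X_[m] * cut_binomial Gam + (c ^+ (\sum_(v in Gam) w v))%:MP *
      ('X_[m + out_mnm Gam] - (c ^+ pweight pi')%:MP * 'X_[reduce u pi]).
  rewrite wE exprD mpolyCM [in 'X_[u]]uE /cut_binomial !mpolyXD; ring.
apply: (idealD idN); apply: (idealMl idN) => //; exact: span_ideal_gen.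
Qed.

Definition normal_mnm u : P := (c ^+ pweight (dist u))%:MP * 'X_[reduce u (dist u)].
(** The bound [k] is a parameter independent of [p], so that the map is linear. *)
Definition normal_form k (p : P) : P := \sum_(m : 'X_{1..n < k}) p@_m *: normal_mnm m.

Lemma normal_formD k : {morph normal_form k : p q / p + q}.
Proof. by move=> p q; rewrite -big_split; apply: eq_bigr => m _; rewrite mcoeffD scalerDl. Qed.

Lemma normal_formZ k a p : normal_form k (a *: p) = a *: normal_form k p.
Proof. by rewrite scaler_sumr; apply: eq_bigr => m _; rewrite mcoeffZ scalerA. Qed.

Lemma normal_form0 k : normal_form k 0 = 0.
Proof. by rewrite /normal_form big1 // => m _; rewrite mcoeff0 scale0r. Qed.

Lemma normal_formX k m :
  normal_form k 'X_[m] = if (mdeg m < k)%N then normal_mnm m else 0.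
Proof.
case: ltnP => mk.
  rewrite /normal_form (bigD1 (BMultinom mk)) //= mcoeffX eqxx scale1r big1 ?addr0 // => m' ne.
  by rewrite mcoeffX -[m == _]/(BMultinom mk == m' :> 'X_{1..n}) -bmeqP eq_sym (negPf ne) scale0r.
apply: big1 => m' _; rewrite mcoeffX; case: eqP => [E|_]; rewrite ?scale0r //.
by have := bmdeg m'; rewrite -E ltnNge mk.
Qed.

(** Both monomials of a multiple [X_[m]] of a cut relation have the same degree, so the bound [k]
    keeps or drops them together; if kept, they reduce to the same monomial, and the exponents of
    [c] differ by exactly the weight of [Gam]. *)
Lemma normal_form_cut k p : cut_ideal p -> normal_form k p = 0.
Proof.
move=> [a ->]; rewrite (big_morph _ (normal_formD k) (normal_form0 k)) big1 // => Gam _.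
rewrite [a Gam]mpolyE mulr_suml (big_morph _ (normal_formD k) (normal_form0 k)) big1 // => m _.
rewrite -scalerAl normal_formZ /cut_binomial.
suff -> : normal_form k ('X_[m] * ('X_[in_mnm Gam] -
   (c ^+ (\sum_(v in Gam) w v))%:MP * 'X_[out_mnm Gam])) = 0 by rewrite scaler0.
rewrite mulrBr mulrCA -!mpolyXD mul_mpolyC -scaleNr normal_formD normal_formZ !normal_formX.
rewrite !mdegD cut_balanced; case: ifP => _; rewrite ?scaler0 ?addr0 //.
rewrite /normal_mnm (pweight_cut Gam m) (reduce_cut Gam m) addnC exprD mpolyCM.
by rewrite -[X in _ + X]mul_mpolyC mpolyCN mulNr mulrA subrr.
Qed.

Lemma normal_form_mod k p : (msize p <= k)%N -> cut_ideal (p - normal_form k p).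
Proof.
move=> pk; rewrite {1}(mpolywE pk) -sumrB; apply: (ideal_sum (span_ideal_ideal _)) => m _.
rewrite -scalerBr -mul_mpolyC; apply: (idealMl (span_ideal_ideal _)).
exact/reduce_mod/dist_feasible.
Qed.

Hypothesis c_reg : forall x, c * x = 0 -> x = 0.

(** The normal form of [c p] is [c] times that of [p] and vanishes on the ideal; cancelling [c] in
    each coefficient kills the normal form of [p], to which [p] is congruent. *)
Lemma cut_ideal_torsion_free p : cut_ideal (c%:MP * p) -> cut_ideal p.
Proof.
move=> /(normal_form_cut (msize p)); rewrite mul_mpolyC normal_formZ => E.
have := normal_form_mod (leqnn (msize p)).
suff -> : normal_form (msize p) p = 0 by rewrite subr0.
apply/mpolyP => m; rewrite mcoeff0; apply: c_reg.
by rewrite -mcoeffZ E mcoeff0.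
Qed.

End Potential.

(** * Vanishing of Tor for regular sequences *)

Section LinearMaps.
Variable E : comNzRingType.
Implicit Types (U V W M N : lmodType E).

Lemma linear_ex U V (f : U -> V) : linear f -> exists g : {linear U -> V}, g =1 f.
Proof.
by move=> lf; exists (HB.pack f (GRing.isLinear.Build E U V *:%R f lf) : {linear U -> V}).
Qed.

Lemma submod_val_linear U (S : set U) : linear (@submod_val E U S).
Proof. by []. Qed.
HB.instance Definition _ U (S : set U) :=
  GRing.isLinear.Build E (submod S) U *:%R (@submod_val E U S) (@submod_val_linear U S).

Lemma gen_id U (S : set U) x : is_submodule S -> x \in gen S -> S x.
Proof. by move=> sS; apply: gen_sub. Qed.

Lemma gen_linear U V (f : {linear U -> V}) (S : set U) (T : set V) x :
  (forall y, S y -> f y \in gen T) -> x \in gen S -> f x \in gen T.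
Proof.
move=> fS; apply: (gen_sub (U := [set y | f y \in gen T])) => //.
by split=> [|a y z /= fy fz]; rewrite /= ?linear0 ?rpred0 // linearP rpredD // rpredZ.
Qed.

Lemma gen_mono U (S T : set U) x : S `<=` T -> x \in gen S -> x \in gen T.
Proof. by move=> ST; apply: (gen_linear (f := idfun)) => y /ST; apply: gen_incl. Qed.

Lemma quot_lift U V (S : set U) (f : {linear U -> V}) :
  (forall x, S x -> f x = 0) ->
  exists g : {linear quot S -> V}, forall x, g (toquot S x) = f x.
Proof.
move=> fS; have f0 x : x \in gen S -> f x = 0.
  apply: (gen_sub (U := [set y | f y = 0])) => //.
  by split=> [|a y z /= fy fz]; rewrite /= ?linear0 // linearP fy fz scaler0 addr0.
have fr x : f (repr (toquot S x)) = f x.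
  by apply/eqP; rewrite -subr_eq0 -linearB; apply/eqP/f0/toquotP; rewrite toquot_repr.
have lf : linear (fun q : quot S => f (repr q)).
  by move=> a p q; rewrite -[p]toquot_repr -[q]toquot_repr -linearP !fr linearP.
by have [g gE] := linear_ex lf; exists g => x; rewrite gE fr.
Qed.

Lemma toquot0P U (S : set U) x : toquot S x = 0 <-> x \in gen S.
Proof.
rewrite -[0](linear0 (toquot S)); split=> [/toquotP|xS]; first by rewrite subr0.
by apply/toquotP; rewrite subr0.
Qed.

Lemma free_lift_linear (S : choiceType) M (g : S -> M) : linear (free_lift g).
Proof.
have free_liftw (z : {malg E[S]}) (d : {fset S}) : (monalg.msupp z `<=` d)%fset ->
    free_lift g z = \sum_(s <- d) monalg.mcoeff s z *: g s.
  move=> zd; rewrite /free_lift; apply/esym.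
  rewrite (bigID (mem (monalg.msupp z))) /= [X in _ + X]big1 ?addr0; last first.
    by move=> s /monalg.mcoeff_outdom ->; rewrite scale0r.
  rewrite -big_filter; apply: perm_big; apply: uniq_perm; rewrite ?filter_uniq ?fset_uniq //.
  by move=> s; rewrite mem_filter andb_idr // => /(fsubsetP zd).
move=> a x y; pose d := (monalg.msupp (a *: x + y) `|` (monalg.msupp x `|` monalg.msupp y))%fset.
rewrite (free_liftw _ d) ?fsubsetUl // (free_liftw x d); last first.
  by rewrite /d fsetUCA fsubsetUl.
rewrite (free_liftw y d); last by rewrite /d fsetUA fsubsetUr.
rewrite scaler_sumr -big_split; apply: eq_bigr => s _ /=.
by rewrite monalg.mcoeffD monalg.mcoeffZ scalerDl scalerA.
Qed.
HB.instance Definition _ (S : choiceType) M (g : S -> M) :=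
  GRing.isLinear.Build E {malg E[S]} M *:%R (free_lift g) (free_lift_linear g).

Lemma free_liftU (S : choiceType) M (g : S -> M) s : free_lift g << s >> = g s.
Proof. by rewrite /free_lift monalg.msuppU oner_eq0 big_seq_fset1 monalg.mcoeffUU scale1r. Qed.

Lemma free_lift_comp (S : choiceType) M N (g : S -> M) (h : {linear M -> N}) z :
  free_lift (fun s => h (g s)) z = h (free_lift g z).
Proof. by rewrite /free_lift linear_sum; apply: eq_bigr => s _; rewrite linearZ. Qed.

Lemma malgZE (S : choiceType) (z : {malg E[S]}) :
  z = \sum_(s <- monalg.msupp z) monalg.mcoeff s z *: << s >>.
Proof.
rewrite {1}[z]monalg.monalgE; apply: eq_bigr => s _.
apply/monalg.malgP => k; rewrite monalg.mcoeffZ !monalg.mcoeffU.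
by case: eqP => _; rewrite ?mulr1n ?mulr0n ?mulr1 ?mulr0.
Qed.

Definition projective M := forall U V (g : {linear U -> V}) (h : {linear M -> V}),
  (forall y, exists x, g x = y) -> exists k : {linear M -> U}, forall p, g (k p) = h p.

Lemma free_projective (S : choiceType) : projective {malg E[S]}.
Proof.
move=> U V g h gs; have /boolp.choice[f fE] := fun s : S => gs (h << s >>).
exists (free_lift f) => z; rewrite [z]malgZE (linear_sum (free_lift f)) (linear_sum g) (linear_sum h).
apply: eq_bigr => s _.
by rewrite !linearZ /= free_liftU fE.
Qed.

Lemma prod_projective M N : projective M -> projective N -> projective (M * N)%type.
Proof.
move=> pM pN U V g h gs.
have [h1 h1E] : exists h1 : {linear M -> V}, forall x, h1 x = h (x, 0).
  apply: linear_ex => a x y.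
  by rewrite -linearP; congr (h _); apply/pair_equal_spec; rewrite /= scaler0 addr0.
have [h2 h2E] : exists h2 : {linear N -> V}, forall x, h2 x = h (0, x).
  apply: linear_ex => a x y.
  by rewrite -linearP; congr (h _); apply/pair_equal_spec; rewrite /= scaler0 addr0.
have [k1 k1E] := pM _ _ g h1 gs; have [k2 k2E] := pN _ _ g h2 gs.
have [k kE] : exists k : {linear (M * N)%type -> U}, forall x, k x = k1 x.1 + k2 x.2.
  apply: linear_ex => a x y /=.
  by rewrite !linearP scalerDr addrACA.
exists k => -[x y]; rewrite kE linearD k1E k2E h1E h2E -linearD; congr (h _).
by apply/pair_equal_spec; rewrite /= addr0 add0r.
Qed.

Section Exact.
Variables (K P M : lmodType E) (i : {linear K -> P}) (p : {linear P -> M}).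

Definition short_exact := [/\ injective i, forall x, p x = 0 <-> exists k, x = i k
  & forall m, exists x, p x = m].

Hypothesis ex : short_exact.

Lemma factor_kernel U (h : {linear U -> P}) : (forall x, p (h x) = 0) ->
  exists g : {linear U -> K}, forall x, i (g x) = h x.
Proof.
case: ex => i_inj pP _ ph.
have /boolp.choice[g gE] : forall x, exists k, h x = i k by move=> x; apply/pP.
have [g' g'E] : exists g' : {linear U -> K}, g' =1 g.
  by apply: linear_ex => a x y; apply: i_inj; rewrite linearP -!gE linearP.
by exists g' => x; rewrite g'E gE.
Qed.

End Exact.

Lemma kernel_exact U V (f : {linear U -> V}) : (forall y, exists x, f x = y) ->
  short_exact (@submod_val E U [set x | f x = 0]) f.
Proof.
move=> fs; split=> // [x y|x]; first exact: val_inj.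
have sub : is_submodule [set x | f x = 0].
  by split=> [|a y z /= fy fz]; rewrite /= ?linear0 // linearP fy fz scaler0 addr0.
split=> [fx|[k ->]]; last exact: (gen_id sub (submod_valP k)).
by exists (Submod (gen_incl (S := [set x | f x = 0]) fx)).
Qed.

Section Acyclic.
Variable S : set E^o.

(** The submodule [I M], for [I] the ideal spanned by [S]. *)
Definition ideal_mod M : {pred M} :=
  gen [set x : M | exists a m, S a /\ x = a *: m].

Arguments ideal_mod : clear implicits.

Lemma ideal_mod_gen M a (m : M) : S a -> a *: m \in ideal_mod M.
Proof. by move=> Sa; apply: gen_incl; exists a, m. Qed.

Lemma ideal_mod_linear M N (f : {linear M -> N}) x : x \in ideal_mod M -> f x \in ideal_mod N.
Proof. by apply: gen_linear => _ [a [m [Sa ->]]]; rewrite linearZ; apply: ideal_mod_gen. Qed.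

Lemma ideal_mod_surj M N (f : {linear M -> N}) y : (forall y, exists x, f x = y) ->
  y \in ideal_mod N -> exists2 x, x \in ideal_mod M & f x = y.
Proof.
move=> fs; apply: (gen_sub (U := [set y | exists2 x, x \in ideal_mod M & f x = y])).
  split=> [|a _ _ [x xI <-] [z zI <-]]; first by exists 0; rewrite ?rpred0 ?linear0.
  by exists (a *: x + z); rewrite ?linearP // rpredD ?rpredZ.
by move=> _ [a [n [Sa ->]]]; have [m <-] := fs n; exists (a *: m); rewrite ?ideal_mod_gen ?linearZ.
Qed.

(* Tor_j(M, E / I) = 0 for 0 < j <= n, read off an arbitrary projective
   presentation of M: injectivity of K / I K -> P / I P is Tor_1 = 0. *)
Fixpoint acyclic n M : Prop :=
  if n is n'.+1 then forall (K P : lmodType E) (i : {linear K -> P}) (p : {linear P -> M}),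
    projective P -> short_exact i p ->
    (forall k, i k \in ideal_mod P -> k \in ideal_mod K) /\ acyclic n' K
  else True.

(** A presentation of a projective module splits. The retraction [r] of [P] onto [K] gives
    injectivity modulo [I] and shows that [K] is projective, which feeds the induction. *)
Lemma projective_acyclic n M : projective M -> acyclic n M.
Proof.
elim: n M => // n IH M pM K P i p pP ex; have [i_inj ipP p_surj] := ex.
have [s sE] := pM _ _ p idfun p_surj.
have [h hE] : exists h : {linear P -> P}, forall x, h x = x - s (p x).
  by apply: linear_ex => a x y; rewrite (linearP p) (linearP s) scalerBr opprD addrACA.
have [r rE] : exists r : {linear P -> K}, forall x, i (r x) = h x.
  by apply: (factor_kernel ex) => x; rewrite hE linearB sE subrr.
have rK k : r (i k) = k.
  have pik : p (i k) = 0 by apply/ipP; exists k.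
  by apply: i_inj; rewrite rE hE pik linear0 subr0.
split=> [k /(ideal_mod_linear r)|]; first by rewrite rK.
apply: IH => U V g h' gs.
have [hr hrE] : exists hr : {linear P -> V}, forall x, hr x = h' (r x).
  by apply: linear_ex => a x y; rewrite !linearP.
have [k kE] := pP _ _ g hr gs.
have [k' k'E] : exists k' : {linear K -> U}, forall x, k' x = k (i x).
  by apply: linear_ex => a x y; rewrite !linearP.
by exists k' => x; rewrite k'E kE hrE rK.
Qed.

(** The hypothesis on [a] is the injectivity of [A / I A -> B / I B]. As in the horseshoe lemma, the
    given presentation of [C] and a free one of [A] combine to one of [B]; the kernels form a
    sequence [KA -> KB -> K] with the same properties, to which the induction applies. *)
Lemma cokernel_acyclic (A B C : lmodType E) (a : {linear A -> B}) (b : {linear B -> C}) :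
  short_exact a b -> (forall x, a x \in ideal_mod B -> x \in ideal_mod A) ->
  (forall n, acyclic n A) -> (forall n, acyclic n B) -> forall n, acyclic n C.
Proof.
move=> exab aI acA acB n; elim: n A B C a b exab aI acA acB => // n IH A B C a b exab aI acA acB.
move=> K F i p pF ex; have [i_inj ipP p_surj] := ex; have [a_inj abP b_surj] := exab.
have [q qE] := pF _ _ b p b_surj.
pose FA : lmodType E := {malg E[A]}; pose pA : {linear FA -> A} := free_lift id.
have pA_surj y : exists x, pA x = y by exists << y >>; exact: free_liftU.
have [pB pBE] : exists pB : {linear (FA * F)%type -> B}, forall x, pB x = a (pA x.1) + q x.2.
  by apply: linear_ex => c x y /=; rewrite !linearP scalerDr addrACA.
have pB_surj z : exists x, pB x = z.
  have [y Ey] := p_surj (b z); have [w Ew] : exists w, z - q y = a w.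
    by apply/abP; rewrite linearB qE Ey subrr.
  by have [x Ex] := pA_surj w; exists (x, y); rewrite pBE /= Ex -Ew subrK.
pose KA : lmodType E := submod [set x | pA x = 0].
pose iA : {linear KA -> FA} := @submod_val E FA [set x | pA x = 0].
have exA : short_exact iA pA := kernel_exact pA_surj.
pose KB : lmodType E := submod [set x | pB x = 0].
pose iB : {linear KB -> (FA * F)%type} := @submod_val E _ [set x | pB x = 0].
have exB : short_exact iB pB := kernel_exact pB_surj.
have pFAF : projective (FA * F)%type by apply: prod_projective => //; exact: free_projective.
have [inA inAE] : exists f : {linear FA -> (FA * F)%type}, forall x, f x = (x, 0).
  by apply: linear_ex => c x y; apply/pair_equal_spec; rewrite /= scaler0 addr0.
have [inF inFE] : exists f : {linear F -> (FA * F)%type}, forall x, f x = (0, x).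
  by apply: linear_ex => c x y; apply/pair_equal_spec; rewrite /= scaler0 addr0.
have [prA prAE] : exists f : {linear (FA * F)%type -> FA}, forall x, f x = x.1.
  exact: linear_ex.
have [prF prFE] : exists f : {linear (FA * F)%type -> F}, forall x, f x = x.2.
  exact: linear_ex.
have [u uE] : exists u : {linear KA -> KB}, forall x, iB (u x) = (iA x, 0).
  have [h hE] : exists h : {linear KA -> (FA * F)%type}, forall x, h x = inA (iA x).
    by apply: linear_ex => c x y; rewrite !linearP.
  have [|u uE] := factor_kernel exB (h := h).
    move=> x; rewrite hE inAE pBE /= linear0 addr0; case: exA => _ /(_ (iA x)) [_ ->].
      by rewrite linear0.
    by exists x.
  by exists u => x; rewrite uE hE inAE.
have [v vE] : exists v : {linear KB -> K}, forall x, i (v x) = (iB x).2.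
  have [h hE] : exists h : {linear KB -> F}, forall x, h x = prF (iB x).
    by apply: linear_ex => c x y; rewrite !linearP.
  have [|v vE] := factor_kernel ex (h := h).
    move=> x; rewrite hE prFE -qE; apply/abP; exists (- (pA (iB x).1)).
    rewrite linearN; apply/eqP; rewrite -addr_eq0 addrC -pBE; apply/eqP.
    by case: exB => _ /(_ (iB x)) [_ ->] //; exists x.
  by exists v => x; rewrite vE hE prFE.
have iA0 x : pA (iA x) = 0 by case: exA => _ /(_ (iA x)) [_ ->] //; exists x.
have lift_KB x y : a (pA x) + q y = 0 -> exists k, (x, y) = iB k.
  by move=> xy0; case: exB => _ /(_ (x, y)) [+ _] _; apply; rewrite pBE.
have exuv : short_exact u v.
  split.
  - move=> x y /(congr1 iB); rewrite !uE => -[]; by case: exA => + _ _; apply.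
  - move=> x; split=> [vx0|[k ->]]; last first.
      by apply: i_inj; rewrite vE uE linear0.
    have := vE x; rewrite vx0 linear0 => x2.
    have [k kE] : exists k, (iB x).1 = iA k.
      case: exA => _ /(_ (iB x).1) [+ _] _; apply; apply: a_inj; rewrite linear0.
      have : pB (iB x) = 0 by case: exB => _ /(_ (iB x)) [_ ->] //; exists x.
      by rewrite pBE -x2 linear0 addr0.
    exists k; case: exB => iB_inj _ _; apply: iB_inj.
    by rewrite uE -kE x2; case: (iB x).
  - move=> k; have [z zE] : exists z, q (i k) = a z.
      by apply/abP; rewrite qE; apply/ipP; exists k.
    have [x' x'E] := pA_surj z; have [|l lE] := lift_KB (- x') (i k).
      by rewrite !linearN x'E zE addNr.
    by exists l; apply: i_inj; rewrite vE -lE.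
have Kac m : acyclic m KA by case: (acA m.+1 _ _ _ _ (@free_projective A) exA).
have KBac m : acyclic m KB by case: (acB m.+1 _ _ _ _ pFAF exB).
have uI x : u x \in ideal_mod KB -> x \in ideal_mod KA.
  move=> /(ideal_mod_linear iB)/(ideal_mod_linear prA); rewrite prAE uE /=.
  by case: (acA 1%N _ _ _ _ (@free_projective A) exA) => + _; apply.
split; last exact: (IH _ _ _ u v exuv).
(* As [q (i k) = a z] lies in [I B], [z] lies in [I A] and lifts to some [x] in [I FA]. The pair
   [(- x, i k)] is then an element of [KB] over [k], lies in [I (FA * F)], and hence in [I KB]. *)
move=> k kI; have [z zE] : exists z, q (i k) = a z.
  by apply/abP; rewrite qE; apply/ipP; exists k.
have /(ideal_mod_surj pA_surj)[x xI xE] : z \in ideal_mod A.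
  by apply: aI; rewrite -zE; apply: ideal_mod_linear.
have [|l lE] := lift_KB (- x) (i k); first by rewrite !linearN xE zE addNr.
have lI : l \in ideal_mod KB.
  case: (acB 1%N _ _ _ _ pFAF exB) => + _; apply; rewrite -lE.
  have -> : (- x, i k) = inA (- x) + inF (i k).
    by rewrite inAE inFE; apply/pair_equal_spec; rewrite /= addr0 add0r.
  by apply: rpredD; apply: ideal_mod_linear; rewrite ?rpredN.
have -> : k = v l by apply: i_inj; rewrite vE -lE.
exact: ideal_mod_linear.
Qed.

End Acyclic.
End LinearMaps.
Arguments ideal_mod {E} S M _.

(** * Acyclicity of quotients by a regular sequence *)

Section RegularQuotient.
Variables (E : comNzRingType) (N : set E^o) (f : nat -> E) (r : nat).

Definition first_gens k : set E^o := [set x | exists2 i, (i < k)%N & x = f i].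

Lemma gen_mull (T : set E^o) (a x : E) : (x : E^o) \in gen T -> (a * x : E^o) \in gen T.
Proof. by move=> xT; have := gen_submod_closed T => -[T0 /(_ a x 0 xT T0)]; rewrite addr0. Qed.

Lemma gen_ideal (T : set E^o) : is_ideal (P := E) [set x : E | (x : E^o) \in gen T].
Proof. by split=> [|a x y /= xT yT]; [exact: rpred0 | apply: rpredD => //; apply: gen_mull]. Qed.

Lemma gen_first_gens k (T : set E^o) (x : E) :
  (x : E^o) \in gen (first_gens k `|` T) <-> ideal_plus [set y : E | (y : E^o) \in gen T] f k x.
Proof.
have idk := ideal_plus_ideal f k (gen_ideal T); split.
  apply: (gen_sub (M := E^o) (U := ideal_plus [set y : E | (y : E^o) \in gen T] f k)) => //.
  move=> y [[i ik ->]|yT]; first by apply: ideal_plus_gen => //; apply: gen_ideal.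
  by apply: (@ideal_plusW _ _ _ 0%N) => //; apply: gen_incl.
clear idk; elim: k x => [x|k IH x /= [b /IH H]]; first by apply: (@gen_mono E E^o T) => y; right.
rewrite -[x](subrK (f k * b)); apply: rpredD.
  apply: (@gen_mono E E^o (first_gens k `|` T)) H => y [[i ik ->]|yT]; [left|by right].
  by exists i => //; apply: ltnW.
by rewrite mulrC; apply: gen_mull; apply: gen_incl; left; exists k.
Qed.

(** Turns injectivity modulo [I] between quotients of [E] into regularity modulo the ideal spanned
    by [N]. *)
Lemma quot_ideal_mod (T : set E^o) (y : E^o) :
  toquot T y \in ideal_mod N (quot T) <-> y \in gen (T `|` N).
Proof.
split.
  have [|h hE] := @quot_lift E E^o (quot (T `|` N)) T (toquot (T `|` N)).
    by move=> x Tx; apply/toquot0P; apply: gen_incl; left.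
  move=> yI; apply/toquot0P; rewrite -hE.
  apply: (gen_sub (U := [set z | h z = 0])) yI => [|_ [a [m [Na ->]]] /=].
    by split=> [|a x z /= hx hz]; rewrite /= ?linear0 // linearP hx hz scaler0 addr0.
  rewrite linearZ /= -[m]toquot_repr hE -linearZ; apply/toquot0P.
  rewrite [a *: _]mulrC; apply: gen_mull; apply: gen_incl; by right.
apply: gen_linear => z [Tz|Nz] /=; first by rewrite (_ : toquot T z = 0) ?rpred0 //; apply/toquot0P/gen_incl.
have -> : toquot T z = (z : E) *: toquot T (1 : E^o).
  by rewrite -linearZ; congr toquot; apply/esym/mulr1.
exact: ideal_mod_gen.
Qed.

(** There are no generators, so the quotient is [E], free of rank one. *)
Lemma quot_set0_projective : projective (quot (first_gens 0)).
Proof.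
move=> U V g h gs; have [x0 x0E] := gs (h (toquot _ (1 : E^o))).
have [k kE] : exists k : {linear E^o -> U}, forall x, k x = x *: x0.
  by apply: linear_ex => a x y; rewrite scalerDl scalerA.
have [|k' k'E] := @quot_lift E E^o U (first_gens 0) k; first by move=> x [].
exists k' => p; rewrite -[p]toquot_repr k'E kE linearZ x0E -linearZ -linearZ.
by congr (h (toquot _ _)); apply: mulr1.
Qed.

Hypothesis regE : regular_mod [set (0 : E)] f r.
Hypothesis regN : regular_mod [set y : E | (y : E^o) \in gen N] f r.

Lemma gen_first_gens0 k (x : E) :
  (x : E^o) \in gen (first_gens k) <-> ideal_plus [set (0 : E)] f k x.
Proof.
have gen0 : [set y : E | (y : E^o) \in gen set0] = [set (0 : E)].
  apply/seteqP; split=> [y|y ->]; last exact: rpred0.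
  apply: (gen_sub (M := E^o) (U := [set (0 : E^o)])) => //.
  by split=> // a u v /= -> ->; rewrite scaler0 addr0.
by rewrite -gen0 -gen_first_gens setU0.
Qed.

(** Each quotient is the cokernel of multiplication by [f k] on the previous one. This map is
    injective by [regE], and remains so modulo [N] by [regN]: these are the inputs of
    [cokernel_acyclic]. *)
Lemma quot_acyclic k n : (k <= r)%N -> acyclic N n (quot (first_gens k)).
Proof.
elim: k n => [|k IH] n kr; first exact: projective_acyclic quot_set0_projective.
pose Mk : lmodType E := quot (first_gens k).
have [a aE] : exists a : {linear Mk -> Mk}, forall x, a x = f k *: x.
  by apply: linear_ex => c x y; rewrite scalerDr !scalerA mulrC.
have [|b bE] := @quot_lift E E^o (quot (first_gens k.+1)) (first_gens k) (toquot _).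
  by move=> x [i ik ->]; apply/toquot0P/gen_incl; exists i => //; apply: ltnW.
have aq y : f k *: toquot (first_gens k) (y : E^o) = toquot (first_gens k) (f k * y : E^o).
  by rewrite -linearZ.
apply: (cokernel_acyclic (a := a) (b := b)) => [|x|m|m].
- split.
  + move=> x y; rewrite !aE => /eqP; rewrite -subr_eq0 -scalerBr => /eqP xy.
    apply/eqP; rewrite -subr_eq0; apply/eqP; move: xy; rewrite -[x - y]toquot_repr aq.
    move=> /toquot0P/gen_first_gens0 H; apply/toquot0P/gen_first_gens0.
    exact: regE.
  + move=> x; rewrite -[x]toquot_repr bE; split.
      move=> /toquot0P/gen_first_gens0 /= [c /gen_first_gens0 H].
      exists (toquot _ (c : E^o)); rewrite aE aq; apply/eqP; rewrite -subr_eq0 -linearB.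
      exact/eqP/toquot0P.
    move=> [w wE]; rewrite -bE wE aE linearZ -[w]toquot_repr bE /= -linearZ.
    apply/toquot0P; rewrite [_ *: _]mulrC; apply: gen_mull.
    by apply: gen_incl; exists k.
  + by move=> m; exists (toquot _ (repr m)); rewrite bE; exact: toquot_repr.
- rewrite aE -[x]toquot_repr aq => /quot_ideal_mod/gen_first_gens H.
  by apply/quot_ideal_mod/gen_first_gens; apply: regN.
- exact: IH (ltnW kr).
- exact: IH (ltnW kr).
Qed.

End RegularQuotient.

(** * Tensor products and Tor with a cyclic module *)

Section Tensor.
Variable E : comNzRingType.
Implicit Types M N X : lmodType E.

Lemma pureDl M N a (m m' : M) (n : N) : pure (a *: m + m') n = a *: pure m n + pure m' n.
Proof.
apply/eqP; rewrite -subr_eq0 -(linearP (toquot _)) -(linearB (toquot _)).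
apply/eqP/toquot0P/gen_incl; left; exists a, m, m', n; by rewrite opprD addrA.
Qed.

Lemma pureDr M N a (m : M) (n n' : N) : pure m (a *: n + n') = a *: pure m n + pure m n'.
Proof.
apply/eqP; rewrite -subr_eq0 -(linearP (toquot _)) -(linearB (toquot _)).
apply/eqP/toquot0P/gen_incl; right; exists a, m, n, n'; by rewrite opprD addrA.
Qed.

Lemma pure0l M N (n : N) : pure (0 : M) n = 0.
Proof. by have := pureDl (-1) (0 : M) 0 n; rewrite !scaler0 addr0 scaleN1r addNr. Qed.
Lemma pure0r M N (m : M) : pure m (0 : N) = 0.
Proof. by have := pureDr (-1) m (0 : N) 0; rewrite !scaler0 addr0 scaleN1r addNr. Qed.
Lemma pureZl M N a (m : M) (n : N) : pure (a *: m) n = a *: pure m n.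
Proof. by have := pureDl a m 0 n; rewrite pure0l !addr0. Qed.
Lemma pureZr M N a (m : M) (n : N) : pure m (a *: n) = a *: pure m n.
Proof. by have := pureDr a m n 0; rewrite pure0r !addr0. Qed.
Lemma pureBl M N (m m' : M) (n : N) : pure (m - m') n = pure m n - pure m' n.
Proof. by rewrite addrC -scaleN1r pureDl scaleN1r addrC. Qed.

Lemma tensor_ind M N (Q : set (tensor M N)) : is_submodule Q ->
  (forall m n, Q (pure m n)) -> forall z, Q z.
Proof.
move=> [Q0 QP] Qpure z; rewrite -[z]toquot_repr [repr z]malgZE linear_sum.
elim/big_ind: _ => // [x y Qx Qy|[m n] _]; first by rewrite -[x]scale1r; apply: QP.
by rewrite linearZ /= -[_ *: _]addr0; apply: QP => //; apply: Qpure.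
Qed.

Lemma tensor_lift M N X (g : M -> N -> X) :
  (forall a m m' n, g (a *: m + m') n = a *: g m n + g m' n) ->
  (forall a m n n', g m (a *: n + n') = a *: g m n + g m n') ->
  exists h : {linear tensor M N -> X}, forall m n, h (pure m n) = g m n.
Proof.
move=> gl gr.
have [|h hE] := @quot_lift E _ X (tensor_rel (M := M) (N := N))
    (free_lift (fun p : M * N => g p.1 p.2)).
  move=> z [[a [m [m' [n ->]]]]|[a [m [n [n' ->]]]]].
    by rewrite !linearB linearZ /= !free_liftU /= gl -addrA -opprD subrr.
  by rewrite !linearB linearZ /= !free_liftU /= gr -addrA -opprD subrr.
by exists h => m n; rewrite hE /= free_liftU.
Qed.

Lemma tensor_mapl_linear M M' N (f : {linear M -> M'}) :
  exists2 h : {linear tensor M N -> tensor M' N}, tensor_mapl (N := N) f =1 h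
    & forall m n, h (pure m n) = pure (f m) n.
Proof.
have [|h hE] := @quot_lift E _ (tensor M' N) (tensor_rel (M := M) (N := N))
    (free_lift (fun p : M * N => pure (f p.1) p.2)).
  move=> z [[a [m [m' [n ->]]]]|[a [m [n [n' ->]]]]].
    by rewrite !linearB linearZ /= !free_liftU /= (linearP f) pureDl -addrA -opprD subrr.
  by rewrite !linearB linearZ /= !free_liftU /= pureDr -addrA -opprD subrr.
exists h => [z|m n]; first by rewrite -[in RHS](toquot_repr z) hE.
by rewrite hE /= free_liftU.
Qed.

Variable S : set E^o.
Local Notation Q := (quot S).
Local Notation q1 := (toquot S (1 : E^o)).

Lemma tensor_quotE M (z : tensor M Q) : exists m, z = pure m q1.
Proof.
apply: (tensor_ind (Q := [set z | exists m : M, z = pure m q1])).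
  split=> [|a _ _ [m ->] [m' ->]]; first by exists 0; rewrite pure0l.
  by exists (a *: m + m'); rewrite pureDl.
move=> m n; exists ((repr n : E) *: m); rewrite pureZl -pureZr -linearZ.
by congr pure; rewrite -[LHS]toquot_repr; congr toquot; apply/esym/mulr1.
Qed.

(** The tensor product with [E / I] is [M / I M]. The nontrivial direction evaluates the map sending
    [m] tensor [q] to the class of [q m]. *)
Lemma pure_quot_eq0 M (m : M) : pure m q1 = 0 <-> m \in ideal_mod S M.
Proof.
pose T : set M := [set x | exists a m', S a /\ x = a *: m'].
split=> [m0|]; last first.
  apply: (gen_sub (U := [set x | pure x q1 = 0])) => [|_ [a [x [Sa ->]]] /=].
    split=> [|a x y /= x0 y0]; first exact: pure0l.
    by rewrite pureDl x0 y0 scaler0 addr0.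
  rewrite pureZl -pureZr -linearZ /= (_ : toquot S _ = 0) ?pure0r //.
  by apply/toquot0P; rewrite [a *: _]mulr1; apply: gen_incl.
have SM a (x : quot T) : a \in gen S -> (a : E) *: x = 0.
  apply: (gen_sub (M := E^o) (U := [set a : E^o | (a : E) *: x = 0])) => [|b Sb /=].
    split=> [|b y z /= y0 z0]; first by rewrite /= scale0r.
    by rewrite scalerDl z0 addr0 -scalerA y0 scaler0.
  by rewrite -[x]toquot_repr -linearZ; apply/toquot0P/gen_incl; exists b, (repr x).
have reprP (y : E^o) (x : quot T) : (repr (toquot S y) : E) *: x = (y : E) *: x.
  apply/eqP; rewrite -subr_eq0 -scalerBl; apply/eqP/SM.
  by apply/toquotP; rewrite toquot_repr.
have [||h hE] := @tensor_lift M Q (quot T) (fun m q => (repr q : E) *: toquot T m).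
- by move=> a x x' q; rewrite linearP scalerDr !scalerA mulrC.
- move=> a x q q'; rewrite -[in LHS](toquot_repr q) -[in LHS](toquot_repr q').
  by rewrite -linearP reprP scalerDl scalerA.
have := hE m q1; rewrite m0 linear0 reprP scale1r => /esym/toquot0P.
by [].
Qed.

Lemma syzygy_exact M n : short_exact (@submod_val E {malg E[syzygy M n]}
   [set z : {malg E[syzygy M n]} | free_lift id z = 0]) (free_lift (@id (syzygy M n))).
Proof. by apply: (kernel_exact (f := free_lift id)) => y; exists << y >>; exact: free_liftU. Qed.

(** A cycle has the form [x] tensor 1, and [x] maps to some [k] in syzygy [n + 1] lying in [I F_n],
    where [F_n] is the [n]-th free module. Acyclicity of syzygy [n] puts [k] in [I] times syzygy
    [n + 1], so [k] is also the image of some [x'] in [I F_(n+1)]. Now [x'] tensor 1 is zero, and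
    [x - x'] lies in the next syzygy, which gives a boundary. *)
Lemma tor_acyclic M n (z : tor n.+1 M Q) : (forall m, acyclic S m M) -> z = 0.
Proof.
move=> acM.
have acS j m : acyclic S m (syzygy M j).
  elim: j m => // j IH m; have := IH m.+1 _ _ _ _ (@free_projective E _) (syzygy_exact M j).
  by case.
have [K0 _] := acS n 1%N _ _ _ _ (@free_projective E _) (syzygy_exact M n).
have dE : exists2 d : {linear tensor (resolution M n.+1) Q -> tensor (resolution M n) Q},
    tor_diff (M := M) (N := Q) (n := n) =1 d
    & forall m q, d (pure m q) = pure (free_lift (fun z : syzygy M n.+1 => submod_val z) m) q.
  exact: (tensor_mapl_linear Q (free_lift (fun z : syzygy M n.+1 => submod_val z))).
have d'E : exists2 d : {linear tensor (resolution M n.+2) Q -> tensor (resolution M n.+1) Q},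
    tor_diff (M := M) (N := Q) (n := n.+1) =1 d
    & forall m q, d (pure m q) = pure (free_lift (fun z : syzygy M n.+2 => submod_val z) m) q.
  exact: (tensor_mapl_linear Q (free_lift (fun z : syzygy M n.+2 => submod_val z))).
have [d dd dpure] := dE; have [d' dd' dpure'] := d'E.
rewrite -[z]toquot_repr; apply/toquot0P/gen_incl; move: (repr z) => {z} z.
have zc : tor_diff (submod_val z) = 0.
  apply: (gen_id _ (submod_valP z)); split=> [|a x y /= x0 y0]; first by rewrite /= dd linear0.
  by move: x0 y0; rewrite /= !dd linearP => -> ->; rewrite scaler0 addr0.
have [x xE] := tensor_quotE (submod_val z).
rewrite xE dd dpure in zc; move/pure_quot_eq0: zc.
have [k kE] : exists k : syzygy M n.+1, free_lift id x = k by eexists.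
have -> : free_lift (fun z : syzygy M n.+1 => submod_val z) x = submod_val k.
  by rewrite -kE; exact: (free_lift_comp id (@submod_val E _ [set z : {malg E[syzygy M n]} | free_lift id z = 0]) x).
move=> /K0 kI.
have surj : forall y : syzygy M n.+1, exists x, (free_lift id : {linear {malg E[syzygy M n.+1]} -> _}) x = y.
  by move=> y; exists << y >>; exact: free_liftU.
have [x' x'I x'E] := ideal_mod_surj surj kI.
have [_ /(_ (x - x')) [+ _] _] := syzygy_exact M n.+1.
case; first by rewrite linearB /= kE x'E subrr.
move=> k' k'E; exists (pure << k' >> q1).
rewrite dd' dpure' /= free_liftU -k'E pureBl xE.
by have /pure_quot_eq0 -> := x'I; rewrite subr0.
Qed.

End Tensor.

(** * The edge ring of a framed graph *)

Lemma rmorph_cong (R : comNzRingType) n (J : set {mpoly R[n]})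
    (h : {rmorphism {mpoly R[n]} -> {mpoly R[n]}}) p :
  is_ideal J -> (forall c, h c%:MP = c%:MP) -> (forall i, J ('X_i - h 'X_i)) -> J (p - h p).
Proof.
move=> idJ hC Jh.
suff -> : h p = p \mPo [tuple h 'X_i | i < n].
  by apply: comp_mpoly_cong => // i; rewrite tnth_mktuple.
rewrite {1}(mpolyE p) rmorph_sum comp_mpolyEX; apply: eq_bigr => m _.
rewrite -!mul_mpolyC rmorphM hC; congr (_ * _); rewrite comp_mpolyX mpolyXE_id rmorph_prod.
by apply: eq_bigr => i _; rewrite rmorphXn tnth_mktuple.
Qed.

Lemma toquot_ring0P (R : comNzRingType) (S : set R^o) (x : R) :
  toquot_ring S x = 0 <-> (x : R^o) \in gen S.
Proof. exact: toquot0P. Qed.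

Lemma quot_ring_lift (R : comNzRingType) (S : set R^o) (T : pzRingType) (h : {rmorphism R -> T}) :
  (forall x : R, S x -> h x = 0) ->
  exists g : {rmorphism quot_ring S -> T}, forall x, g (toquot_ring S x) = h x.
Proof.
move=> hS; have h0 x : x \in gen S -> h x = 0.
  apply: (gen_sub (M := R^o) (U := [set y : R^o | h y = 0])) => //.
  split=> [|a y z /= hy hz]; first exact: rmorph0.
  by rewrite rmorphD [_ *: _]/(_ * _) rmorphM hy mulr0 hz addr0.
have fr (x : R) : h (repr (toquot_ring S x)) = h x.
  apply/eqP; rewrite -subr_eq0 -rmorphB; apply/eqP/h0.
  by apply/toquotP; rewrite toquot_repr.
pose g (q : quot_ring S) := h (repr q).
have g_zmod : zmod_morphism g.
  move=> p q; rewrite -[p]toquot_repr -[q]toquot_repr /g -[_ - _](rmorphB (toquot_ring S)).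
  by rewrite !fr rmorphB.
have g_monoid : monoid_morphism g.
  split=> [|p q]; first by rewrite /g -(rmorph1 (toquot_ring S)) fr rmorph1.
  rewrite -[p]toquot_repr -[q]toquot_repr /g -[_ * _](rmorphM (toquot_ring S)).
  by rewrite !fr rmorphM.
exists (HB.pack g (GRing.isZmodMorphism.Build _ _ g g_zmod)
   (GRing.isMonoidMorphism.Build _ _ g g_monoid) : {rmorphism quot_ring S -> T}).
exact: fr.
Qed.

Lemma ideal_plusN (P : comPzRingType) (J : set P) s k x :
  ideal_plus J (fun i => - s i) k x <-> ideal_plus J s k x.
Proof.
elim: k x => //= k IH x; split=> -[b]; first by move=> /IH; exists (- b); rewrite mulrN -mulNr.
by move=> H; exists (- b); apply/IH; rewrite mulrNN.
Qed.

Lemma regular_modN (P : comPzRingType) (J : set P) s r : is_ideal J ->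
  regular_mod J s r -> regular_mod J (fun i => - s i) r.
Proof.
move=> idJ reg k a kr /ideal_plusN; rewrite mulNr => H; apply/ideal_plusN/reg => //.
by rewrite -[_ * _]opprK; apply: idealN => //; apply: ideal_plus_ideal.
Qed.

Lemma regular_mod_iso (P Q : comPzRingType) (th : {rmorphism Q -> P}) (et : {rmorphism P -> Q})
    (J : set P) (s : nat -> Q) r :
  cancel th et -> cancel et th ->
  regular_mod J (th \o s) r -> regular_mod [set q | J (th q)] s r.
Proof.
move=> thK etK reg; have tr k q : ideal_plus [set q | J (th q)] s k q <-> ideal_plus J (th \o s) k (th q).
  elim: k q => // k IH q /=; split=> -[b].
    by move=> /IH; exists (th b); rewrite -rmorphM -rmorphB.
  by exists (et b); apply/IH; rewrite rmorphB rmorphM etK.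
move=> k a kr /tr; rewrite rmorphM => H; apply/tr; exact: reg.
Qed.

Section FramedGraph.
Variables (F : fieldType) (G : graph) (l : edge G -> nat).
Local Notation L := (laurent F).
Local Notation s := (fun e : edge G => Posz (l e)).
Local Notation ER := (edge_ring F s).
Local Notation n := #|edge G|.
Local Notation PL := {mpoly L[n]}.
Local Notation PO := {mpoly (pseries F)[n]}.
Local Notation P2 := {mpoly L[#|{: edge G + edge G}|]}.

Hypothesis in_degree : forall v : vertex G, #|[pred e | head e == Some v]| = if thick v then 2 else 1%N.
Hypothesis out_degree : forall v : vertex G, #|[pred e | tail e == Some v]| = if thick v then 2 else 1%N.
Hypothesis framing_head : forall e : edge G, head e != None -> (0 < l e)%N.
Hypothesis framing_tail : forall e : edge G, tail e != None -> (0 < l e + (head e == None))%N.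

Definition etop (e : edge G) : nat := head e == None.
Definition elen (e : edge G) : nat := (l e + etop e)%N.

(* In the coordinates Y_e = t ^ - etop e * y_e every relation of N(G) reads
   Y_in = t ^ k * Y_out with 0 < k. *)
Definition edge_to_mpoly (i : 'I_#|{: edge G + edge G}|) : PL :=
  match enum_val i with
  | inl e => (tpow F (elen e))%:MP * 'X_(enum_rank e)
  | inr e => (tpow F (etop e))%:MP * 'X_(enum_rank e)
  end.
Definition edge_coords : #|{: edge G + edge G}|.-tuple PL := [tuple edge_to_mpoly i | i < _].

Definition mpoly_coords : n.-tuple P2 :=
  [tuple (tpow F (- (etop (enum_val i))%:Z))%:MP * 'X_(enum_rank (inr (enum_val i) : edge G + edge G)) | i < n].

Lemma edge_coordsX (e : edge G + edge G) :
  'X_(enum_rank e) \mPo edge_coords = edge_to_mpoly (enum_rank e).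
Proof. by rewrite comp_mpolyXU -tnth_nth tnth_mktuple. Qed.

Lemma mpoly_coordsX (i : 'I_n) : 'X_i \mPo mpoly_coords =
  (tpow F (- (etop (enum_val i))%:Z))%:MP * 'X_(enum_rank (inr (enum_val i) : edge G + edge G)).
Proof. by rewrite comp_mpolyXU -tnth_nth tnth_mktuple. Qed.

(** Both segment variables of an edge are multiples of one coordinate by powers of [t], so the edge
    ring is a polynomial ring with one variable for each edge. *)
Lemma edge_ring_mpoly_iso :
  exists (th : {rmorphism ER -> PL}) (et : {rmorphism PL -> ER}),
  [/\ cancel th et, cancel et th,
      forall c, th (edge_scalar s c) = c%:MP,
      forall e, th (xvar F s e) = (tpow F (elen e))%:MP * 'X_(enum_rank e)
    & forall e, th (yvar F s e) = (tpow F (etop e))%:MP * 'X_(enum_rank e)].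
Proof.
have thS x : edge_ring_rel s x -> x \mPo edge_coords = 0.
  move=> [e ->]; rewrite rmorphB rmorphM /= comp_mpolyC !edge_coordsX /edge_to_mpoly !enum_rankK.
  by rewrite mulrA -mpolyCM -tpowD -PoszD subrr.
have [th thE] := @quot_ring_lift _ _ PL (comp_mpoly edge_coords) thS.
pose et : {rmorphism PL -> ER} := toquot_ring (edge_ring_rel s) \o comp_mpoly mpoly_coords.
exists th, et; split.
- move=> q; rewrite -[q in LHS]toquot_repr thE; apply/eqP; rewrite -subr_eq0 -opprB oppr_eq0.
  rewrite -{1}[q]toquot_repr -[_ - _](rmorphB (toquot_ring (edge_ring_rel s))).
  apply/eqP/toquot_ring0P.
  apply: (rmorph_cong (J := [set p | (p : P2^o) \in gen (edge_ring_rel s)])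
    (h := comp_mpoly mpoly_coords \o comp_mpoly edge_coords)) => [|c|i /=].
  + exact: gen_ideal.
  + by rewrite /= !comp_mpolyC.
  have {i} [e ->] : exists e, i = enum_rank e by exists (enum_val i); rewrite enum_valK.
  rewrite edge_coordsX /edge_to_mpoly enum_rankK; case: e => e.
    rewrite rmorphM /= comp_mpolyC mpoly_coordsX enum_rankK mulrA -mpolyCM -tpowD PoszD addrK.
    by rewrite -rpredN opprB; apply: gen_incl; exists e.
  rewrite rmorphM /= comp_mpolyC mpoly_coordsX enum_rankK mulrA -mpolyCM -tpowD subrr.
  by rewrite tpow0 mpolyC1 mul1r subrr rpred0.
- move=> p; rewrite thE; apply/eqP; rewrite -subr_eq0 -opprB oppr_eq0; apply/eqP.
  apply: (rmorph_cong (J := [set 0]) (h := comp_mpoly edge_coords \o comp_mpoly mpoly_coords)) => [|c|i /=].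
  + by split=> // a x y -> ->; rewrite mulr0 addr0.
  + by rewrite /= !comp_mpolyC.
  rewrite mpoly_coordsX rmorphM /= comp_mpolyC edge_coordsX /edge_to_mpoly enum_rankK enum_valK.
  by rewrite mulrA -mpolyCM -tpowD addNr tpow0 mpolyC1 mul1r subrr.
- by move=> c; rewrite thE /= comp_mpolyC.
- by move=> e; rewrite thE /= edge_coordsX /edge_to_mpoly enum_rankK.
- by move=> e; rewrite thE /= edge_coordsX /edge_to_mpoly enum_rankK.
Qed.

Lemma in_degree_sum (d : edge G -> option (vertex G)) (Gam : {set vertex G}) (f : edge G -> nat) :
  (\sum_(e | oin Gam (d e)) f e = \sum_(v in Gam) \sum_(e | d e == Some v) f e)%N.
Proof.
rewrite (exchange_big_dep (fun e => oin Gam (d e))) /=; last first.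
  by move=> v e vG /eqP->.
apply: eq_bigr => e; case: (d e) => [v|//] /= vG.
rewrite (bigD1 v) ?vG ?eqxx //= big1 ?addn0 // => u /andP[/andP[_ /eqP[->]]].
by rewrite eqxx.
Qed.

(** In- and out-degrees agree at every vertex, and inner edges cancel. This is the homogeneity of
    the non-local relations. *)
Lemma entering_leaving_card (Gam : {set vertex G}) : #|entering Gam| = #|leaving Gam|.
Proof.
have split_sum (A B : pred (edge G)) :
    (\sum_(e | A e) 1 = #|[pred e | A e && ~~ B e]| + #|[pred e | A e && B e]|)%N.
  by rewrite (bigID B) /= addnC; congr addn; rewrite -sum1_card.
have E : (\sum_(e | head_in Gam e) 1 = \sum_(e | tail_in Gam e) 1)%N.
  rewrite (in_degree_sum (@head G) Gam (fun=> 1%N)) (in_degree_sum (@tail G) Gam (fun=> 1%N)).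
  by apply: eq_bigr => v _; rewrite !sum1_card in_degree out_degree.
move: E; rewrite (split_sum _ (tail_in Gam)) (split_sum (tail_in Gam) (head_in Gam)).
rewrite (@eq_card _ [pred e | head_in Gam e && tail_in Gam e] [pred e | tail_in Gam e && head_in Gam e]).
  by move/eqP; rewrite eqn_add2r => /eqP.
by move=> e; rewrite !inE andbC.
Qed.

(** A set that no edge enters is left by none, the two numbers being equal, so it contains a whole
    component. That component is special, and its boundary edge enters or leaves the set, a
    contradiction. *)
Lemma connected_entered (Gam : {set vertex G}) : nonspecial_components G = finset.set0 ->
  Gam != finset.set0 -> exists e, e \in entering Gam.
Proof.
move=> conn /finset.set0Pn[v vG]; apply/existsP; apply: contraT; rewrite negb_exists => /forallP noent.
have noleave e : e \notin leaving Gam.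
  have /card0_eq -> // : #|leaving Gam| = 0%N.
  by rewrite -entering_leaving_card; apply: eq_card0 => x; apply/negbTE/noent.
have closed u w : adjacent u w -> u \in Gam -> w \in Gam.
  case/existsP => e /orP[] /andP[/eqP te /eqP he] uG.
    by have := noleave e; rewrite !inE /tail_in /head_in te he uG /= negbK.
  by have := noent e; rewrite !inE /tail_in /head_in te he uG /= negbK.
have sub : component v \subset Gam.
  apply/fintype.subsetP => u; rewrite inE => /connectP[p].
  by elim: p v vG => [|w p IH] v vG /=; [move=> _ -> | case/andP => /closed/(_ vG)/IH H /H].
have : component v \notin nonspecial_components G by rewrite conn inE.
rewrite inE negb_and negbK imset_f //= => /existsP[e /orP[] /andP[]].
  move=> te /eqP he; have := noleave e; rewrite !inE /head_in he andbT.
  by move: te; rewrite /tail_in; case: (tail e) => // u /(fintype.subsetP sub) ->.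
move=> he /eqP te; have := noent e; rewrite !inE /tail_in te andbT.
by move: he; rewrite /head_in; case: (head e) => // u /(fintype.subsetP sub) ->.
Qed.

Let hdi (i : 'I_n) := head (enum_val i).
Let tli (i : 'I_n) := tail (enum_val i).
(** Summed over [Gam] this is the exponent of [t] in the rescaled relation: inner edges contribute
    their framing, leaving edges the rescaling of [x_e]. *)
Definition out_weight (v : vertex G) : nat := (\sum_(e | tail e == Some v) elen e)%N.
Definition framed_cut (Gam : {set vertex G}) : PO :=
  cut_binomial (pstpow F 1) hdi tli out_weight Gam.

Lemma out_weight_gt0 v : (0 < out_weight v)%N.
Proof.
have [e te] : exists e, tail e == Some v.
  suff /card_gt0P[e] : (0 < #|[pred e | tail e == Some v]|)%N by exists e.
  by rewrite out_degree; case: ifP.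
rewrite /out_weight (bigD1 e) //= addn_gt0.
by have := @framing_tail e; rewrite (eqP te) => ->.
Qed.

Lemma cut_weight_gt0 (Gam : {set vertex G}) : Gam != finset.set0 ->
  (0 < \sum_(v in Gam) out_weight v)%N.
Proof.
by case/finset.set0Pn => v vG; rewrite (bigD1 v) //= addn_gt0 out_weight_gt0.
Qed.

Lemma big_enum_rank (R : Type) (idx : R) (op : Monoid.com_law idx) (Q : pred 'I_n) (f : 'I_n -> R) :
  \big[op/idx]_(i | Q i) f i = \big[op/idx]_(e : edge G | Q (enum_rank e)) f (enum_rank e).
Proof. by rewrite (reindex enum_rank) //; apply/onW_bij/enum_rank_bij. Qed.

Lemma mdeg_in_mnm Gam : mdeg (in_mnm hdi tli Gam) = #|entering Gam|.
Proof.
rewrite mdegE big_enum_rank -sum1_card [RHS]big_mkcond; apply: eq_bigr => e _ /=.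
by rewrite mnmE /enters /hdi /tli enum_rankK inE /head_in /tail_in /oin; case: ifP.
Qed.

Lemma mdeg_out_mnm Gam : mdeg (out_mnm hdi tli Gam) = #|leaving Gam|.
Proof.
rewrite mdegE big_enum_rank -sum1_card [RHS]big_mkcond; apply: eq_bigr => e _ /=.
by rewrite mnmE /leaves /hdi /tli enum_rankK inE /head_in /tail_in /oin; case: ifP.
Qed.

Lemma mpolyX_in (R : comNzRingType) Gam :
  'X_[in_mnm hdi tli Gam] = \prod_(e in entering Gam) 'X_(enum_rank e) :> {mpoly R[n]}.
Proof.
rewrite mpolyXE_id big_enum_rank [RHS]big_mkcond; apply: eq_bigr => e _ /=.
by rewrite mnmE /enters /hdi /tli enum_rankK inE /head_in /tail_in /oin; case: ifP.
Qed.

Lemma mpolyX_out (R : comNzRingType) Gam :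
  'X_[out_mnm hdi tli Gam] = \prod_(e in leaving Gam) 'X_(enum_rank e) :> {mpoly R[n]}.
Proof.
rewrite mpolyXE_id big_enum_rank [RHS]big_mkcond; apply: eq_bigr => e _ /=.
by rewrite mnmE /leaves /hdi /tli enum_rankK inE /head_in /tail_in /oin; case: ifP.
Qed.

Lemma pstpowX k : pstpow F 1 ^+ k = pstpow F k.
Proof. by elim: k => [|k IH]; rewrite ?expr0 ?pstpow0 // exprS IH -pstpowD. Qed.

Lemma framed_cutE Gam : framed_cut Gam = \prod_(e in entering Gam) 'X_(enum_rank e) -
  (pstpow F (\sum_(v in Gam) out_weight v))%:MP * \prod_(e in leaving Gam) 'X_(enum_rank e).
Proof. by rewrite /framed_cut /cut_binomial pstpowX mpolyX_in mpolyX_out. Qed.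

Variable v0 : vertex G.
Definition thick_vertex (i : nat) : vertex G := nth v0 (enum (@thick G)) i.
Local Notation r := #|@thick G|.

Lemma thick_vertexP i : (i < r)%N -> thick (thick_vertex i).
Proof. by rewrite cardE => /(mem_nth v0); rewrite mem_enum. Qed.

Lemma thick_vertex_inj i j :
  (i < r)%N -> (j < r)%N -> thick_vertex i = thick_vertex j -> i = j.
Proof. by rewrite cardE => ir jr /eqP; rewrite nth_uniq ?enum_uniq // => /eqP. Qed.

Lemma thick_in_degree (v : vertex G) c : thick v -> hdi c = Some v ->
  exists2 d, d != c & hdi d = Some v.
Proof.
move=> tv hc; have := in_degree v; rewrite tv (cardD1 (enum_val c)) inE -/(hdi c) hc eqxx.
move=> [] /(congr1 (leq 1)) /card_gt0P[d]; rewrite !inE => /andP[dc /eqP hd].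
exists (enum_rank d); last by rewrite /hdi enum_rankK.
by apply: contra dc => /eqP <-; rewrite enum_rankK.
Qed.

Definition linear_form (i : nat) : PO :=
  \sum_(e | tail e == Some (thick_vertex i)) (pstpow F (elen e))%:MP * 'X_(enum_rank e)
  - \sum_(e | head e == Some (thick_vertex i)) 'X_(enum_rank e).

Lemma linear_form_homog i m : m \in msupp (linear_form i) -> mdeg m = 1%N.
Proof.
move=> /msuppB_le; rewrite mem_cat => /orP[] /msupp_sum_le /flattenP[q /mapP[e _ ->]].
  by rewrite mul_mpolyC => /msuppZ_le; rewrite msuppX inE => /eqP->; rewrite mdeg1.
by rewrite msuppX inE => /eqP->; rewrite mdeg1.
Qed.

Lemma mredX m : mred ('X_[m] : PO) = 'X_[m].
Proof. exact: map_mpolyX. Qed.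

Lemma mred_tpow k : mred (pstpow F k)%:MP = (k == 0%N)%:R :> {mpoly F[n]}.
Proof. by rewrite [LHS]map_mpolyC /= psconst_term_tpow mpolyC_nat. Qed.

Lemma mred_linear_form i : mred (linear_form i) = - in_sum F hdi thick_vertex i.
Proof.
rewrite rmorphB !rmorph_sum /= big1 ?sub0r => [|e te]; last first.
  rewrite rmorphM /= mred_tpow; have := @framing_tail e; rewrite (eqP te) => /(_ isT).
  by rewrite -/(etop e) -/(elen e); case: (elen e) => // k _; rewrite mul0r.
congr (- _); rewrite /in_sum big_enum_rank; apply: eq_big => [e|e _]; last exact: mredX.
by rewrite /hdi enum_rankK.
Qed.

(** The empty set is exceptional because its relation [1 - 1] carries no positive power of [t]. *)
Lemma mred_framed_cut Gam :
  mred (framed_cut Gam) = if Gam == finset.set0 then 0 else 'X_[in_mnm hdi tli Gam].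
Proof.
rewrite framed_cutE rmorphB rmorphM /= mred_tpow.
have [->|G0] := eqVneq Gam finset.set0.
  rewrite big_set0 mul1r !big_pred0 ?subrr // => e; rewrite inE /tail_in /head_in.
    by case: (tail e) => [?|]; rewrite ?inE.
  by case: (head e) => [?|]; rewrite ?inE.
rewrite (negPf (lt0n_neq0 (cut_weight_gt0 G0))) mul0r subr0 rmorph_prod mpolyX_in.
by apply: eq_bigr => e _; apply: mredX.
Qed.

(** The starting point of the induction: nothing reached, deleted or contracted. *)
Lemma span_mred_cut : span_ideal (@mred F n \o framed_cut) =
  monomial_ideal (bad hdi tli finset.set0 finset.set0 finset.set0).
Proof.
have idJ : is_ideal (monomial_ideal (F := F) (bad hdi tli finset.set0 finset.set0 finset.set0)).
  by apply: monomial_ideal_ideal => m m'; apply: bad_up.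
apply/seteqP; split=> [p [c ->]|p pbad].
  apply: (ideal_sum idJ) => Gam _; apply: (idealMl idJ); rewrite /= mred_framed_cut.
  case: ifP => [_|/negbT G0]; first by case: idJ.
  move=> m; rewrite msuppX inE => /eqP->; apply/orP; right; apply/existsP; exists Gam.
  rewrite G0 /=; apply/andP; split; first by apply/pred0P => v /=; rewrite inE andbF.
  by apply/forallP => e; apply/implyP => eG; rewrite inE mnmE eG.
have idS := span_ideal_ideal (@mred F n \o framed_cut).
rewrite [p]mpolyE big_seq; apply: (ideal_sum idS) => m /pbad /orP[/exists_inP[e]|].
  by rewrite inE.
case/existsP => Gam /and3P[G0 _ /forallP GD]; rewrite -mul_mpolyC; apply: (idealMl idS).
have -> : m = ((m - in_mnm hdi tli Gam) + in_mnm hdi tli Gam)%MM.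
  rewrite submK //; apply/mnm_lepP => e; rewrite mnmE.
  by have := GD e; rewrite inE; case: (enters _ _ _ _).
rewrite mpolyXD; apply: (idealMl idS); have := span_ideal_gen (@mred F n \o framed_cut) Gam.
by rewrite /= mred_framed_cut (negPf G0).
Qed.

Definition edge_linear_form (i : nat) : ER :=
  \sum_(e | tail e == Some (thick_vertex i)) xvar F s e
  - \sum_(e | head e == Some (thick_vertex i)) yvar F s e.

Lemma mincl_linear_form (th : {rmorphism ER -> PL}) :
  (forall e, th (xvar F s e) = (tpow F (elen e))%:MP * 'X_(enum_rank e)) ->
  (forall e, th (yvar F s e) = (tpow F (etop e))%:MP * 'X_(enum_rank e)) ->
  th \o edge_linear_form = (mincl (F := F) (n := n)) \o linear_form.
Proof.
move=> thx thy; apply/funext => i /=.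
rewrite rmorphB !rmorph_sum [in RHS]rmorphB !rmorph_sum /=; congr (_ - _).
  apply: eq_bigr => e _; rewrite thx rmorphM /= mincl_tpow; congr (_ * _).
  exact/esym/map_mpolyX.
apply: eq_bigr => e he; rewrite thy /etop (eqP he) tpow0 mpolyC1 mul1r.
exact/esym/map_mpolyX.
Qed.

(** The same lifting, with an empty family of relations. The zero ideal is the monomial ideal in
    which all vertices count as reached. *)
Lemma linear_form_regular : regular_mod [set (0 : ER)] edge_linear_form r.
Proof.
have [th [et [thK etK thC thx thy]]] := edge_ring_mpoly_iso.
have span0 (P : comPzRingType) (g : void -> P) : span_ideal g = [set 0].
  apply/seteqP; split=> [x [c ->]|x ->]; first by rewrite big1 // => -[].
  by exists (fun=> 0); rewrite big1 // => -[].
have -> : [set (0 : ER)] = [set q | [set (0 : PL)] (th q)].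
  apply/seteqP; split=> [q ->|q /= q0]; first exact: rmorph0.
  by rewrite -[q]thK q0 rmorph0.
apply: (regular_mod_iso thK etK); rewrite (mincl_linear_form thx thy).
pose g (x : void) : PO := match x with end.
rewrite -(span0 _ (@mincl F n \o g)).
apply: (@regular_lift_laurent F n void g (fun=> 0%N)) => [[]|i m|p|].
- exact: linear_form_homog.
- rewrite !span0 /= => tp0; exact: mulXt_inj.
rewrite span0; have -> : @mred F n \o linear_form = fun i => - in_sum F hdi thick_vertex i.
  by apply/funext => i; apply: mred_linear_form.
apply: regular_modN; first by split=> // a x y -> ->; rewrite mulr0 addr0.
have -> : [set 0] = monomial_ideal (F := F) (bad hdi tli finset.setT finset.set0 finset.set0).
  apply/seteqP; split=> [p -> m|p pbad]; first by rewrite msupp0.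
  apply/msuppnil0; case E: (msupp p) => [//|m q]; have /pbad : m \in msupp p by rewrite E inE eqxx.
  case/orP => [/exists_inP[e]|/existsP[Gam /and3P[/finset.set0Pn[v vG] D _]]]; first by rewrite inE.
  by have := disjointFr D vG; rewrite inE.
apply: in_sum_regular_free => [i j|i ir].
  exact: thick_vertex_inj.
have tv := thick_vertexP ir; have := in_degree (thick_vertex i); rewrite tv => /(congr1 (leq 1)).
case/card_gt0P => e /eqP he; exists (enum_rank e); rewrite ?inE //.
by rewrite /hdi enum_rankK.
Qed.

Lemma cut_weightE (Gam : {set vertex G}) : (\sum_(v in Gam) out_weight v =
  \sum_(e in inner Gam) l e + \sum_(e in leaving Gam) elen e)%N.
Proof.
rewrite -(in_degree_sum (@tail G)) (bigID (head_in Gam)) /=; congr addn.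
apply: eq_bigr => e /andP[_ he]; rewrite /elen.
by have -> : etop e = 0%N; [move: he; rewrite /etop /head_in; case: (head e) | rewrite addn0].
Qed.

Lemma nonlocal_cut (th : {rmorphism ER -> PL}) Gam :
  (forall c, th (edge_scalar s c) = c%:MP) ->
  (forall e, th (xvar F s e) = (tpow F (elen e))%:MP * 'X_(enum_rank e)) ->
  (forall e, th (yvar F s e) = (tpow F (etop e))%:MP * 'X_(enum_rank e)) ->
  th (edge_scalar s (tpow F (framing_weight s Gam)) * \prod_(e in leaving Gam) xvar F s e
      - \prod_(e in entering Gam) yvar F s e) = - mincl (framed_cut Gam).
Proof.
move=> thC thx thy; rewrite framed_cutE rmorphB [in RHS]rmorphB opprB !rmorphM /= mincl_tpow thC.
rewrite !rmorph_prod; congr (_ - _); last first.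
  apply: eq_bigr => e; rewrite inE => /andP[he _]; rewrite thy.
  have -> : etop e = 0%N by move: he; rewrite /etop /head_in; case: (head e).
  by rewrite tpow0 mpolyC1 mul1r; apply/esym/map_mpolyX.
rewrite (eq_bigr (fun e => (tpow F (elen e))%:MP * 'X_(enum_rank e))) => [|e _]; last exact: thx.
rewrite big_split /= mulrA; congr (_ * _); last first.
  by apply: eq_bigr => e _; apply/esym/map_mpolyX.
rewrite -(rmorph_prod (mpolyC n (R := L))) -mpolyCM -tpow_sum -tpowD; congr (tpow F _)%:MP.
by rewrite cut_weightE PoszD !(big_morph Posz PoszD (erefl 0%:Z)).
Qed.

(** Without closed components every nonempty set is entered, which bounds potentials and so gives
    torsion-freeness; [in_sum_regular] handles the special fibre. *)
Lemma linear_form_regular_nonlocal : nonspecial_components G = finset.set0 ->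
  regular_mod [set y : ER | (y : ER^o) \in gen (@nonlocal_gens F G s)] edge_linear_form r.
Proof.
move=> conn; have [th [et [thK etK thC thx thy]]] := edge_ring_mpoly_iso.
have idL := span_ideal_ideal (@mincl F n \o framed_cut).
have -> : [set y : ER | (y : ER^o) \in gen (@nonlocal_gens F G s)] =
    [set q | span_ideal (@mincl F n \o framed_cut) (th q)].
  apply/seteqP; split=> [q|q /= [c cE]].
    apply: (gen_sub (M := ER^o) (U := [set q | span_ideal (@mincl F n \o framed_cut) (th q)])).
      split=> [|a x y /= xI yI]; first by rewrite /= rmorph0; case: idL.
      by rewrite rmorphD [_ *: _]/(_ * _) rmorphM; case: idL => _; apply.
    move=> x [Gam ->] /=; rewrite nonlocal_cut //; apply: idealN => //.
    exact: (span_ideal_gen (@mincl F n \o framed_cut)).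
  rewrite -[q]thK cE rmorph_sum; apply: rpred_sum => Gam _; rewrite rmorphM; apply: gen_mull.
  have := nonlocal_cut Gam thC thx thy => /(congr1 -%R); rewrite opprK /= => <-.
  by rewrite rmorphN thK rpredN; apply: gen_incl; exists Gam.
apply: (regular_mod_iso thK etK); rewrite (mincl_linear_form thx thy).
apply: (@regular_lift_laurent F n _ framed_cut (fun Gam => #|entering Gam|)) => [Gam m|i m|p|].
- move=> /msuppB_le; rewrite mem_cat => /orP[]; first by rewrite msuppX inE => /eqP->; rewrite mdeg_in_mnm.
  rewrite mul_mpolyC => /msuppZ_le; rewrite msuppX inE => /eqP->.
  by rewrite mdeg_out_mnm entering_leaving_card.
- exact: linear_form_homog.
- apply: cut_ideal_torsion_free => [Gam|Gam /(connected_entered conn)[e eG]|x].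
  + by rewrite mdeg_in_mnm mdeg_out_mnm entering_leaving_card.
  + by exists (enum_rank e); move: eG; rewrite inE /enters /hdi /tli enum_rankK.
  + exact: pstpow1_lreg.
have -> : @mred F n \o linear_form = fun i => - in_sum F hdi thick_vertex i.
  by apply/funext => i; apply: mred_linear_form.
rewrite span_mred_cut; apply: regular_modN.
  by apply: monomial_ideal_ideal => m m'; apply: bad_up.
apply: in_sum_regular => [i j|i c ir|e|i ir].
- exact: thick_vertex_inj.
- by apply: thick_in_degree; apply: thick_vertexP.
- by rewrite inE.
have tv := thick_vertexP ir; have := in_degree (thick_vertex i); rewrite tv => /(congr1 (leq 1)).
case/card_gt0P => e /eqP he; exists (enum_rank e); rewrite ?inE //.
by rewrite /hdi enum_rankK.
Qed.

End FramedGraph.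

(** * The algebra of the subdivided graph *)

(** Summation by parts of [i * (b i - b i.+1)], where [b i] tells whether the [i]-th vertex of a
    chain belongs to a set. *)
Lemma chain_weight (b : nat -> bool) k :
  (\sum_(i < k) b i.+1 + \sum_(i < k.+1) (b i.+1 && ~~ b i) * i =
   \sum_(i < k.+1) (b i && ~~ b i.+1) * i + k * b k.+1)%N.
Proof.
elim: k => [|k IH]; first by rewrite big_ord0 !big_ord_recl !big_ord0 /= !muln0.
rewrite !(@big_ord_recr _ _ _ k.+1) (@big_ord_recr _ _ _ k (fun i => b i.+1 : nat)) /=.
by move: IH; case: (b k.+1); case: (b k.+2) => /=; lia.
Qed.

Lemma chain_count (b : nat -> bool) k :
  (\sum_(i < k) (b i && ~~ b i.+1) + b k = \sum_(i < k) (b i.+1 && ~~ b i) + b 0)%N.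
Proof.
elim: k => [|k IH]; first by rewrite !big_ord0.
rewrite !big_ord_recr /=; move: IH; case: (b k); case: (b k.+1) => /=; lia.
Qed.

Section Subdivided.
Variables (G : graph) (l : edge G -> nat).
Hypothesis in_degree : forall v : vertex G,
  #|[pred e | head e == Some v]| = if thick v then 2 else 1%N.
Hypothesis framing_head : forall e : edge G, head e != None -> (0 < l e)%N.
Local Notation H := (subdivision l).
Local Notation mklink e i := (@Tagged _ e (fun d => 'I_(l d).-1.+1) i).
Local Notation mkbead e i := (@Tagged _ e (fun d => 'I_(l d).-1) i).
Implicit Types (Gam : {set vertex H}) (e : edge G).

Definition old_vertices Gam : {set vertex G} := [set v | (inl v : vertex H) \in Gam]%SET.

(* The vertices of the chain of e are numbered by m from its tail, numbered 0, to
   its head, numbered (l e).-1.+1. *)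
Definition chain_in Gam e (m : nat) : bool :=
  if m is m'.+1 then
    if insub m' : option 'I_(l e).-1 is Some j then (inr (mkbead e j) : vertex H) \in Gam
    else head_in (old_vertices Gam) e
  else tail_in (old_vertices Gam) e.

Lemma tail_in_link Gam e i : tail_in Gam (mklink e i : edge H) = chain_in Gam e i.
Proof.
rewrite /tail_in /= /link_tail /=; case: unliftP => [j|] ->.
  by rewrite lift0 /= (valK j).
by rewrite /= /tail_in; case: (tail e) => //= v; rewrite inE.
Qed.

Lemma head_in_link Gam e i : head_in Gam (mklink e i : edge H) = chain_in Gam e i.+1.
Proof.
rewrite /head_in /= /link_head /=; case: unliftP => [j|] ->.
  by rewrite lift_max /= (valK j).
rewrite insubF /= ?ltnn // /head_in; case: (head e) => //= v; by rewrite inE.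
Qed.

Lemma chain_in_last Gam e : chain_in Gam e (l e).-1.+1 = head_in (old_vertices Gam) e.
Proof. by rewrite /= insubF ?ltnn. Qed.

Lemma big_link (R : Type) (idx : R) (op : Monoid.com_law idx) (Q : pred (edge H))
    (f : edge H -> R) :
  \big[op/idx]_(k | Q k) f k = \big[op/idx]_e \big[op/idx]_(i | Q (mklink e i)) f (mklink e i).
Proof.
rewrite (sig_big_dep _ _ (fun e i => f (mklink e i))) /=.
by apply: eq_big => [[]|[]].
Qed.

Definition leaving_number Gam e : nat := \sum_(i < (l e).-1.+1) (mklink e i \in @leaving H Gam : nat).
Definition entering_number Gam e : nat := \sum_(i < (l e).-1.+1) (mklink e i \in @entering H Gam : nat).

Lemma link_leaving Gam e i : (mklink e i \in @leaving H Gam) = chain_in Gam e i && ~~ chain_in Gam e i.+1.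
Proof. by rewrite inE tail_in_link head_in_link. Qed.
Lemma link_entering Gam e i : (mklink e i \in @entering H Gam) = chain_in Gam e i.+1 && ~~ chain_in Gam e i.
Proof. by rewrite inE tail_in_link head_in_link. Qed.

Lemma leaving_entering_number Gam e :
  (leaving_number Gam e + head_in (old_vertices Gam) e =
   entering_number Gam e + tail_in (old_vertices Gam) e)%N.
Proof.
have := chain_count (chain_in Gam e) (l e).-1.+1; rewrite chain_in_last.
rewrite /leaving_number /entering_number.
under eq_bigr => i _ do rewrite -link_leaving.
by under [in RHS]eq_bigr => i _ do rewrite -link_entering.
Qed.

(** A link at height [i] stands for [t ^ - i] times the first one, so these sums are exponents of
    [t]. *)
Definition leaving_height Gam : nat :=
  \sum_e \sum_(i < (l e).-1.+1) (mklink e i \in @leaving H Gam : nat) * i.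
Definition entering_height Gam : nat :=
  \sum_e \sum_(i < (l e).-1.+1) (mklink e i \in @entering H Gam : nat) * i.

(** The weight of a vertex of [G] is its in-degree, so it counts 1 for each edge arriving in the
    set. Added to the beads of that edge, this 1 completes the [l e - 1] from summation by parts to
    [l e]. *)
Lemma algebra_weight_height Gam :
  (algebra_weight Gam + entering_height Gam =
   leaving_height Gam + \sum_(e | head_in (old_vertices Gam) e) l e)%N.
Proof.
have -> : algebra_weight Gam = (\sum_(e | head_in (old_vertices Gam) e) 1 +
    \sum_e \sum_(i < (l e).-1) chain_in Gam e i.+1)%N.
  rewrite /algebra_weight big_sumType /=; congr addn.
    rewrite (in_degree_sum (@head G) (old_vertices Gam) (fun=> 1%N)).
    by apply: eq_big => v; rewrite ?inE // sum1_card in_degree.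
  transitivity (\sum_e \sum_(i < (l e).-1 | (inr (mkbead e i) : vertex H) \in Gam) 1)%N.
    rewrite (sig_big_dep _ _ (fun e i => 1%N)).
    by apply: eq_bigl => -[].
  apply: eq_bigr => e _; rewrite [LHS]big_mkcond; apply: eq_bigr => i _.
  by rewrite /= (valK i); case: (_ \in _).
rewrite /leaving_height /entering_height [X in (X + _ + _)%N]big_mkcond [X in _ = (_ + X)%N]big_mkcond.
rewrite -!big_split; apply: eq_bigr => e _ /=.
under [X in (_ + X = _)%N]eq_bigr => i _ do rewrite link_entering.
under [X in (_ = X + _)%N]eq_bigr => i _ do rewrite link_leaving.
rewrite -addnA chain_weight chain_in_last; case: ifP => he; last by rewrite muln0 addn0 add0n.
have l0 : (0 < l e)%N.
  by apply: framing_head; move: he; rewrite /head_in; case: (head e).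
by rewrite muln1 addnCA add1n prednK.
Qed.

Section Evaluation.
Variables (T : comPzRingType) (tau : int -> T) (X : edge G -> T).
Hypotheses (tau0 : tau 0 = 1) (tauD : forall a b, tau (a + b) = tau a * tau b).

(** [tau] stands for the powers of [t] and [X] for the first segments, in an arbitrary ring: the
    same computation serves in the edge ring and in the graph algebra. *)
Definition link_value (k : edge H) : T := tau (- (tagged k : nat)%:Z) * X (tag k).
Definition excess Gam e : nat := (leaving_number Gam e - (e \in leaving (old_vertices Gam)))%N.

Lemma tau_sum (I : Type) (rr : seq I) (Q : pred I) (f : I -> int) :
  tau (\sum_(i <- rr | Q i) f i) = \prod_(i <- rr | Q i) tau (f i).
Proof. exact: (big_morph _ tauD tau0). Qed.

Lemma prod_link_value (Q : pred (edge H)) : \prod_(k in Q) link_value k =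
  tau (- (\sum_e \sum_(i < (l e).-1.+1) (mklink e i \in Q : nat) * i)%N%:Z) *
  \prod_e X e ^+ (\sum_(i < (l e).-1.+1) (mklink e i \in Q : nat))%N.
Proof.
rewrite big_link (big_morph Posz PoszD (erefl 0%:Z)) -sumrN tau_sum -big_split.
apply: eq_bigr => e _ /=; rewrite big_split /=.
rewrite (big_morph Posz PoszD (erefl 0%:Z)) -sumrN tau_sum; congr (_ * _).
  by rewrite big_mkcond; apply: eq_bigr => i _; case: ifP; rewrite ?mul1n // mul0n tau0.
by rewrite big_mkcond expr_sum; apply: eq_bigr => i _; case: ifP.
Qed.

(** Along a chain that weaves in and out of [Gam], leaving and entering links alternate. Apart from
    the crossing that [e] makes as an edge of [G], they pair up into the common factor
    [X e ^+ excess Gam e], and the relation of the old vertices remains, up to a power of [t]. *)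
Lemma link_cut Gam :
  tau (algebra_weight Gam) * \prod_(k in @leaving H Gam) link_value k
    - \prod_(k in @entering H Gam) link_value k =
  tau ((\sum_(e in entering (old_vertices Gam)) l e)%N%:Z - (entering_height Gam)%:Z) *
  \prod_e X e ^+ excess Gam e *
  (tau (\sum_(e in inner (old_vertices Gam)) (l e)%:Z) * \prod_(e in leaving (old_vertices Gam)) X e
     - \prod_(e in entering (old_vertices Gam)) (tau (- (l e)%:Z) * X e)).
Proof.
rewrite !prod_link_value; set c := excess Gam; set Gm := old_vertices Gam.
have le_lv e : ((e \in leaving Gm) <= leaving_number Gam e)%N.
  by have := leaving_entering_number Gam e; rewrite inE; case: (tail_in _ _); case: (head_in _ _) => /=; lia.
have lvE : \prod_e X e ^+ leaving_number Gam e = \prod_e X e ^+ c e * \prod_(e in leaving Gm) X e.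
  rewrite [X in _ * X]big_mkcond -big_split; apply: eq_bigr => e _ /=.
  by rewrite -[in LHS](subnK (le_lv e)) exprD; congr (_ * _); case: ifP.
have enE : \prod_e X e ^+ entering_number Gam e = \prod_e X e ^+ c e * \prod_(e in entering Gm) X e.
  rewrite [X in _ * X]big_mkcond -big_split; apply: eq_bigr => e _ /=.
  have -> : entering_number Gam e = (c e + (e \in entering Gm))%N.
    have := leaving_entering_number Gam e; have := le_lv e; rewrite /c /excess -/Gm !inE.
    by case: (tail_in _ _); case: (head_in _ _) => /=; lia.
  by rewrite exprD; congr (_ * _); case: ifP.
rewrite lvE enE big_split /= -tau_sum sumrN -/(leaving_height Gam) -/(entering_height Gam).
rewrite -!(big_morph Posz PoszD (erefl 0%:Z)).
set p := \prod_e _; set x := \prod_(e in leaving _) _; set y := \prod_(e in entering _) _.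
set A := leaving_height _; set Bh := entering_height _; set w := algebra_weight _.
set Sin := (\sum_(e in inner _) _)%N; set Sen := (\sum_(e in entering _) _)%N.
have W : (w + Bh = A + (Sin + Sen))%N.
  rewrite algebra_weight_height -/A; congr addn; rewrite (bigID (tail_in Gm)) /=.
  by congr addn; apply: eq_bigl => e; rewrite !inE // andbC.
set C := Sen%:Z - Bh%:Z.
have -> : tau w * (tau (- A%:Z) * (p * x)) = tau (w%:Z - A%:Z) * p * x by rewrite tauD; ring.
have -> : w%:Z - A%:Z = C + Sin%:Z by rewrite /C; lia.
have -> : - Bh%:Z = C + - Sen%:Z by rewrite /C; lia.
rewrite !(tauD C); ring.
Qed.

Lemma sum_tail_link v : \sum_(k : edge H | tail k == Some (inl v : vertex H)) link_value k =
  \sum_(e | tail e == Some v) X e.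
Proof.
rewrite big_link [RHS]big_mkcond; apply: eq_bigr => e _ /=.
case: eqP => [te|te].
  rewrite (big_pred1 ord0); first by rewrite /link_value /= oppr0 tau0 mul1r.
  move=> i /=; rewrite /link_tail /=; case: unliftP => [j|] ->; last by rewrite te /= !eqxx.
  by transitivity false => //; apply/esym/negbTE; rewrite eq_sym neq_lift.
rewrite big_pred0 // => i /=; rewrite /link_tail /=; case: unliftP => [j|] //= _.
by apply/eqP; case: (tail e) te => [u|] te //= [E]; case: te; rewrite E.
Qed.

(** The last link has height [l e - 1], whereas [y_e] is [t ^ - l e] times [x_e]; the discrepancy
    [tau 1] matches the factor [t] in the linear relations of the graph algebra. *)
Lemma sum_head_link v : \sum_(k : edge H | head k == Some (inl v : vertex H)) link_value k =
  tau 1 * \sum_(e | head e == Some v) (tau (- (l e)%:Z) * X e).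
Proof.
rewrite big_link [in RHS]big_mkcond mulr_sumr; apply: eq_bigr => e _ /=.
case: eqP => [he|he].
  rewrite (big_pred1 ord_max).
    rewrite /link_value /= mulrA -tauD; congr (tau _ * _).
    by have := @framing_head e; rewrite he => /(_ isT); case: (l e) => // k _ /=; lia.
  move=> i /=; rewrite /link_head /=; case: unliftP => [j|] ->; last by rewrite he /= !eqxx.
  by transitivity false => //; apply/esym/negbTE; rewrite eq_sym neq_lift.
rewrite big_pred0 ?mulr0 // => i /=; rewrite /link_head /=; case: unliftP => [j|] //= _.
by apply/eqP; case: (head e) he => [u|] he //= [E]; case: he; rewrite E.
Qed.

End Evaluation.

(* The beads of the edges inside Gam are included, so that a single link of an
   edge leaves or enters the set. *)
Definition saturation (Gam : {set vertex G}) : {set vertex H} :=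
  [set v : vertex H | match v with inl u => u \in Gam | inr b => tag b \in inner Gam end]%SET.

Lemma old_saturation (Gam : {set vertex G}) : old_vertices (saturation Gam) = Gam.
Proof. by apply/setP => v; rewrite !inE. Qed.

(** All beads of [e] have the same membership, that of [e] in [inner Gam], so the chain is left at
    most once, and only when [e] leaves [Gam]. *)
Lemma excess_saturation (Gam : {set vertex G}) e : excess (saturation Gam) e = 0%N.
Proof.
apply/eqP; rewrite subn_eq0 old_saturation; rewrite /leaving_number.
under eq_bigr => i _ do rewrite link_leaving.
have chE m : (m < (l e).-1.+2)%N -> chain_in (saturation Gam) e m =
    if m == 0%N then tail_in Gam e else
    if m == (l e).-1.+1 then head_in Gam e else e \in inner Gam.
  case: m => [_|m]; first by rewrite /= old_saturation.
  rewrite ltnS eqSS => /= mk; case: eqP => [->|/eqP ne]; first by rewrite insubF ?ltnn // old_saturation.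
  have mk' : (m < (l e).-1)%N by rewrite ltn_neqAle ne.
  by rewrite insubT !inE.
rewrite inE; move: chE; set b := chain_in _ e; rewrite inE; set k := (l e).-1 => chE.
have b0 : b 0 = tail_in Gam e by rewrite chE.
have bS i : (i < k)%N -> b i.+1 = tail_in Gam e && head_in Gam e.
  by move=> ik; rewrite chE ?ltnS 1?ltnW //= eqSS ltn_eqF.
have bk : b k.+1 = head_in Gam e by rewrite chE //= eqxx.
have split_le i : (i < k.+1)%N -> (b i && ~~ b i.+1 <= ((i == 0%N) && (tail_in Gam e && ~~ head_in Gam e)))%N.
  case: i => [|i]; rewrite ?ltnS => ik.
    rewrite b0; case: (posnP k) => [k0|k0].
      by have b1 : b 1%N = head_in Gam e; [rewrite -bk k0 | rewrite b1 leqnn].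
    by rewrite bS //; case: (tail_in _ _); case: (head_in _ _).
  rewrite bS // ; have [ik1|ik1] := ltnP i.+1 k; first by rewrite bS //; case: (tail_in _ _); case: (head_in _ _).
  have -> : i.+2 = k.+1 by rewrite (_ : k = i.+1) //; apply/eqP; rewrite eqn_leq ik1.
  by rewrite bk; case: (tail_in _ _); case: (head_in _ _).
apply: (@leq_trans (\sum_(i < k.+1) ((i == 0%N :> nat) && (tail_in Gam e && ~~ head_in Gam e)))%N).
  by apply: leq_sum => i _; apply: split_le.
by rewrite big_ord_recl /= big1 ?addn0 // => i _; rewrite /= /bump.
Qed.

End Subdivided.
Lemma gen_rmorph (R R' : comNzRingType) (h : {rmorphism R -> R'}) (S : set R^o) (T : set R'^o)
    (x : R) :
  (forall y : R, S y -> (h y : R'^o) \in gen T) -> (x : R^o) \in gen S -> (h x : R'^o) \in gen T.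
Proof.
move=> hS; apply: (gen_sub (M := R^o) (U := [set x : R^o | (h x : R'^o) \in gen T])) => //.
split=> [|c y z /= yT zT]; first by rewrite /= rmorph0 rpred0.
by rewrite rmorphD [_ *: _]/(_ * _) rmorphM; apply: rpredD => //; apply: gen_mull.
Qed.

Lemma gen_rmorph0 (R : comNzRingType) (R' : pzRingType) (h : {rmorphism R -> R'}) (S : set R^o)
    (x : R) :
  (forall y : R, S y -> h y = 0) -> (x : R^o) \in gen S -> h x = 0.
Proof.
move=> hS; apply: (gen_sub (M := R^o) (U := [set x : R^o | h x = 0])) => //.
split=> [|c y z /= y0 z0]; first by rewrite /= rmorph0.
by rewrite rmorphD [_ *: _]/(_ * _) rmorphM y0 z0 mulr0 addr0.
Qed.

Lemma prod_expr0 (R : pzSemiRingType) (I : finType) (f : I -> R) (m : I -> nat) :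
  (forall i, m i = 0%N) -> \prod_i f i ^+ m i = 1.
Proof. by move=> m0; apply: big1 => i _; rewrite m0 expr0. Qed.

(** * The map from the edge ring onto the graph algebra *)

Section AlgebraMap.
Variables (F : fieldType) (G : graph) (l : edge G -> nat).
Local Notation L := (laurent F).
Local Notation s := (fun e : edge G => Posz (l e)).
Local Notation ER := (edge_ring F s).
Local Notation H := (subdivision l).
Local Notation AR := (graph_algebra F H).
Local Notation P2 := {mpoly L[#|{: edge G + edge G}|]}.
Local Notation PA := {mpoly L[#|edge H|]}.
Local Notation mklink e i := (@Tagged _ e (fun d => 'I_(l d).-1.+1) i).
Local Notation mkbead e i := (@Tagged _ e (fun d => 'I_(l d).-1) i).

Hypothesis in_degree : forall v : vertex G,
  #|[pred e | head e == Some v]| = if thick v then 2 else 1%N.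
Hypothesis framing_head : forall e : edge G, head e != None -> (0 < l e)%N.

Let tauE (a : int) : ER := edge_scalar s (tpow F a).
Let tauA (a : int) : AR := algebra_scalar H (tpow F a).
Let XA (e : edge G) : AR := algebra_var F (first_link l e).

Let tauE0 : tauE 0 = 1.
Proof. by rewrite /tauE tpow0 /edge_scalar mpolyC1; apply: rmorph1. Qed.
Let tauED a b : tauE (a + b) = tauE a * tauE b.
Proof. by rewrite /tauE tpowD /edge_scalar mpolyCM; apply: rmorphM. Qed.
Let tauA0 : tauA 0 = 1.
Proof. by rewrite /tauA tpow0 /algebra_scalar mpolyC1; apply: rmorph1. Qed.
Let tauAD a b : tauA (a + b) = tauA a * tauA b.
Proof. by rewrite /tauA tpowD /algebra_scalar mpolyCM; apply: rmorphM. Qed.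

Lemma yvarE e : yvar F s e = tauE (- (l e)%:Z) * xvar F s e.
Proof.
have -> : xvar F s e = tauE (l e) * yvar F s e.
  rewrite /tauE /edge_scalar /yvar /xvar -rmorphM; apply/toquotP.
  by rewrite -rpredN opprB; apply: gen_incl; exists e.
by rewrite mulrA -tauED addNr tauE0 mul1r.
Qed.

Lemma algebra_relP (p : PA) : graph_algebra_rel (F := F) p -> toquot_ring (graph_algebra_rel (F := F) (G := H)) p = 0.
Proof. by move=> rp; apply/toquot_ring0P/gen_incl. Qed.

Lemma algebra_cut (Gam : {set vertex H}) :
  tauA (algebra_weight Gam) * \prod_(k in @leaving H Gam) algebra_var F k
    - \prod_(k in @entering H Gam) algebra_var F k = 0.
Proof.
rewrite /algebra_var -!rmorph_prod /tauA /algebra_scalar -rmorphM -rmorphB.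
by apply: algebra_relP; right; exists Gam.
Qed.

Lemma algebra_linear (v : vertex H) : thick v ->
  tauA 1 * (\sum_(k | tail k == Some v) algebra_var F k)
    - \sum_(k | head k == Some v) algebra_var F k = 0.
Proof.
move=> tv; rewrite /algebra_var -!rmorph_sum /tauA /algebra_scalar -rmorphM -rmorphB.
by apply: algebra_relP; left; exists v.
Qed.

(** The relation of a single bead says that [t] times the link above is the link below; induction up
    the chain. *)
Lemma algebra_var_link (k : edge H) : algebra_var F k = link_value tauA XA k.
Proof.
case: k => e [i ile]; rewrite /link_value /=.
elim: i ile => [|i IH] ile.
  rewrite oppr0 tauA0 mul1r /XA; congr (algebra_var (G := H) F _).
  by rewrite /first_link; congr (Tagged _ _); apply: val_inj.
have ile' := ltnW ile; have ik : (i < (l e).-1)%N by rewrite -ltnS.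
pose b : vertex H := inr (mkbead e (Ordinal ik)).
have := algebra_cut [set b]%SET.
have -> : algebra_weight [set b]%SET = 1%N by rewrite /algebra_weight big_set1.
have eq_link (d : edge G) (j : 'I_(l d).-1.+1) m (mle : (m < (l e).-1.+1)%N) :
    (mklink d j == mklink e (Ordinal mle) :> edge H) = (d == e) && (j == m :> nat).
  apply/eqP/andP => [E|[/eqP de /eqP jm]].
    by have /= de := congr1 (@tag _ _) E; subst d; split; rewrite // (eq_from_Tagged E).
  by subst d; congr (Tagged _ _); apply: val_inj.
have eq_bead (d : edge G) (j : 'I_(l d).-1) :
    (Some (inr (mkbead d j) : vertex H) == Some b) = (d == e) && (j == i :> nat).
  apply/eqP/andP => [E|[/eqP de /eqP jm]].
    have {}E := congr1 (fun o => if o is Some (inr x) then x else mkbead d j) E.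
    by have /= de := congr1 (@tag _ _) E; subst d; split; rewrite // (eq_from_Tagged E).
  by subst d; congr (Some (inr (Tagged _ _))); apply: val_inj.
have tailb (k : edge H) : tail_in [set b]%SET k = (k == mklink e (Ordinal ile)).
  case: k => d j; rewrite eq_link /tail_in /= /link_tail /=.
  case: unliftP => [m|] ->; last by rewrite andbF; case: (tail d) => //= v; rewrite inE.
  by rewrite inE lift0 eqSS; apply: (eq_bead d m).
have headb (k : edge H) : head_in [set b]%SET k = (k == mklink e (Ordinal ile')).
  case: k => d j; rewrite eq_link /head_in /= /link_head /=.
  case: unliftP => [m|] ->; first by rewrite inE lift_max; apply: (eq_bead d m).
  transitivity false; first by case: (head d) => //= v; rewrite inE.
  by apply/esym/negbTE/andP => -[/eqP-> /=] /eqP E; have := ik; rewrite -E ltnn.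
have neq : (mklink e (Ordinal ile) == mklink e (Ordinal ile') :> edge H) = false.
  by rewrite eq_link eqxx /= eqn_leq ltnn.
rewrite (big_pred1 (mklink e (Ordinal ile) : edge H)); last first.
  move=> k; rewrite !inE tailb headb /=; case: eqP => [->|] //=; by rewrite neq.
rewrite (big_pred1 (mklink e (Ordinal ile') : edge H)); last first.
  move=> k; rewrite !inE tailb headb /=; case: eqP => [->|] //=; by rewrite eq_sym neq.
move/eqP; rewrite subr_eq0 (IH ile') => /eqP E.
have := congr1 (fun x => tauA (- 1%:Z) * x) E; rewrite !mulrA -!tauAD addNr tauA0 mul1r => ->.
by congr (tauA _ * _); lia.
Qed.

(** Sending the link at height [i] to [t ^ - i x_e] inverts the map on generators, so the kernel
    comes from comparing relations. By [link_cut] those of the graph algebra land in L + N;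
    conversely, saturated sets have excess 0 and give back the relations of N up to a power of
    [t]. *)
Lemma edge_ring_algebra_map : exists phi : {rmorphism ER -> AR},
  [/\ forall c, phi (edge_scalar s c) = algebra_scalar H c,
      forall e, phi (xvar F s e) = algebra_var F (first_link l e),
      forall z, exists a, phi a = z
    & forall a : ER, phi a = 0 <->
        (a : ER^o) \in gen (@linear_gens F G s `|` @nonlocal_gens F G s)].
Proof.
pose alphaf (e : edge G + edge G) : PA := match e with
  | inl e => 'X_(enum_rank (first_link l e))
  | inr e => (tpow F (- (l e)%:Z))%:MP * 'X_(enum_rank (first_link l e)) end.
pose alpha := [tuple alphaf (enum_val i) | i < #|{: edge G + edge G}|].
have alphaX e : 'X_(enum_rank e) \mPo alpha = alphaf e.
  by rewrite comp_mpolyXU -tnth_nth tnth_mktuple enum_rankK.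
pose qA : {rmorphism PA -> AR} := toquot_ring (graph_algebra_rel (F := F) (G := H)).
have rel0 x : edge_ring_rel s x -> (qA \o comp_mpoly alpha) x = 0.
  move=> [e ->] /=; suff -> : comp_mpoly alpha ((tpow F (l e))%:MP * 'X_(enum_rank (inr e)) -
      'X_(enum_rank (inl e))) = 0 by rewrite rmorph0.
  rewrite rmorphB rmorphM /= comp_mpolyC !alphaX /=.
  by rewrite mulrA -mpolyCM -tpowD subrr tpow0 mpolyC1 mul1r subrr.
have [phi phiE] := quot_ring_lift rel0.
have phiC c : phi (edge_scalar s c) = algebra_scalar H c by rewrite phiE /= comp_mpolyC.
have phix e : phi (xvar F s e) = XA e by rewrite phiE /= alphaX.
have phiy e : phi (yvar F s e) = tauA (- (l e)%:Z) * XA e by rewrite yvarE rmorphM phiC phix.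
pose betaf (k : edge H) : P2 :=
  (tpow F (- (tagged k : nat)%:Z))%:MP * 'X_(enum_rank (inl (tag k) : edge G + edge G)).
pose beta := [tuple betaf (enum_val i) | i < #|edge H|].
have betaX k : 'X_(enum_rank k) \mPo beta = betaf k.
  by rewrite comp_mpolyXU -tnth_nth tnth_mktuple enum_rankK.
pose qE : {rmorphism P2 -> ER} := toquot_ring (edge_ring_rel (F := F) s).
have qEbeta k : qE ('X_(enum_rank k) \mPo beta) = link_value tauE (xvar F s) k.
  by rewrite betaX rmorphM.
pose LN := gen (@linear_gens F G s `|` @nonlocal_gens F G s).
exists phi; split=> //.
- move=> z; suff [p <-] : exists p : PA, qA p = z.
    exists (qE (p \mPo beta)); rewrite phiE /=; apply/eqP; rewrite -subr_eq0 -rmorphB; apply/eqP.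
    rewrite -opprB rmorphN; apply/eqP; rewrite oppr_eq0; apply/eqP/toquot_ring0P.
    apply: (rmorph_cong (J := [set p : PA | (p : PA^o) \in gen (graph_algebra_rel (F := F) (G := H))])
      (h := comp_mpoly alpha \o comp_mpoly beta)) => [|c|i /=].
    + exact: gen_ideal.
    + by rewrite /= !comp_mpolyC.
    have {i} [k ->] : exists k, i = enum_rank k by exists (enum_val i); rewrite enum_valK.
    apply/toquot_ring0P; rewrite rmorphB betaX rmorphM /= comp_mpolyC alphaX /= rmorphM.
    apply/eqP; rewrite subr_eq0; apply/eqP; exact: algebra_var_link.
  by exists (repr z); apply: toquot_repr.
have gensE : forall x : PA, graph_algebra_rel x -> (qE (x \mPo beta) : ER^o) \in LN.
  move=> x [[v tv ->]|[Gam ->]].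
    rewrite rmorphB rmorphM !rmorph_sum /= comp_mpolyC rmorphB rmorphM !rmorph_sum.
    rewrite (eq_bigr (link_value tauE (xvar F s))) => [|k _]; last exact: qEbeta.
    rewrite [X in _ - X](eq_bigr (link_value tauE (xvar F s))) => [|k _]; last exact: qEbeta.
    case: v tv => // v tv.
    rewrite (sum_tail_link l (xvar F s) tauE0) (sum_head_link framing_head (xvar F s) tauED) -mulrBr.
    apply: gen_mull; apply: gen_incl; left; exists v => //; congr (_ - _).
    by apply: eq_bigr => e _; rewrite yvarE.
  rewrite rmorphB rmorphM !rmorph_prod /= comp_mpolyC rmorphB rmorphM !rmorph_prod.
  rewrite (eq_bigr (link_value tauE (xvar F s))) => [|k _]; last exact: qEbeta.
  rewrite [X in _ - X](eq_bigr (link_value tauE (xvar F s))) => [|k _]; last exact: qEbeta.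
  rewrite -[X in X * _ - _]/(tauE (algebra_weight Gam)).
  rewrite (link_cut in_degree framing_head (xvar F s) tauE0 tauED).
  apply: gen_mull; apply: gen_incl; right; exists (old_vertices Gam); congr (_ - _).
  by apply: eq_bigr => e _; rewrite yvarE.
move=> a; split=> [pa0|].
  have := phiE (repr a); rewrite [toquot_ring _ _](toquot_repr a) pa0 => /esym/toquot_ring0P H0.
  have {}H0 : (qE ((repr a \mPo alpha) \mPo beta) : ER^o) \in LN.
    exact: (gen_rmorph (h := qE \o comp_mpoly beta) gensE H0).
  suff qEa : qE ((repr a \mPo alpha) \mPo beta) = qE (repr a) by rewrite -(toquot_repr a) -[toquot _ _]qEa.
  apply/eqP; rewrite eq_sym -subr_eq0 -rmorphB; apply/eqP/toquot_ring0P.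
  apply: (rmorph_cong (J := [set p : P2 | (p : P2^o) \in gen (edge_ring_rel (F := F) s)])
      (h := comp_mpoly beta \o comp_mpoly alpha)) => [|c|i /=].
  + exact: gen_ideal.
  + by rewrite /= !comp_mpolyC.
  have {i} [k ->] : exists k, i = enum_rank k by exists (enum_val i); rewrite enum_valK.
  rewrite alphaX; case: k => e /=.
    by rewrite betaX /betaf /= oppr0 tpow0 mpolyC1 mul1r subrr rpred0.
  rewrite rmorphM /= comp_mpolyC betaX /betaf /= oppr0 tpow0 mpolyC1 mul1r.
  apply/toquot_ring0P; rewrite rmorphB rmorphM; apply/eqP; rewrite subr_eq0; apply/eqP.
  exact: yvarE.
apply: gen_rmorph0.
move=> x [[v tv ->]|[Gam ->]] /=.
  have := algebra_linear (v := inl v) tv.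
  rewrite (eq_bigr (link_value tauA XA)) => [|k _]; last exact: algebra_var_link.
  rewrite [X in _ - X](eq_bigr (link_value tauA XA)) => [|k _]; last exact: algebra_var_link.
  rewrite (sum_tail_link l XA tauA0) (sum_head_link framing_head XA tauAD) -mulrBr => E.
  rewrite rmorphB !rmorph_sum (eq_bigr XA) => [|e _]; last exact: phix.
  rewrite [X in _ - X](eq_bigr (fun e => tauA (- (l e)%:Z) * XA e)) => [|e _]; last exact: phiy.
  have := congr1 (fun x => tauA (- 1%:Z) * x) E.
  by rewrite mulr0 mulrA -tauAD addNr tauA0 mul1r.
have := algebra_cut (saturation l Gam).
rewrite (eq_bigr (link_value tauA XA)) => [|k _]; last exact: algebra_var_link.
rewrite [X in _ - X](eq_bigr (link_value tauA XA)) => [|k _]; last exact: algebra_var_link.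
rewrite (link_cut in_degree framing_head XA tauA0 tauAD) old_saturation.
rewrite (prod_expr0 XA (excess_saturation l Gam)) mulr1.
set C := (_ - _ : int) => E.
rewrite rmorphB rmorphM phiC !rmorph_prod (eq_bigr XA) => [|e _]; last exact: phix.
rewrite [X in _ - X](eq_bigr (fun e => tauA (- (l e)%:Z) * XA e)) => [|e _]; last exact: phiy.
have := congr1 (fun x => tauA (- C) * x) E.
by rewrite mulr0 mulrA -tauAD addNr tauA0 mul1r.
Qed.

End AlgebraMap.

(** * Graph homology of a framed graph *)

Section ZeroDegree.
Variables (E : comNzRingType) (Lg Ng : set E^o).
Local Notation M := (quot Lg).
Local Notation N := (quot Ng).
Local Notation Q := (quot (Lg `|` Ng)).

Lemma gen_annihilates (T : lmodType E) (S : set E^o) (x : T) (a : E) :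
  (forall b : E, S b -> b *: x = 0) -> (a : E^o) \in gen S -> a *: x = 0.
Proof.
move=> Sx; apply: (gen_sub (M := E^o) (U := [set a : E^o | (a : E) *: x = 0])) => //.
split=> [|b y z /= y0 z0]; first by rewrite /= scale0r.
by rewrite scalerDl z0 addr0 -scalerA y0 scaler0.
Qed.

Lemma quot_kill (a : E) (x : Q) : (a : E^o) \in gen Ng -> a *: x = 0.
Proof.
apply: gen_annihilates => b Nb; rewrite -[x]toquot_repr -linearZ; apply/toquot0P.
by rewrite [_ *: _]mulrC; apply: gen_mull; apply: gen_incl; right.
Qed.

(** Induced by sending [m] tensor [n] to [n m]. Boundaries come from the first syzygy, on which the
    evaluation [free_lift id] vanishes. *)
Lemma tor0_to_quot : exists h : {linear tor 0 M N -> Q}, forall (c : submod (@tor_cycles E M N 0)) z n,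
  submod_val c = pure z n -> exists2 p : {linear M -> Q},
    (forall x, p (toquot Lg x) = toquot _ x) &
    h (toquot _ c) = (repr n : E) *: p (free_lift id z).
Proof.
have [|p pE] := @quot_lift E E^o Q Lg (toquot _).
  by move=> x Lx; apply/toquot0P/gen_incl; left.
have reprP (y : E^o) (x : Q) : (repr (toquot Ng y) : E) *: x = (y : E) *: x.
  apply/eqP; rewrite -subr_eq0 -scalerBl; apply/eqP/quot_kill.
  by apply/toquotP; rewrite toquot_repr.
have [||h0 h0E] := @tensor_lift E {malg E[M]} N Q (fun z n => (repr n : E) *: p (free_lift id z)).
- by move=> a z z' n; rewrite (linearP (free_lift id)) (linearP p) scalerDr !scalerA mulrC.
- move=> a z n n'; rewrite -[in LHS](toquot_repr n) -[in LHS](toquot_repr n').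
  by rewrite -linearP reprP scalerDl scalerA.
have [h1 h1E] : exists h1 : {linear submod (@tor_cycles E M N 0) -> Q}, forall c, h1 c = h0 (submod_val c).
  by apply: linear_ex => a x y; rewrite !linearP.
have dE : exists2 d : {linear tensor (resolution M 1) N -> tensor (resolution M 0) N},
    tor_diff (M := M) (N := N) (n := 0) =1 d
    & forall m q, d (pure m q) = pure (free_lift (fun z : syzygy M 1 => submod_val z) m) q.
  exact: (tensor_mapl_linear N (free_lift (fun z : syzygy M 1 => submod_val z))).
have [d dd dpure] := dE.
have [|h hE] := @quot_lift E _ Q (@tor_boundaries E M N 0) h1.
  move=> c [y yE]; rewrite h1E yE dd.
  apply: (tensor_ind (Q := [set y | h0 (d y) = 0])) => [|x n] /=.
    split=> [|a u v /= u0 v0]; first by rewrite /= !linear0.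
    by rewrite !linearP u0 v0 scaler0 addr0.
  rewrite dpure h0E -(free_lift_comp _ (free_lift id)) (_ : free_lift _ x = 0) ?linear0 ?scaler0 //.
  rewrite /free_lift big1 // => k _.
  have [_ /(_ (submod_val k)) [_ H] _] := syzygy_exact M 0.
  rewrite -/(free_lift id (submod_val k)) H ?scaler0 //; by exists k.
exists h => c z n cE; exists p => //; by rewrite hE h1E cE h0E.
Qed.

Lemma tor0_cyclic : exists t0 : tor 0 M N,
  [/\ forall t, exists a : E, t = a *: t0,
      forall a : E, (a : E^o) \in gen (Lg `|` Ng) -> a *: t0 = 0
    & exists h : {linear tor 0 M N -> Q}, h t0 = toquot _ (1 : E^o)].
Proof.
pose one : {malg E[M]} := << toquot Lg (1 : E^o) >>.
pose q1 : N := toquot Ng (1 : E^o).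
have inT x : x \in gen (@tor_cycles E M N 0) by apply: gen_incl.
pose c0 : submod (@tor_cycles E M N 0) := Submod (inT (pure one q1)).
have boundary z : free_lift id z = 0 :> M -> forall c : submod (@tor_cycles E M N 0),
    submod_val c = pure z q1 -> toquot (@tor_boundaries E M N 0) c = 0.
  move=> z0 c cE; apply/toquot0P/gen_incl.
  have [_ /(_ z) [+ _] _] := syzygy_exact M 0; case=> // k kE.
  have dE : exists2 d : {linear tensor (resolution M 1) N -> tensor (resolution M 0) N},
      tor_diff (M := M) (N := N) (n := 0) =1 d
      & forall m q, d (pure m q) = pure (free_lift (fun z : syzygy M 1 => submod_val z) m) q.
    exact: (tensor_mapl_linear N (free_lift (fun z : syzygy M 1 => submod_val z))).
  have [d dd dpure] := dE; exists (pure << k >> q1).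
  have fk : free_lift (fun z : syzygy M 1 => submod_val z) << k >> = submod_val k := free_liftU _ _.
  rewrite cE dd dpure fk -kE; reflexivity.
have one_id (a : E) : free_lift id (a *: one) = toquot Lg (a : E^o).
  rewrite linearZ /= free_liftU -linearZ; congr toquot; exact: mulr1.
exists (toquot _ c0); split.
- move=> t; rewrite -[t]toquot_repr; move: (repr t) => c {t}.
  have [z zE] := tensor_quotE (submod_val c); pose a : E := repr (free_lift id z : M).
  exists a; apply/eqP; rewrite -subr_eq0 -linearZ -linearB; apply/eqP.
  apply: (boundary (z - a *: one)); first by rewrite linearB /= one_id toquot_repr subrr.
  by rewrite pureBl pureZl -zE.
- move=> a; apply: gen_annihilates => b [Lb|Nb]; rewrite -linearZ.
    apply: (boundary (b *: one)); last by rewrite pureZl.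
    by rewrite one_id; apply/toquot0P/gen_incl.
  rewrite (_ : b *: c0 = 0) ?linear0 //; apply: val_inj; rewrite linearZ /= -pureZr -linearZ /=.
  rewrite (_ : toquot Ng _ = 0) ?pure0r ?linear0 //; apply/toquot0P.
  by rewrite [_ *: _]mulr1; apply: gen_incl.
- have [h hE] := tor0_to_quot; exists h.
  have [p pE ->] := hE c0 one q1 erefl.
  rewrite free_liftU pE -linearZ [_ *: _]mulr1.
  apply/toquotP; have : repr q1 - (1 : E^o) \in gen Ng by apply/toquotP; rewrite toquot_repr.
  by apply: gen_mono => x; right.
Qed.

Variable V : lmodType E.

Lemma exterior0_cyclic : exists e0 : exterior 0 V,
  (forall e, exists a : E, e = a *: e0) /\
  exists h : {linear exterior 0 V -> E^o}, h e0 = 1.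
Proof.
pose w0 : {ffun 'I_0 -> V} := [ffun i => 0].
have wE (w : {ffun 'I_0 -> V}) : w = w0 by apply/ffunP => -[].
exists (toquot _ << w0 >>); split.
  move=> e; rewrite -[e]toquot_repr [repr e]malgZE; move: (repr e) => z {e}.
  exists (\sum_(s <- monalg.msupp z) monalg.mcoeff s z).
  rewrite -linearZ scaler_suml; congr toquot; apply: eq_bigr => s _.
  by rewrite (wE s).
have [|h hE] := @quot_lift E _ E^o (exterior_rel (j := 0) (V := V)) (free_lift (fun=> 1)).
  by move=> z [[w [[]]]|[w [[]]]].
by exists h; rewrite hE /= free_liftU.
Qed.

End ZeroDegree.

Lemma tensor_cyclic_quot (E : comNzRingType) (S : set E^o) (T X : lmodType E) (t0 : T) (e0 : X)
    (ht : {linear T -> quot S}) (he : {linear X -> E^o}) :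
  (forall t, exists a : E, t = a *: t0) -> (forall e, exists a : E, e = a *: e0) ->
  (forall a : E, (a : E^o) \in gen S -> a *: t0 = 0) ->
  ht t0 = toquot _ (1 : E^o) -> he e0 = 1 ->
  exists f : {linear tensor T X -> quot S}, bijective f.
Proof.
move=> t0gen e0gen t0ann ht0 he0.
have [||f fE] := @tensor_lift E T X (quot S) (fun t e => (he e : E) *: ht t).
- by move=> a t t' e; rewrite linearP scalerDr !scalerA mulrC.
- by move=> a t e e'; rewrite linearP scalerDl scalerA.
have zE z : exists a : E, z = a *: pure t0 e0.
  apply: (tensor_ind (Q := [set z | exists a : E, z = a *: pure t0 e0])) => [|t e] /=.
    split=> [|a _ _ [b ->] [c ->]]; first by exists 0; rewrite scale0r.
    by exists (a * b + c); rewrite scalerDl scalerA.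
  have [a ->] := t0gen t; have [b ->] := e0gen e; exists (a * b).
  by rewrite pureZl pureZr scalerA.
have f0 (a : E) : f (a *: pure t0 e0) = toquot _ (a : E^o).
  by rewrite linearZ /= fE he0 scale1r ht0 -linearZ; congr toquot; apply: mulr1.
exists f; exists (fun q => (repr q : E) *: pure t0 e0) => z.
  have [a ->] := zE z; rewrite f0; apply/eqP; rewrite -subr_eq0 -scalerBl -pureZl.
  rewrite t0ann ?pure0l //; by apply/toquotP; rewrite toquot_repr.
by rewrite f0; apply: toquot_repr.
Qed.

Lemma tensor_tor0_quot (E : comNzRingType) (Lg Ng : set E^o) (V : lmodType E) :
  exists f : {linear tensor (tor 0 (quot Lg) (quot Ng)) (exterior 0 V) -> quot (Lg `|` Ng)},
    bijective f.
Proof.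
have [t0 [t0gen t0ann [ht ht0]]] := tor0_cyclic Lg Ng.
have [e0 [e0gen [he he0]]] := exterior0_cyclic V.
exact: tensor_cyclic_quot t0gen e0gen t0ann ht0 he0.
Qed.

Lemma quot_ring_semilinear (E : comNzRingType) (S : set E^o) (A : pzRingType)
    (phi : {rmorphism E -> A}) (T : lmodType E) (f : {linear T -> quot S}) :
  (forall z, exists a, phi a = z) -> (forall a : E, phi a = 0 <-> (a : E^o) \in gen S) ->
  bijective f ->
  exists g : {additive T -> A}, bijective g /\ forall (a : E) z, g (a *: z) = phi a * g z.
Proof.
move=> /boolp.choice[psi psiE] phiK [f' fK f'K].
have phi_repr (x : E) : phi (repr (toquot S (x : E^o)) : E) = phi x.
  apply/eqP; rewrite -subr_eq0 -rmorphB; apply/eqP/phiK/toquotP.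
  by rewrite toquot_repr.
pose g z : A := phi (repr (f z) : E).
have gB : zmod_morphism g.
  move=> x y; rewrite /g linearB -[f x]toquot_repr -[f y]toquot_repr -linearB !phi_repr.
  exact: rmorphB.
have gZ (a : E) z : g (a *: z) = phi a * g z.
  by rewrite /g linearZ -[f z]toquot_repr -linearZ !phi_repr -rmorphM.
exists (HB.pack g (GRing.isZmodMorphism.Build T A g gB) : {additive T -> A}); split=> //.
exists (fun x => f' (toquot S (psi x : E^o))) => x /=; last by rewrite /g f'K phi_repr psiE.
rewrite -[RHS]fK -[f x in RHS]toquot_repr; congr f'; apply/toquotP/phiK.
by rewrite rmorphB psiE subrr.
Qed.

Section Vanishing.
Variable E : comNzRingType.

Lemma tensor_eq0 (M N : lmodType E) : (forall m : M, m = 0) -> forall z : tensor M N, z = 0.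
Proof.
move=> M0; apply: (tensor_ind (Q := [set z | z = 0])) => [|m n /=]; last by rewrite (M0 m) pure0l.
by split=> // a x y /= -> ->; rewrite scaler0 addr0.
Qed.

Lemma tensor_eq0r (M N : lmodType E) : (forall n : N, n = 0) -> forall z : tensor M N, z = 0.
Proof.
move=> N0; apply: (tensor_ind (Q := [set z | z = 0])) => [|m n /=]; last by rewrite (N0 n) pure0r.
by split=> // a x y /= -> ->; rewrite scaler0 addr0.
Qed.

Lemma tor_unit_ideal (Ng : set E^o) (M : lmodType E) i :
  (1 : E^o) \in gen Ng -> forall z : tor i M (quot Ng), z = 0.
Proof.
move=> N1 z; rewrite -[z]toquot_repr (_ : repr z = 0) ?linear0 //; apply: val_inj.
have [x xE] := tensor_quotE (submod_val (repr z)).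
by rewrite [LHS]xE; move/toquot0P: N1 => ->; rewrite pure0r.
Qed.

Lemma exterior_zero (V : lmodType E) j : (forall v : V, v = 0) -> (0 < j)%N ->
  forall e : exterior j V, e = 0.
Proof.
case: j => // j V0 _ e; rewrite -[e]toquot_repr [repr e]malgZE linear_sum big1 // => w _.
rewrite linearZ /= (_ : toquot _ << w >> = 0) ?scaler0 //; apply/toquot0P.
(* Since all tuples coincide, linearity with [a = 1] reads [w - w - w = - w]. *)
rewrite -rpredN; apply: gen_incl; left; exists w, ord0, 1, 0, 0.
have updw v : upd w ord0 v = w by apply/ffunP => k; rewrite ffunE (V0 (w k)) (V0 v); case: eqP.
by rewrite !updw scale1r subrr add0r.
Qed.

End Vanishing.

Section Main.
Variables (F : fieldType) (G : graph) (l : edge G -> nat) (v0 : vertex G).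
Local Notation s := (fun e : edge G => Posz (l e)).
Local Notation ER := (edge_ring F s).

Hypothesis in_degree : forall v : vertex G,
  #|[pred e | head e == Some v]| = if thick v then 2 else 1%N.
Hypothesis out_degree : forall v : vertex G,
  #|[pred e | tail e == Some v]| = if thick v then 2 else 1%N.
Hypothesis framing_head : forall e : edge G, head e != None -> (0 < l e)%N.
Hypothesis framing_tail : forall e : edge G, tail e != None -> (0 < l e + (head e == None))%N.

Lemma linear_gensE :
  first_gens (edge_linear_form F l v0) #|@thick G| = @linear_gens F G s.
Proof.
apply/seteqP; split=> [x [i ir ->]|x [v tv ->]].
  by exists (thick_vertex v0 i) => //; apply: thick_vertexP.
exists (index v (enum (@thick G))); first by rewrite cardE index_mem mem_enum.
by rewrite /edge_linear_form /thick_vertex nth_index // mem_enum.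
Qed.

Lemma closed_component_unit (C : {set vertex G}) : C \in nonspecial_components G ->
  (1 : ER^o) \in gen (@nonlocal_gens F G s).
Proof.
rewrite inE => /andP[/imsetP[v _ CE] nsp].
have adj_mem u w : adjacent u w -> u \in C -> w \in C.
  rewrite CE !inE => uw vu; apply: connect_trans vu _; exact: connect1.
have vC : v \in C by rewrite CE inE connect0.
have nin e : (head_in C e -> tail e != None) /\ (tail_in C e -> head e != None).
  move: nsp; rewrite /special negb_exists => /forallP/(_ e); rewrite negb_or !negb_and.
  by case/andP => /orP[/negPf->|->] /orP[/negPf->|->].
have noleave e : e \notin leaving C.
  rewrite inE; apply/negP => /andP[te]; have := (nin e).2 te; move: te; rewrite /tail_in /head_in.
  case te: (tail e) => [u|//] uC; case he: (head e) => [w|//] _; rewrite (adj_mem u w) //.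
  by apply/existsP; exists e; rewrite te he !eqxx.
have noenter e : e \notin entering C.
  rewrite inE; apply/negP => /andP[he]; have := (nin e).1 he; move: he; rewrite /tail_in /head_in.
  case he: (head e) => [u|//] uC; case te: (tail e) => [w|//] _; rewrite (adj_mem u w) //.
  by apply/existsP; exists e; rewrite te he !eqxx orbT.
(* An out-edge of [v] cannot leave [C]; it has a head, so its framing is positive. *)
have w0 : (0 < \sum_(e in inner C) l e)%N.
  have /card_gt0P[e /eqP te] : (0 < #|[pred e : edge G | tail e == Some v]|)%N.
    by rewrite out_degree; case: ifP.
  have tC : tail_in C e by rewrite /tail_in te.
  have hC : head_in C e by have := noleave e; rewrite inE tC /= negbK.
  rewrite (bigD1 e) /= ?inE ?tC // addn_gt0 framing_head //; exact: (nin e).2.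
have [c cE] := one_sub_tpow_inv F w0.
have -> : (1 : ER) = - (edge_scalar s c) * (edge_scalar s (tpow F (framing_weight s C)) - 1).
  have -> : framing_weight s C = (\sum_(e in inner C) l e)%N%:Z.
    by rewrite (big_morph Posz PoszD (erefl 0%:Z)).
  rewrite mulNr -mulrN opprB /edge_scalar -[X in X - _](rmorph1 (toquot_ring (edge_ring_rel s))).
  rewrite -rmorphB -rmorphM -(mpolyC1 _ (laurent F)) -mpolyCB -mpolyCM mulrC cE mpolyC1.
  exact/esym/rmorph1.
apply: gen_mull; apply: gen_incl; exists C.
rewrite big_pred0 ?big_pred0 ?mulr1 // => e; apply/negbTE; [exact: noenter | exact: noleave].
Qed.

(** Isolates what is required of a closed braid: the degrees of thick edges and bivalent vertices,
    and framings that are positive away from the top boundary. *)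
Theorem framed_graph_homology :
  exists phi : {rmorphism ER -> graph_algebra F (subdivision l)},
    [/\ (forall c : laurent F, phi (edge_scalar s c) = algebra_scalar (subdivision l) c),
        (forall e : edge G, phi (xvar F s e) = algebra_var F (first_link l e)),
        (exists f : {additive graph_homology F s 0 0 -> graph_algebra F (subdivision l)},
            bijective f /\
            (forall (a : ER) (z : graph_homology F s 0 0), f (a *: z) = phi a * f z))
      & (forall i j : nat, (0 < i + j)%N -> forall z : graph_homology F s i j, z = 0)].
Proof.
have [phi [phiC phix phis phik]] := edge_ring_algebra_map F in_degree framing_head.
exists phi; split => //.
  (* This identification of degree 0 also covers graphs with closed components, where both sides
     vanish. *)
  have [f fbij] := tensor_tor0_quot (@linear_gens F G s) (@nonlocal_gens F G s) (component_module F s).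
  exact: (quot_ring_semilinear phis phik fbij).
move=> i j ij z.
have [conn|/finset.set0Pn[C nsC]] := eqVneq (nonspecial_components G) finset.set0; last first.
  by apply: tensor_eq0 => t; apply: tor_unit_ideal (closed_component_unit nsC) _.
have [i0|i0] := posnP i; last first.
  case: i i0 z {ij} => // i _ z; apply: tensor_eq0 => t; apply: tor_acyclic => m.
  rewrite -linear_gensE; apply: quot_acyclic (leqnn _).
    exact: linear_form_regular.
  exact: linear_form_regular_nonlocal.
apply: tensor_eq0r; apply: exterior_zero; last by rewrite i0 in ij.
move=> v; rewrite [v]malgZE big1_seq // => -[D nsD]; exfalso.
by move: nsD; rewrite conn inE.
Qed.

End Main.

(** * Closed braid graphs *)

Lemma ohead_filter_ord n (P : pred 'I_n) j : ohead [seq i <- enum 'I_n | P i] = Some j ->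
  P j /\ forall i : 'I_n, (i < j)%N -> ~~ P i.
Proof.
have : sorted ltn (map val (enum 'I_n)) by rewrite val_enum_ord iota_ltn_sorted.
have mem i : i \in enum 'I_n by rewrite mem_enum.
suff H s : sorted ltn (map val s) -> ohead [seq i <- s | P i] = Some j ->
    P j /\ forall i : 'I_n, i \in s -> (i < j)%N -> ~~ P i.
  by move=> /H h /h [Pj hj]; split=> // i; apply: hj.
elim: s => //= x s IH; rewrite path_sortedE; last exact: ltn_trans.
case/andP => /allP gtx ss; case: ifP => Px /=.
  move=> [<-]; split=> // i; rewrite inE => /orP[/eqP->|si]; first by rewrite ltnn.
  by move=> ix; have := ltn_trans ix (gtx (val i) (map_f val si)); rewrite ltnn.
move=> /(IH ss)[Pj hj]; split=> // i; rewrite inE => /orP[/eqP->|]; [by rewrite Px | exact: hj].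
Qed.

Lemma ohead_filter_none n (P : pred 'I_n) : ohead [seq i <- enum 'I_n | P i] = None ->
  forall i, ~~ P i.
Proof.
case E: [seq _ <- _ | _] => [|//] _ i; apply/negP => Pi.
by have := mem_filter P i (enum 'I_n); rewrite E mem_enum Pi.
Qed.

Section ClosedBraidGraph.
Variable B : braid_graph.
Local Notation strand := 'I_(width B).+1.
Local Notation layer := 'I_(layers B).
Local Notation G := (closed_braid B).
Local Notation position := {p : layer * strand | occupied p.1 p.2}.
Local Notation lay p := (val p).1.
Local Notation str p := (val p).2.

Lemma next_layerP (k j : layer) (s : strand) : next_layer k s = Some j ->
  [/\ (k < j)%N, occupied j s & forall i : layer, (k < i)%N -> (i < j)%N -> ~~ occupied i s].
Proof.
move=> /ohead_filter_ord[/andP[kj oj] hj]; split=> // i ki ij.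
by have := hj i ij; rewrite ki.
Qed.

Lemma next_layerN (k : layer) (s : strand) : next_layer k s = None ->
  forall i : layer, (k < i)%N -> ~~ occupied i s.
Proof. by move=> /ohead_filter_none H i ki; have := H i; rewrite ki. Qed.

Lemma first_layerP (j : layer) (s : strand) : first_layer s = Some j ->
  occupied j s /\ forall i : layer, (i < j)%N -> ~~ occupied i s.
Proof. exact: ohead_filter_ord. Qed.

Lemma first_layer_ex (s : strand) : exists j, first_layer s = Some j.
Proof.
case E: (first_layer s) => [j|]; first by exists j.
have [k ok] := strand_vertex s.
by have := ohead_filter_none E k; rewrite /occupied ok.
Qed.

(** Edges are indexed by the position where they start; this relation records where they end. The
    lemmas below make it a bijection between the edges with a head and the positions, through which
    in-degrees are counted. *)
Definition arrives (e : edge G) (p : position) : Prop :=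
  match e with
  | None => str p = ord0 /\ first_layer ord0 = Some (lay p)
  | Some q => str q = str p /\ (next_layer (lay q) (str q) = Some (lay p) \/
      [/\ next_layer (lay q) (str q) = None, str q != ord0 & first_layer (str q) = Some (lay p)])
  end.

Lemma arrives_head e p : arrives e p -> head e = vertex_at (str p) (lay p).
Proof.
case: e => [[[k s] o]|] /=; last by case=> -> ->.
case: p => -[j s'] o' /= [->] [->//|[-> sn0 ->]].
by rewrite (negPf sn0).
Qed.

Lemma head_arrives e v : head e = Some v -> exists p, arrives e p.
Proof.
case: e => [[[k s] o]|] /=.
  case E: (next_layer k s) => [j|].
    by move=> _; have [_ oj _] := next_layerP E; exists (exist _ (j, s) oj); split; [|left].
  case: ifP => // /negbT s0; have [j jE] := first_layer_ex s; rewrite jE /= => _.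
  by have [oj _] := first_layerP jE; exists (exist _ (j, s) oj); split; [|right].
have [j jE] := first_layer_ex ord0; rewrite jE /= => _.
by have [oj _] := first_layerP jE; exists (exist _ (j, ord0) oj).
Qed.

Lemma arrives_fun e p p' : arrives e p -> arrives e p' -> p = p'.
Proof.
move=> ep ep'; apply: val_inj; move: ep ep'; case: p p' => -[j s] o [[j' s'] o'] /=.
case: e => [[[k t] ot]|] /=; last by move=> [ss h] [ss' h']; congr pair; congruence.
by move=> [ts [h|[hN _ h]]] [ts' [h'|[hN' _ h']]]; congr pair; congruence.
Qed.

Lemma arrives_inj e e' p : arrives e p -> arrives e' p -> e = e'.
Proof.
have contra_next (k i j : layer) t : next_layer k t = Some j -> occupied i t ->
    (k < i)%N -> (i < j)%N -> False.
  by move=> /next_layerP[_ _ H] oi ki ij; apply: (negP (H i ki ij)).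
have contra_none (k i : layer) t : next_layer k t = None -> occupied i t -> (k < i)%N -> False.
  by move=> /next_layerN H oi ki; apply: (negP (H i ki)).
have contra_first (k j : layer) t : next_layer k t = Some j -> occupied k t ->
    first_layer t = Some j -> False.
  by move=> /next_layerP[kj _ _] ok /first_layerP[_ H]; apply: (negP (H k kj)).
have next_lt (k j : layer) t : next_layer k t = Some j -> (k < j)%N by case/next_layerP.
have not_lt (k k' j : layer) t : occupied k t -> occupied k' t ->
    (next_layer k t = Some j \/
      [/\ next_layer k t = None, t != ord0 & first_layer t = Some j]) ->
    (next_layer k' t = Some j \/
      [/\ next_layer k' t = None, t != ord0 & first_layer t = Some j]) -> (k < k')%N -> False.
  move=> ok ok' [E|[E _ fl]] E' lt; last exact: contra_none E ok' lt.
  case: E' => [E'|[E' _ fl]]; first exact: contra_next E ok' lt (next_lt _ _ _ E').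
  exact: contra_first E ok fl.
case: p => -[j s] oj; case: e => [[[k t] o]|]; case: e' => [[[k' t'] o']|] //=.
- have ok : occupied k t := o; have ok' : occupied k' t' := o'.
  move=> [ts E] [ts' E']; subst t t'; congr Some; apply: val_inj => /=; congr pair.
  apply: val_inj; case: (ltngtP k k') => // lt; first by case: (not_lt k k' j s).
  by case: (not_lt k' k j s).
- have ok : occupied k t := o.
  move=> [ts E] [s0 fl]; subst t s; case: E => [E|[_ t0 _]]; last by rewrite eqxx in t0.
  by case: (contra_first _ _ _ E ok fl).
- have ok' : occupied k' t' := o'.
  move=> [s0 fl] [ts E]; subst t' s; case: E => [E|[_ t0 _]]; last by rewrite eqxx in t0.
  by case: (contra_first _ _ _ E ok' fl).
Qed.

(** The edge starts at the last occupied layer below [p]. If there is none, it is the bottom edge on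
    strand 0, and on any other strand the closing arc, which starts at the highest occupied
    layer. *)
Lemma arrives_ex p : exists e, arrives e p.
Proof.
case: p => -[j s] oj /=.
have [/existsP[k /andP[kj ok]]|nok] := boolP [exists k : layer, (k < j)%N && occupied k s].
  pose m := [arg max_(i > k | (i < j)%N && occupied i s) i].
  have [mj om mmax] : [/\ (m < j)%N, occupied m s &
      forall i : layer, (i < j)%N && occupied i s -> (i <= m)%N].
    by rewrite /m; case: arg_maxnP => [|i /andP[ij oi] hi]; [rewrite kj ok | split].
  exists (Some (exist _ (m, s) om)); split=> //=; left.
  case E: (next_layer m s) => [i|]; last by have := next_layerN E mj; rewrite oj.
  have [mi oi hi] := next_layerP E; congr Some; apply: val_inj.
  case: (ltngtP i j) => // lt; last by have := hi j mj lt; rewrite oj.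
  by have := mmax i; rewrite lt oi => /(_ isT); rewrite leqNgt mi.
have fE : first_layer s = Some j.
  have [i iE] := first_layer_ex s; have [oi hi] := first_layerP iE.
  rewrite iE; congr Some; apply: val_inj.
  case: (ltngtP i j) => // lt; last by have := hi j lt; rewrite oj.
  by move: nok; rewrite negb_exists => /forallP/(_ i); rewrite lt oi.
have [s0|s0] := eqVneq s ord0; first by exists None; rewrite /= -s0.
pose m := [arg max_(i > j | occupied i s) i].
have [om mmax] : occupied m s /\ forall i : layer, occupied i s -> (i <= m)%N.
  by rewrite /m; case: arg_maxnP => [|i oi hi]; [exact: oj | split].
exists (Some (exist _ (m, s) om)); split=> //=; right; split=> //.
case E: (next_layer m s) => [i|//]; have [mi oi _] := next_layerP E.
by have := mmax i oi; rewrite leqNgt mi.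
Qed.

Definition positions_at (v : vertex G) : {set position} :=
  [set p : position | vertex_at (str p) (lay p) == Some v]%SET.

Lemma closed_braid_out_degree v : #|[pred e : edge G | tail e == Some v]| = #|positions_at v|.
Proof.
have some_inj : injective (@Some position) by move=> p q [].
rewrite -(card_imset (mem (positions_at v)) some_inj).
apply: eq_card => -[p|]; rewrite !inE /=; last by apply/esym/negbTE/imsetP => -[].
apply/idP/imsetP => [pv|[q qv [->]]]; first by exists p; rewrite // inE.
by rewrite inE in qv.
Qed.

Lemma closed_braid_in_degree v : #|[pred e : edge G | head e == Some v]| = #|positions_at v|.
Proof.
have /boolp.choice[a aP] := arrives_ex.
have a_inj : injective a by move=> p q E; apply: (@arrives_fun (a p)) => //; rewrite E.
rewrite -(card_imset (mem (positions_at v)) a_inj).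
apply: eq_card => e; rewrite !inE; apply/eqP/imsetP => [he|[p]].
  have [p ep] := head_arrives he; exists p; last exact: arrives_inj ep (aP p).
  by rewrite inE -(arrives_head ep) he.
by rewrite inE => /eqP pv ->; rewrite (arrives_head (aP p)).
Qed.

Lemma card_feet (i : 'I_(width B)) : #|feet i| = 2.
Proof.
have -> : feet i = [set widen_ord (leqnSn _) i; lift ord0 i]%SET.
  by apply/setP => t; rewrite !inE -!val_eqE /= /bump add1n.
by rewrite cards2 -val_eqE /= /bump add1n neq_ltn ltnSn.
Qed.

Lemma card_positions_at v : #|positions_at v| = if thick v then 2 else 1%N.
Proof.
case: v => [k|[[k s] sk]] /=.
  rewrite -(card_feet (crossing k)).
  have occ s : s \in feet (crossing k) -> occupied k s by rewrite /occupied => ->.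
  rewrite -(card_in_imset (D := positions_at (inl k)) (f := fun p : position => str p)).
    apply: eq_card => s; apply/imsetP/idP => [[p]|sk].
      rewrite inE /vertex_at; case: ifP => [+ /eqP[<-] ->//|_]; case: insubP => //.
    exists (exist _ (k, s) (occ s sk)) => //; by rewrite inE /vertex_at /= sk.
  move=> [[j s] o] [[j' s'] o']; rewrite !inE /vertex_at /=.
  case: ifP => [_ /eqP[jk]|_]; last by case: insubP.
  case: ifP => [_ /eqP[jk']|_]; last by case: insubP.
  by move=> E; apply: val_inj; congr pair; rewrite // jk jk'.
have o : occupied k s by rewrite /occupied; move: (sk) => /= ->; rewrite orbT.
rewrite -(cards1 (exist _ (k, s) o : position)); apply: eq_card => -[[j t] ojt].
rewrite !inE /vertex_at /= -val_eqE /=; case: ifP => tf.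
  apply/esym/negbTE/eqP => -[jk ts]; subst j t.
  by have := bivalent_thin sk; rewrite /= tf.
case: insubP => [u _ uE|]; last first.
  by rewrite /= => nb; move: (ojt); rewrite /occupied /= tf (negPf nb).
rewrite /=; apply/eqP/eqP => [[E]|E]; first by rewrite -uE E.
by congr (Some (inr _)); apply: val_inj; rewrite uE E.
Qed.

Lemma layer_framing_head (e : edge G) : head e != None -> (0 < layer_framing e)%N.
Proof.
case: e => [[[k s] o]|] /=.
  case E: (next_layer k s) => [j|]; first by have [kj _ _] := next_layerP E; rewrite subn_gt0.
  case: ifP => // _; have [j ->] := first_layer_ex s; by rewrite addn_gt0 orbT.
by have [j ->] := first_layer_ex ord0.
Qed.

(** The top edge has framing 0 when its tail is in the last layer; the rescaling by [etop] makes up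
    for this. *)
Lemma layer_framing_tail (e : edge G) : tail e != None ->
  (0 < layer_framing e + (head e == None))%N.
Proof.
move=> _; have [he|/layer_framing_head H] := eqVneq (head e) None; first by rewrite addn1.
by rewrite addn_gt0 H.
Qed.

End ClosedBraidGraph.

(* graph_homology F s i j is placed in degree i + j, and the graph algebra in
   degree 0; phi is the map through which the edge ring acts on the latter. *)
Theorem proposition2p3 (F : fieldType) (B : braid_graph) :
  let s : edge (closed_braid B) -> int := fun e => Posz (layer_framing e) in
  exists phi : {rmorphism edge_ring F s -> graph_algebra F (layered_graph B)},
    [/\ (forall c : laurent F, phi (edge_scalar s c) = algebra_scalar (layered_graph B) c),
        (forall e : edge (closed_braid B),
            phi (xvar F s e) = algebra_var F (first_link (@layer_framing B) e)),
        (exists f : {additive graph_homology F s 0 0 -> graph_algebra F (layered_graph B)},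
            bijective f /\
            (forall (a : edge_ring F s) (z : graph_homology F s 0 0),
                f (a *: z) = phi a * f z))
      & (forall i j : nat, (0 < i + j)%N -> forall z : graph_homology F s i j, z = 0)].
Proof.
(* Strand 0 carries a vertex, so some layer [k] exists, and its thick edge [inl k] serves as the
   default vertex. *)
move=> s; have [k _] := strand_vertex (ord0 : 'I_(width B).+1).
have deg_in v : #|[pred e : edge (closed_braid B) | head e == Some v]| =
    if thick v then 2 else 1%N.
  by rewrite closed_braid_in_degree card_positions_at.
have deg_out v : #|[pred e : edge (closed_braid B) | tail e == Some v]| =
    if thick v then 2 else 1%N.
  by rewrite closed_braid_out_degree card_positions_at.
exact: (@framed_graph_homology F (closed_braid B) (@layer_framing B) (inl k)
  deg_in deg_out (@layer_framing_head B) (@layer_framing_tail B)).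
Qed.
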